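(* Let $s\ge 0$. The dual space $(B^s)'$ of the spectral Barron space $B^s$ can be identified, both algebraically and topologically, with the space $\tilde B^{-s}$. That is: every $f\in\tilde B^{-s}$, which acts on $\varphi\in\mathscr S$ by $$\langle f,\varphi\rangle=\int_{\mathbb R^n}\left[\langle\xi\rangle^{-s}\mathscr F^{-1}f(\xi)\right]\left[\langle\xi\rangle^{s}\hat\varphi(\xi)\right]d\xi ,$$ extends uniquely to a bounded linear functional on $B^s$, and the resulting map $\tilde B^{-s}\to (B^s)'$ is a linear bijection which is a homeomorphism for the norm topologies.
   Context: Functions are complex valued on $\mathbb R^n$. $\mathscr S$ is the Schwartz space on $\mathbb R^n$, $\mathscr S'$ the space of tempered distributions, $\langle\cdot,\cdot\rangle$ the (bilinear) pairing between them. The Fourier transform is $\hat\varphi(\xi)=\mathscr F\varphi(\xi)=\int_{\mathbb R^n}e^{-ix\cdot\xi}\varphi(x)\,dx$, with inverse $\mathscr F^{-1}\varphi(\xi)=(2\pi)^{-n}\int_{\mathbb R^n}e^{ix\cdot\xi}\varphi(x)\,dx$, both extended to $\mathscr S'$ by duality ($\langle \hat f,\varphi\rangle=\langle f,\hat\varphi\rangle$, and similarly for $\mathscr F^{-1}$). $\langle\xi\rangle=\sqrt{1+|\xi|^2}$. $C_b^0$ is the space of bounded continuous functions on $\mathbb R^n$. For $s\ge0$, $$B^s=\{f\in C_b^0:\ \langle\xi\rangle^s\hat f\in L^1(\mathbb R^n)\},\qquad \|f\|_{B^s}=\|\langle\xi\rangle^s\hat f\|_{L^1},$$ a Banach space containing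 $\mathscr S$, and $$\tilde B^{-s}=\{f\in\mathscr S':\ \langle\xi\rangle^{-s}\mathscr F^{-1}f\in L^\infty(\mathbb R^n)\},\qquad \|f\|_{\tilde B^{-s}}=\|\langle\xi\rangle^{-s}\mathscr F^{-1}f\|_{L^\infty}.$$ *)

(* Defs.v *)
(* MathComp / MathComp-Analysis; complex numbers are R[i] from real-closed. *)
From HB Require Import structures.
From mathcomp Require Import all_boot all_order all_algebra.
From mathcomp Require Import all_classical all_reals all_analysis.
From mathcomp Require Import complex.
Set Implicit Arguments. Unset Strict Implicit. Unset Printing Implicit Defensive.
Import Order.TTheory GRing.Theory Num.Theory.
Import numFieldNormedType.Exports.
Local Open Scope classical_set_scope.
Local Open Scope ring_scope.

(* 'rV[T]_n carries the product sigma-algebra, exactly as the library does for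
   n.-tuple T; for T = R it is the Borel sigma-algebra of R^n. *)
Definition measure_rV_display : measure_display -> measure_display.
Proof. exact. Qed.

Section measurable_rV.
Context {d} {T : sigmaRingType d} (n : nat).

Definition rV_coord (i : 'I_n) (x : 'rV[T]_n) : T := x ord0 i.

HB.instance Definition _ := @isMeasurable.Build (measure_rV_display d)
  'rV[T]_n (g_sigma_preimage rV_coord) (@sigma_algebra0 _ _ _)
  (@sigma_algebraC _ _) (@sigma_algebra_bigcup _ _ _).

End measurable_rV.

Lemma measurable_rV_coord d (T : sigmaRingType d) n (i : 'I_n) :
  measurable_fun [set: 'rV[T]_n] (rV_coord i).
Proof.
move=> _ Y mY; rewrite setTI; apply: sub_sigma_algebra => /=.
rewrite -bigcup_seq/=; exists i => /=; first by rewrite mem_index_enum.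
by exists Y => //; rewrite setTI.
Qed.

Lemma measurable_fun_rVP d1 d2 (T1 : measurableType d1)
    (T2 : measurableType d2) n (f : T1 -> 'rV[T2]_n) :
  (forall i, measurable_fun [set: T1] (rV_coord i \o f)) ->
  measurable_fun [set: T1] f.
Proof.
move=> mf _ A mA; rewrite setTI; apply: (mA [set B | measurable (f @^-1` B)]).
split; first split => /=.
- by rewrite preimage_set0.
- by move=> B mB; rewrite setTD preimage_setC; exact: measurableC.
- by move=> F mF; rewrite preimage_bigcup; exact: bigcup_measurable.
- move=> B; rewrite -bigcup_seq => -[i /= _] [C mC <-].
  by rewrite setTI -comp_preimage -[X in measurable X]setTI; exact: mf.
Qed.

(* Reproved because the library's own SigmaFiniteMeasure instance on m1 \x m2 is
   shadowed by the one for subprobabilities. *)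
Lemma product_measure1_sigma_finite d1 d2 (T1 : measurableType d1)
    (T2 : measurableType d2) (R : realType)
    (m1 : {sigma_finite_measure set T1 -> \bar R})
    (m2 : {sigma_finite_measure set T2 -> \bar R}) :
  sigma_finite setT (m1 \x m2)%E.
Proof.
have /sigma_finiteP[F [TF ndF Foo]] := sigma_finiteT m1.
have /sigma_finiteP[G [TG ndG Goo]] := sigma_finiteT m2.
exists (fun n => F n `*` G n).
  rewrite -setXTT TF TG predeqE => -[x y]; split.
    move=> [/= [n _ Fnx] [k _ Gky]]; exists (maxn n k) => //; split.
    - by move: x Fnx; exact/subsetPset/ndF/leq_maxl.
    - by move: y Gky; exact/subsetPset/ndG/leq_maxr.
  by move=> [n _ []/= ? ?]; split; exists n.
move=> k; have [? ?] := Foo k; have [? ?] := Goo k.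
split; first exact: measurableX.
by rewrite product_measure1E// lte_mul_pinfty// ge0_fin_numE.
Qed.

Section lebesgue_rV.
Context {R : realType}.

Definition rV_cons n (p : R * 'rV[R]_n) :
    'rV[R]_n.+1 :=
  \row_i oapp (p.2 ord0) p.1 (unlift ord0 i).

Definition rV_uncons n (x : 'rV[R]_n.+1) :
    R * 'rV[R]_n :=
  (x ord0 ord0, \row_j x ord0 (lift ord0 j)).

Lemma rV_consK n : cancel (@rV_cons n) (@rV_uncons n).
Proof.
move=> [a y]; rewrite /rV_uncons /rV_cons mxE unlift_none /=; congr pair.
by apply/rowP => j; rewrite !mxE liftK.
Qed.

Lemma rV_unconsK n : cancel (@rV_uncons n) (@rV_cons n).
Proof.
move=> x; apply/rowP => i; rewrite mxE /rV_uncons /=.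
by case: unliftP => [j ->|->] //=; rewrite mxE.
Qed.

Lemma measurable_rV_cons n : measurable_fun setT (@rV_cons n).
Proof.
apply: measurable_fun_rVP => i.
case: (unliftP ord0 i) => [j ij|i0].
  rewrite (_ : _ \o _ = rV_coord j \o snd); last first.
    by apply/funext => p /=; rewrite /rV_coord /rV_cons mxE ij liftK.
  by apply: measurableT_comp; [exact: measurable_rV_coord|exact: measurable_snd].
rewrite (_ : _ \o _ = fst); first exact: measurable_fst.
by apply/funext => p /=; rewrite /rV_coord /rV_cons mxE i0 unlift_none.
Qed.

Lemma measurable_rV_uncons n : measurable_fun setT (@rV_uncons n).
Proof.
apply: measurable_fun_pair; first exact: (measurable_rV_coord ord0).
apply: measurable_fun_rVP => j.
rewrite (_ : _ \o _ = rV_coord (lift ord0 j)); first exact: measurable_rV_coord.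
by apply/funext => x /=; rewrite /rV_coord mxE.
Qed.

Section step.
Variables (n : nat)
  (m : {sigma_finite_measure set 'rV[R]_n -> \bar R}).

Definition lebesgue_rV_step : set 'rV[R]_n.+1 -> \bar R :=
  pushforward (@lebesgue_measure R \x m)%E (@rV_cons n).

HB.instance Definition _ := Measure.copy lebesgue_rV_step
  (measure_function_pushforward__canonical__measure_function_Measure
    (@lebesgue_measure R \x m)%E (@measurable_rV_cons n)).

Lemma lebesgue_rV_step_sigma_finite : sigma_finite setT lebesgue_rV_step.
Proof.
have [F FT mF] := product_measure1_sigma_finite (@lebesgue_measure R) m.
exists (fun k => @rV_uncons n @^-1` F k).
  by rewrite -preimage_bigcup -FT preimage_setT.
move=> k; have [mFk Fk_oo] := mF k; split.
  by rewrite -[X in measurable X]setTI; exact: measurable_rV_uncons.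
rewrite /lebesgue_rV_step /pushforward -comp_preimage.
rewrite (_ : _ @^-1` _ = F k) //; apply/seteqP.
by split => p /=; rewrite rV_consK.
Qed.

HB.instance Definition _ := Measure_isSigmaFinite.Build _ _ _ lebesgue_rV_step
  lebesgue_rV_step_sigma_finite.

End step.

(* n-dimensional Lebesgue measure: lambda^0 is the point mass on the one-point
   space, and lambda^(n+1) is lambda \x lambda^n transported along
   R * R^n -> R^(n+1). *)
Fixpoint lebesgue_rV n :
    {sigma_finite_measure set 'rV[R]_n -> \bar R} :=
  if n is n'.+1 then lebesgue_rV_step (lebesgue_rV n')
  else @dirac _ 'rV[R]_0 (0 : 'rV[R]_0) R.

End lebesgue_rV.

(* R[i]^o, rather than R[i], is the type on which the library finds both the
   topology/norm of the field R[i] and its structure of R[i]-vector space. *)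
Notation euclid R n := ('rV[R]_n).
Notation cplx R := (R[i]^o).
Notation cfun R n := (euclid R n -> cplx R).
Notation normc := ComplexField.Normc.normc.

Local Open Scope complex_scope.

Section complex_integral.
Context {R : realType} {n : nat}.
Implicit Types f : cfun R n.

Definition re f : euclid R n -> R := fun x => complex.Re (f x).
Definition im f : euclid R n -> R := fun x => complex.Im (f x).

Definition cmeasurable f :=
  measurable_fun setT (re f) /\ measurable_fun setT (im f).

Definition cintegrable f :=
  (lebesgue_rV n).-integrable setT (EFin \o re f) /\
  (lebesgue_rV n).-integrable setT (EFin \o im f).

Definition cintegral f : cplx R :=
  (\int[lebesgue_rV n]_x re f x) +i* (\int[lebesgue_rV n]_x im f x).

End complex_integral.

Section schwartz_space.
Context {R : realType} {n : nat}.
Implicit Types (f : cfun R n) (g : euclid R n -> R) (a b : seq 'I_n).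

(* A multi-index is represented by the sequence of its directions: the sequence
   b stands for the iterated partial derivative along its entries (order
   size b), and a for the monomial of degree size a. *)
Definition partial b g : euclid R n -> R :=
  foldr (fun i h => 'D_(delta_mx 0 i) h) g b.

Definition cpartial b f : cfun R n :=
  fun x => partial b (re f) x +i* partial b (im f) x.

Definition monomial a (x : euclid R n) : R := \prod_(i <- a) x 0 i.

Definition smooth g := forall b,
  continuous (partial b g) /\
  forall i x, derivable (partial b g) x (delta_mx 0 i).

Definition schwartz : set (cfun R n) :=
  [set f | [/\ smooth (re f), smooth (im f) &
    forall a b, exists M : R, forall x,
      `|monomial a x| * normc (cpartial b f x) <= M]].

(* f belongs to the basic neighbourhood of 0 given by the finitely many
   seminorms sup_x |x^a d^b f(x)|, |a|, |b| <= N, and the radius d. *)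
Definition schwartz_small (N : nat) (d : R) f :=
  forall a b, (size a <= N)%N -> (size b <= N)%N ->
  forall x, `|monomial a x| * normc (cpartial b f x) < d.

End schwartz_space.

Definition linear_on {K : pzRingType} {V W : lmodType K} (A : set V)
    (T : V -> W) :=
  forall (k : K) u v, A u -> A v -> T (k *: u + v) = k *: T u + T v.

Section tempered_distributions.
Context {R : realType} {n : nat}.
Local Notation functional := (cfun R n -> cplx R).
Implicit Types (f g phi : cfun R n) (u : functional).

(* A functional on a space A of functions is represented by a function on all of
   cfun R n that vanishes outside A, so that equality of functionals on A is
   Leibniz equality. *)
Definition tempered : set functional :=
  [set u | [/\ linear_on (V := cfun R n) (W := cplx R) schwartz u,
    (forall phi, schwartz phi -> forall e : R, 0 < e ->
       exists (N : nat) (d : R), 0 < d /\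
       forall psi, schwartz psi -> schwartz_small N d (psi - phi) ->
         normc (u psi - u phi) < e) &
    forall phi, ~ schwartz phi -> u phi = 0]].

Definition dot (x y : euclid R n) : R := \sum_i x 0 i * y 0 i.

Definition expi (t : R) : cplx R := cos t +i* sin t.

Definition fourier phi : cfun R n :=
  fun xi => cintegral (fun x => expi (- dot x xi) * phi x).

Definition inv_fourier phi : cfun R n :=
  fun xi => ((2 * pi) ^- n)%:C * cintegral (fun x => expi (dot x xi) * phi x).

Definition dist_fourier u : functional :=
  patch (fun=> 0) schwartz (fun phi => u (fourier phi)).

Definition dist_inv_fourier u : functional :=
  patch (fun=> 0) schwartz (fun phi => u (inv_fourier phi)).

Definition dist_of f : functional :=
  patch (fun=> 0) schwartz (fun phi => cintegral (fun x => f x * phi x)).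

(* The distribution u is (given by) the measurable function g. *)
Definition represents g u :=
  cmeasurable g /\ forall phi, schwartz phi ->
    cintegrable (fun x => g x * phi x) /\
    u phi = cintegral (fun x => g x * phi x).

(* When u is a function, that function (determined almost everywhere). *)
Definition density u : cfun R n := xget (fun=> 0) [set g | represents g u].

End tempered_distributions.

Section barron_spaces.
Context {R : realType} {n : nat} (s : R).
Local Notation functional := (cfun R n -> cplx R).
Implicit Types (f : cfun R n) (u : functional).

(* The norm of 'rV[R]_n is the sup norm, so <xi> is spelled out. *)
Definition japanese (xi : euclid R n) : R :=
  Num.sqrt (1 + \sum_i xi 0 i ^+ 2).

Definition barron_norm f : \bar R :=
  'N[lebesgue_rV n]_1[(fun xi => (japanese xi `^ s *
    normc (density (dist_fourier (dist_of f)) xi))%R%:E)]%E.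

Definition barron : set (cfun R n) :=
  [set f | [/\ continuous f, [bounded f x | x in setT],
    exists g, represents g (dist_fourier (dist_of f)) &
    (barron_norm f < +oo)%E]].

Definition tbarron_norm u : \bar R :=
  'N[lebesgue_rV n]_(+oo)[(fun xi => (japanese xi `^ (- s) *
    normc (density (dist_inv_fourier u) xi))%R%:E)]%E.

Definition tbarron : set functional :=
  [set u | [/\ tempered u, exists g, represents g (dist_inv_fourier u) &
    (tbarron_norm u < +oo)%E]].

End barron_spaces.

Section normed_duals.
Context {R : realType}.
Local Open Scope ereal_scope.

Definition normwise_continuous {V W : lmodType R[i]} (A : set V) (NV : V -> \bar R)
    (NW : W -> \bar R) (T : V -> W) :=
  forall u, A u -> forall e : R, (0 < e)%R ->
  exists2 d : R, (0 < d)%R &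
  forall v, A v -> NV (v - u)%R < d%:E -> NW (T v - T u)%R < e%:E.

Context {V : lmodType R[i]} (A : set V) (N : V -> \bar R).

(* Functionals vanish outside A, as above. *)
Definition dual_space : set (V -> cplx R) :=
  [set L | [/\ linear_on (W := cplx R) A L,
    (exists M : R, forall v, A v -> (normc (L v))%:E <= M%:E * N v) &
    forall v, ~ A v -> L v = 0%R]].

Definition dual_norm (L : V -> cplx R) : \bar R :=
  ereal_sup [set (normc (L v))%:E | v in [set v | A v /\ N v <= 1]].

End normed_duals.

(* Main.v *)
(* Inversion turns B^s into a weighted L^1 space: v lies in B^s iff v is the inverse
   Fourier transform of some h with <xi>^s h integrable, and then h is the transform of v.
   A bounded functional L on B^s thus becomes the bounded functional h |-> L (F^-1 h) on
   this weighted L^1 space, so by Radon-Nikodym it is integration against a measurable g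
   with |g| <= C <xi>^s, and g is the inverse Fourier transform of the distribution
   obtained by restricting L to the Schwartz space. Conversely an f in B~^{-s} extends to B^s by
   integrating F^-1 f against the transform of v.
   Uniqueness statements all rest on one fact: a measurable function orthogonal to every
   Gaussian vanishes almost everywhere. Fourier inversion follows from it by duality, as
   the transforms of Gaussians are explicit. *)
From HB Require Import structures.
Require Import Defs.
From mathcomp Require Import all_boot all_order all_algebra.
From mathcomp Require Import all_classical all_reals all_analysis.
From mathcomp Require Import complex.
From mathcomp Require Import measurable_realfun ess_sup_inf.
From mathcomp Require Import ring lra.
Set Implicit Arguments. Unset Strict Implicit. Unset Printing Implicit Defensive.
Import Order.TTheory GRing.Theory Num.Theory.
Import numFieldNormedType.Exports.
Local Open Scope classical_set_scope.
Local Open Scope ring_scope.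
Local Open Scope complex_scope.

(** A density is a chosen representative, determined only up to null sets. Statements are therefore
    made about every function that [represents] a distribution, and almost-everywhere uniqueness
    links the different choices. Lebesgue measure on R^n is only sigma-finite for n > 0, and the
    indicator of a set of infinite measure is not in L^1. Before Radon-Nikodym, indicators are
    multiplied by a strictly positive integrable function, the inverse of the product of the 1 +
    x_i^2. This product also replaces <x> in most estimates: it is a polynomial, so it preserves the
    Schwartz class, and its inverse is integrated coordinate by coordinate. The real and imaginary
    parts of a functional are represented separately. This is where |g| <= 2 M <xi>^s comes from
    when M bounds the functional, and such a factor is harmless for a homeomorphism. The restriction
    of L to the Schwartz space must be continuous for the Schwartz seminorms. This follows from a
    bound of the B^s norm by finitely many of them, obtained through integration by parts. *)

Notation intg mu f := (mu.-integrable setT (EFin \o f)).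

(** * Real and complex integrals on R^n *)

Section real_integral.
Context d (T : measurableType d) (R : realType) (mu : {measure set T -> \bar R}).
Implicit Types f g : T -> R.

Lemma intg_measurable f : intg mu f -> measurable_fun setT f.
Proof. by move=> /integrableP[/measurable_EFinP]. Qed.

Lemma intg_le f g : measurable_fun setT f -> (forall x, `|f x| <= g x) ->
  intg mu g -> intg mu f.
Proof.
move=> mf fg ig; apply: le_integrable ig => //; first exact/measurable_EFinP.
by move=> x _ /=; rewrite lee_fin (le_trans (fg x))// ler_norm.
Qed.

Lemma intgD f g : intg mu f -> intg mu g -> intg mu (fun x => f x + g x).
Proof.
move=> fi gi; rewrite (_ : _ \o _ = (EFin \o f) \+ (EFin \o g))%E//.
exact: integrableD.
Qed.

Lemma intgN f : intg mu f -> intg mu (fun x => - f x).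
Proof.
move=> fi; rewrite (_ : _ \o _ = \- (EFin \o f))%E//; exact: integrableN.
Qed.

Lemma intgB f g : intg mu f -> intg mu g -> intg mu (fun x => f x - g x).
Proof. by move=> fi gi; apply: intgD => //; exact: intgN. Qed.

Lemma intgZ (r : R) f : intg mu f -> intg mu (fun x => r * f x).
Proof.
move=> fi; rewrite (_ : _ \o _ = (fun x => r%:E * (EFin \o f) x))%E//.
exact: integrableZl.
Qed.

Lemma intg_norm f : intg mu f -> intg mu (fun x => `|f x|).
Proof.
by move=> fi; rewrite (_ : _ \o _ = (abse \o (EFin \o f)))%E//; exact: integrable_abse.
Qed.

Lemma intg_bounded_mul (M : R) f g : measurable_fun setT g ->
  (forall x, `|g x| <= M) -> intg mu f -> intg mu (fun x => f x * g x).
Proof.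
move=> mg gM fi; apply: (@intg_le _ (fun x => M * `|f x|)).
- by apply: measurable_funM => //; exact: intg_measurable.
- by move=> x; rewrite normrM mulrC ler_wpM2r.
- exact/intgZ/intg_norm.
Qed.

Lemma intg_sum (I : Type) (r : seq I) (F : I -> T -> R) :
  (forall i, intg mu (F i)) -> intg mu (fun x => \sum_(i <- r) F i x).
Proof.
move=> Fi; elim: r => [|i r ih].
  rewrite (_ : _ \o _ = cst 0%E); last by apply/funext => x /=; rewrite big_nil.
  exact: integrable0.
rewrite (_ : (fun x => _) = fun x => F i x + \sum_(i <- r) F i x).
  exact: intgD.
by apply/funext => x; rewrite big_cons.
Qed.

Lemma RintegralN f : intg mu f -> \int[mu]_x (- f x) = - \int[mu]_x f x.
Proof.
move=> fi; under eq_Rintegral do rewrite -mulN1r.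
by rewrite RintegralZl// mulN1r.
Qed.

Lemma EFin_Rintegral f : intg mu f ->
  (\int[mu]_x f x)%:E = (\int[mu]_x (f x)%:E)%E.
Proof. by move=> fi; rewrite fineK//; exact: integrable_fin_num. Qed.

Lemma ae_eq_Rintegral f g : measurable_fun setT f -> measurable_fun setT g ->
  {ae mu, forall x, f x = g x} -> \int[mu]_x f x = \int[mu]_x g x.
Proof.
move=> mf mg fg; congr fine; apply: ae_eq_integral => //.
- exact/measurable_EFinP.
- exact/measurable_EFinP.
- by apply: filterS fg => x /= -> _.
Qed.

Lemma ae_eq_intg f g : measurable_fun setT g ->
  {ae mu, forall x, f x = g x} -> intg mu f -> intg mu g.
Proof.
move=> mg fg /integrableP[mf fi]; apply/integrableP; split.
  exact/measurable_EFinP.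
rewrite (le_lt_trans _ fi)// le_eqVlt; apply/orP; left; apply/eqP.
apply: ae_eq_integral => //; [| |by apply: filterS fg => x /= -> _].
- by apply: measurableT_comp => //; exact/measurable_EFinP.
- exact: measurableT_comp.
Qed.

Lemma Rintegral_ae_eq0 f : intg mu f -> \int[mu]_x `|f x| = 0 ->
  {ae mu, forall x, f x = 0}.
Proof.
move=> fi f0; have : ae_eq mu setT (EFin \o f) (cst 0%E).
  apply/ae_eq_integral_abs => //; first exact: measurable_int fi.
  have /= := EFin_Rintegral (intg_norm fi); rewrite f0 => <-//.
by apply: filterS => x /(_ I) /= [].
Qed.

Lemma dominated_cvg_Rintegral (f_ : nat -> T -> R) f g :
  (forall n, measurable_fun setT (f_ n)) ->
  (forall x, f_ n x @[n --> \oo] --> f x) -> intg mu g ->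
  (forall n x, `|f_ n x| <= g x) ->
  intg mu f /\ \int[mu]_x f_ n x @[n --> \oo] --> \int[mu]_x f x.
Proof.
move=> mf_ ff gi fg.
have mf : measurable_fun setT f by apply: measurable_fun_cvg => // x _; exact: ff.
have fi : intg mu f.
  apply: (@intg_le _ g) => // x.
  have := @cvg_norm _ _ _ _ _ _ _ (ff x) => /(_ _) nf.
  rewrite -(cvg_lim _ nf)//; apply: limr_le; first by apply/cvg_ex; exists `|f x|.
  by apply: nearW => n; exact: fg.
split=> //.
apply: fine_cvg; rewrite EFin_Rintegral//.
apply: (@dominated_cvg _ _ _ mu _ _ (fun n x => (f_ n x)%:E) _ (EFin \o g)) => //.
- by move=> n; exact/measurable_EFinP.
- by move=> x _; apply: cvg_EFin; [exact: nearW|exact: ff].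
- by move=> n x _; rewrite lee_fin.
Qed.

End real_integral.

(** * Borel sets of R^n and iterated integrals *)

Section measurable_rV.
Context (R : realType) (n : nat).

(** The sigma-algebra is generated by the coordinates. An open set belongs to it as the union of
    those boxes contained in it that have a rational centre and a radius 1/(k+1), which are
    countably many. *)
Lemma open_measurable_rV (A : set 'rV[R]_n) : open A -> measurable A.
Proof.
move=> oA.
pose box (p : 'rV[rat]_n * nat) : set 'rV[R]_n :=
  [set x | forall i, `|x ord0 i - ratr (p.1 ord0 i)| < p.2.+1%:R^-1].
have mbox p : measurable (box p).
  rewrite (_ : box p = \bigcap_(i in [set: 'I_n])
      (@rV_coord _ R n i @^-1` ball (ratr (p.1 ord0 i) : R) p.2.+1%:R^-1)).
    apply: fin_bigcap_measurable => // i _.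
    rewrite -[X in measurable X]setTI; apply: measurable_rV_coord => //.
    exact: measurable_ball.
  apply/seteqP; split => x /=.
    by move=> bx i _ /=; rewrite /ball/= distrC; exact: bx.
  by move=> bx i; have := bx i I; rewrite /ball/= distrC.
rewrite (_ : A = \bigcup_p (if `[< box p `<=` A >] then box p else set0)).
  by apply: countable_bigcupT_measurable => // p; case: ifP.
apply/seteqP; split => [x Ax|x [p _ /=]]; last first.
  by case: asboolP => // pA; exact: pA.
have /nbhs_ballP[e /= e0 xA] : nbhs x A by exact: open_nbhs_nbhs.
have e20 : 0 < e / 2 by rewrite divr_gt0.
(* A box of radius 1/(k+1) < e/2 whose rational centre is that close to x contains x and stays
   inside the ball of radius e. *)
have [k _ ke] := near_infty_natSinv_lt (PosNum e20).
have {}ke := ke k (leqnn k).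
have k0 : 0 < k.+1%:R^-1 :> R by rewrite invr_gt0.
have /choice[q xq] i : exists r : rat, `|x ord0 i - ratr r| < k.+1%:R^-1.
  have /rat_in_itvoo[r] : x ord0 i - k.+1%:R^-1 < x ord0 i + k.+1%:R^-1.
    by rewrite ltrBlDr -addrA ltrDl addr_gt0.
  rewrite in_itv/= => /andP[r1 r2]; exists r.
  by rewrite ltr_distlC r1.
exists (\row_i q i, k) => //; case: asboolP => /= [_ i|]; first by rewrite mxE.
case=> y yb; apply: xA; split=> // i j; rewrite ord1 /ball/=.
have := yb j; have := xq j; rewrite /= mxE => xqj yqj.
rewrite -(subrKA (ratr (q j))) (le_lt_trans (ler_normD _ _))//.
by rewrite [ltRHS](splitr e) ltrD ?(lt_trans _ ke)// distrC.
Qed.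

Lemma continuous_measurable_rV (f : 'rV[R]_n -> R) : continuous f ->
  measurable_fun setT f.
Proof.
move=> /continuousP cf.
apply: (measurability (@RGenOpens.G R)); first exact: RGenOpens.measurableE.
move=> _ [_ [a [b ->] <-]]; rewrite setTI; apply: open_measurable_rV.
by apply: cf; exact: interval_open.
Qed.

End measurable_rV.

Section lebesgue_rV_succ.
Context (R : realType) (n : nat).
Local Notation leb := (@lebesgue_measure R).

(** [lebesgue_rV n.+1] is by construction the image of a product measure under [rV_cons], so a
    change of variables followed by Tonelli applies. *)
Lemma ge0_integral_rVS (f : 'rV[R]_n.+1 -> \bar R) :
  measurable_fun setT f -> (forall x, 0 <= f x)%E ->
  (\int[lebesgue_rV n.+1]_x f x =
   \int[leb]_a \int[lebesgue_rV n]_y f (rV_cons (a, y)))%E.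
Proof.
move=> mf f0.
transitivity (\int[pushforward (leb \x lebesgue_rV n) (@rV_cons R n)]_x f x)%E.
  by [].
rewrite ge0_integral_pushforward//; last exact: measurable_rV_cons.
rewrite preimage_setT fubini_tonelli1//; last by move=> p; exact: f0.
by apply: measurableT_comp => //; exact: measurable_rV_cons.
Qed.

Lemma integrable_rVS (f : 'rV[R]_n.+1 -> \bar R) :
  (lebesgue_rV n.+1).-integrable setT f ->
  (leb \x lebesgue_rV n)%E.-integrable setT (f \o @rV_cons R n).
Proof.
move=> /integrableP[mf fi].
have mfc : measurable_fun setT (f \o @rV_cons R n).
  by apply: measurableT_comp => //; exact: measurable_rV_cons.
apply/integrableP; split => //; rewrite fubini_tonelli1//.
- by rewrite ge0_integral_rVS// in fi; exact: measurableT_comp.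
- exact: measurableT_comp.
Qed.

Lemma integral_rVS (f : 'rV[R]_n.+1 -> \bar R) :
  (lebesgue_rV n.+1).-integrable setT f ->
  (\int[lebesgue_rV n.+1]_x f x =
   \int[leb]_a \int[lebesgue_rV n]_y f (rV_cons (a, y)))%E.
Proof.
move=> fi; have fci := integrable_rVS fi.
transitivity (\int[pushforward (leb \x lebesgue_rV n) (@rV_cons R n)]_x f x)%E.
  by [].
rewrite integral_pushforward//; last 2 first.
- exact: measurable_rV_cons.
- exact: measurable_int fi.
by rewrite preimage_setT -integral12_prod_meas1.
Qed.

End lebesgue_rV_succ.

Section real_fubini.
Context d1 d2 (T1 : measurableType d1) (T2 : measurableType d2) (R : realType).
Variables (m1 : {sigma_finite_measure set T1 -> \bar R})
  (m2 : {sigma_finite_measure set T2 -> \bar R}).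
Implicit Types f : T1 * T2 -> R.

(** With every slice integrable, the inner real integral coincides with the extended one at every
    point, so Fubini for extended reals transfers through [fine]. *)
Lemma Rintegral_prod12 f : intg (m1 \x m2)%E f ->
  (forall x, intg m2 (fun y => f (x, y))) ->
  intg m1 (fun x => \int[m2]_y f (x, y)) /\
  \int[(m1 \x m2)%E]_p f p = \int[m1]_x \int[m2]_y f (x, y).
Proof.
move=> fi f2i.
have E : fubini_F m2 (EFin \o f) = EFin \o (fun x => \int[m2]_y f (x, y)).
  by apply/funext => x; rewrite /= EFin_Rintegral.
split; first by rewrite -E; exact: integrable_fubini_F.
by congr fine; rewrite -(integral12_prod_meas1 fi) E.
Qed.

Lemma Rintegral_prod21 f : intg (m1 \x m2)%E f ->
  (forall y, intg m1 (fun x => f (x, y))) ->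
  intg m2 (fun y => \int[m1]_x f (x, y)) /\
  \int[(m1 \x m2)%E]_p f p = \int[m2]_y \int[m1]_x f (x, y).
Proof.
move=> fi f1i.
have E : fubini_G m1 (EFin \o f) = EFin \o (fun y => \int[m1]_x f (x, y)).
  by apply/funext => y; rewrite /= EFin_Rintegral.
have mG := measurable_fubini_G fi.
(* The inner integral is dominated in absolute value by the inner integral of |f|, whose integral is
   finite by Tonelli. *)
split; first rewrite -E.
  have mnf : measurable_fun setT (abse \o (EFin \o f)).
    by apply: measurableT_comp => //; exact: measurable_int fi.
  apply/integrableP; split => //.
  apply: le_lt_trans ((integrable21ltyP _ _ (measurable_int _ fi)).1 fi).
  apply: ge0_le_integral => //.
  - exact: measurableT_comp.
  - by apply: (measurable_fun_fubini_tonelli_G (abse \o (EFin \o f)) mnf) => x /=.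
  - move=> y _; apply: le_abse_integral => //.
    exact: measurable_int (f1i y).
by congr fine; rewrite -(integral21_prod_meas1 fi) E.
Qed.

Lemma intg_prod_mul (f : T1 -> R) (g : T2 -> R) : intg m1 f -> intg m2 g ->
  intg (m1 \x m2)%E (fun p => f p.1 * g p.2).
Proof.
move=> fi gi; have mf := intg_measurable fi; have mg := intg_measurable gi.
have mfg : measurable_fun setT (fun p : T1 * T2 => f p.1 * g p.2).
  apply: measurable_funM; first exact: measurableT_comp measurable_fst.
  exact: measurableT_comp measurable_snd.
apply/integrable12ltyP; first exact/measurable_EFinP.
under eq_integral => x _.
  under eq_integral => y _ do rewrite /= normrM EFinM.
  rewrite ge0_integralZl//; last exact/measurable_EFinP/measurableT_comp.
  rewrite -EFin_Rintegral; last exact: intg_norm.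
  over.
rewrite ge0_integralZr//; last 2 first.
- exact/measurable_EFinP/measurableT_comp.
- by rewrite lee_fin; exact: Rintegral_ge0.
by rewrite -EFin_Rintegral ?ltry//; exact: intg_norm.
Qed.

End real_fubini.

(** * Complex-valued functions: modulus, integral, Fubini *)

Section complex_numbers.
Context (R : realType).
Implicit Types x y : cplx R.
Local Notation Re := (@complex.Re R).
Local Notation Im := (@complex.Im R).

Lemma cReD x y : Re (x + y) = Re x + Re y. Proof. by case: x y => ? ? []. Qed.
Lemma cImD x y : Im (x + y) = Im x + Im y. Proof. by case: x y => ? ? []. Qed.
Lemma cReN x : Re (- x) = - Re x. Proof. by case: x. Qed.
Lemma cImN x : Im (- x) = - Im x. Proof. by case: x. Qed.
Lemma cReM x y : Re (x * y) = Re x * Re y - Im x * Im y.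
Proof. by case: x y => ? ? []. Qed.
Lemma cImM x y : Im (x * y) = Re x * Im y + Im x * Re y.
Proof. by case: x y => ? ? []. Qed.
Lemma complex_eq x y : Re x = Re y -> Im x = Im y -> x = y.
Proof. by case: x y => ? ? [? ?] /= -> ->. Qed.

Lemma normc_ReIm x : normc x = Num.sqrt (Re x ^+ 2 + Im x ^+ 2).
Proof. by case: x. Qed.

Lemma normc_ge0 x : 0 <= normc x.
Proof. by rewrite normc_ReIm sqrtr_ge0. Qed.

Lemma normc_abs x : (normc x)%:C = `|x : R[i]|.
Proof. by case: x. Qed.

Lemma normcD x y : normc (x + y) <= normc x + normc y.
Proof. by rewrite -lecR rmorphD /= !normc_abs; exact: ler_normD. Qed.

Lemma normcN x : normc (- x) = normc x.
Proof. by case: x => a b /=; rewrite !sqrrN. Qed.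

Lemma normcR (r : R) : normc r%:C = `|r|.
Proof. by rewrite /= expr0n addr0 sqrtr_sqr. Qed.

Lemma normRe_le x : `|Re x| <= normc x.
Proof. by rewrite normc_ReIm -sqrtr_sqr ler_wsqrtr// lerDl sqr_ge0. Qed.

Lemma normIm_le x : `|Im x| <= normc x.
Proof. by rewrite normc_ReIm -sqrtr_sqr ler_wsqrtr// lerDr sqr_ge0. Qed.

Lemma normc_le x : normc x <= `|Re x| + `|Im x|.
Proof.
rewrite normc_ReIm -[leRHS]ger0_norm ?addr_ge0// -sqrtr_sqr ler_wsqrtr//.
by rewrite sqrrD !real_normK ?num_real// -addrA lerD2l lerDr mulrn_wge0 ?mulr_ge0.
Qed.

Lemma normc_sqr x : normc x ^+ 2 = Re x ^+ 2 + Im x ^+ 2.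
Proof. by rewrite normc_ReIm sqr_sqrtr// addr_ge0 ?sqr_ge0. Qed.

End complex_numbers.

Section complex_integration.
Context d (T : measurableType d) (R : realType) (mu : {measure set T -> \bar R}).
Local Notation Re := (@complex.Re R).
Local Notation Im := (@complex.Im R).
Implicit Types (f g : T -> cplx R) (k : cplx R).

(** Together with [cintg] and [cint], these are [cmeasurable], [cintegrable] and [cintegral] over an
    arbitrary measure space, as Fubini works on products. On [lebesgue_rV n] they are convertible to
    the originals. *)
Definition cmeas f :=
  measurable_fun setT (fun x => Re (f x)) /\ measurable_fun setT (fun x => Im (f x)).

Definition cintg f := intg mu (fun x => Re (f x)) /\ intg mu (fun x => Im (f x)).

Definition cint f : cplx R := (\int[mu]_x Re (f x)) +i* (\int[mu]_x Im (f x)).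

Lemma cmeas_normc f : cmeas f -> measurable_fun setT (fun x => normc (f x)).
Proof.
move=> [mr mi]; under eq_fun do rewrite normc_ReIm.
apply: (measurableT_comp (continuous_measurable_fun (@sqrt_continuous R))).
by apply: measurable_funD; exact: measurable_funX.
Qed.

Lemma cmeasM f g : cmeas f -> cmeas g -> cmeas (fun x => f x * g x).
Proof.
move=> [fr fi] [gr gi]; split.
- under eq_fun do rewrite cReM.
  by apply: measurable_funB; exact: measurable_funM.
- under eq_fun do rewrite cImM.
  by apply: measurable_funD; exact: measurable_funM.
Qed.

Lemma cmeasD f g : cmeas f -> cmeas g -> cmeas (fun x => f x + g x).
Proof.
move=> [fr fi] [gr gi]; split.
- by under eq_fun do rewrite cReD; exact: measurable_funD.
- by under eq_fun do rewrite cImD; exact: measurable_funD.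
Qed.

Lemma cmeas_cst k : cmeas (fun=> k).
Proof. by split; exact: measurable_cst. Qed.

Lemma cmeas_prod (I : Type) (r : seq I) (F : I -> T -> cplx R) :
  (forall i, cmeas (F i)) -> cmeas (fun x => \prod_(i <- r) F i x).
Proof.
move=> mF; elim: r => [|i r ih].
  by under eq_fun do rewrite big_nil; exact: cmeas_cst.
by under eq_fun do rewrite big_cons; exact: cmeasM.
Qed.

Lemma cmeas_real (f : T -> R) : measurable_fun setT f -> cmeas (fun x => (f x)%:C).
Proof. by move=> mf; split => //=; exact: measurable_cst. Qed.

Lemma cintg_cmeas f : cintg f -> cmeas f.
Proof. by move=> [fr fi]; split; [exact: intg_measurable fr|exact: intg_measurable fi]. Qed.

Lemma cintg_le f (g : T -> R) : cmeas f -> (forall x, normc (f x) <= g x) ->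
  intg mu g -> cintg f.
Proof.
move=> [mr mi] fg gi; split; apply: intg_le gi => // x.
- exact: le_trans (normRe_le _) (fg x).
- exact: le_trans (normIm_le _) (fg x).
Qed.

Lemma intg_normc f : cintg f -> intg mu (fun x => normc (f x)).
Proof.
move=> fi; apply: (@intg_le _ _ _ _ _ (fun x => `|Re (f x)| + `|Im (f x)|)).
- exact/cmeas_normc/cintg_cmeas.
- by move=> x; rewrite ger0_norm ?normc_ge0 ?normc_le.
- by case: fi => fr fi; apply: intgD; exact: intg_norm.
Qed.

Lemma cintgD f g : cintg f -> cintg g -> cintg (fun x => f x + g x).
Proof.
move=> [fr fi] [gr gi]; split.
- by under [_ \o _]eq_fun do rewrite /= cReD; exact: intgD.
- by under [_ \o _]eq_fun do rewrite /= cImD; exact: intgD.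
Qed.

Lemma cintg_mul_bounded (M : R) f g : cintg f -> cmeas g ->
  (forall x, normc (g x) <= M) -> cintg (fun x => f x * g x).
Proof.
move=> fi mg gM; apply: (@cintg_le _ (fun x => M * normc (f x))).
- by apply: cmeasM => //; exact: cintg_cmeas.
- move=> x; rewrite ComplexField.Normc.normcM mulrC.
  by rewrite ler_wpM2r ?normc_ge0.
- exact/intgZ/intg_normc.
Qed.

Lemma cintgZ k f : cintg f -> cintg (fun x => k * f x).
Proof.
move=> fi; rewrite (_ : (fun x => _) = (fun x => f x * k)); last first.
  by apply/funext => x; rewrite mulrC.
by apply: (@cintg_mul_bounded (normc k)) => //; exact: cmeas_cst.
Qed.

Lemma cintD f g : cintg f -> cintg g ->
  cint (fun x => f x + g x) = cint f + cint g.
Proof.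
move=> [fr fi] [gr gi]; apply: complex_eq; rewrite ?cReD ?cImD /=.
- by under eq_Rintegral do rewrite cReD; exact: RintegralD.
- by under eq_Rintegral do rewrite cImD; exact: RintegralD.
Qed.

Lemma cintZ k f : cintg f -> cint (fun x => k * f x) = k * cint f.
Proof.
move=> [fr fi]; apply: complex_eq; rewrite ?cReM ?cImM /=.
- under eq_Rintegral do rewrite cReM.
  by rewrite RintegralB ?RintegralZl//; exact: intgZ.
- under eq_Rintegral do rewrite cImM.
  by rewrite RintegralD ?RintegralZl//; exact: intgZ.
Qed.

Lemma cintZr k f : cintg f -> cint (fun x => f x * k) = cint f * k.
Proof. by move=> fi; under eq_fun do rewrite mulrC; rewrite cintZ// mulrC. Qed.

(* Multiplying by the conjugate of the integral makes the integral real. *)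
Lemma normc_cint f : cintg f -> normc (cint f) <= \int[mu]_x normc (f x).
Proof.
move=> fi; set z := cint f.
have [z0|z0] := eqVneq (normc z) 0.
  by rewrite z0; apply: Rintegral_ge0 => x _; exact: normc_ge0.
have zp : 0 < normc z by rewrite lt0r z0 normc_ge0.
rewrite -(ler_pM2l zp) -expr2 normc_sqr.
pose w : cplx R := (Re z) -i* (Im z).
have wz : normc w = normc z by rewrite !normc_ReIm /= sqrrN.
have -> : Re z ^+ 2 + Im z ^+ 2 = Re (w * z) by rewrite cReM /= mulNr opprK !expr2.
rewrite -cintZ//= -RintegralZl//; last exact: intg_normc.
apply: le_Rintegral => //.
- by case: (cintgZ w fi).
- exact/intgZ/intg_normc.
- move=> x _; rewrite (le_trans (ler_norm _))// (le_trans (normRe_le _))//.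
  by rewrite ComplexField.Normc.normcM wz.
Qed.

Lemma ae_eq_cint f g : cmeas f -> cmeas g -> {ae mu, forall x, f x = g x} ->
  cint f = cint g.
Proof.
move=> [? ?] [? ?] fg; apply: complex_eq => /=; apply: ae_eq_Rintegral => //;
  by apply: filterS fg => x /= ->.
Qed.

Lemma ae_eq_cintg f g : cmeas g -> {ae mu, forall x, f x = g x} ->
  cintg f -> cintg g.
Proof.
move=> [gr gi] fg [fr fi].
by split; [apply: ae_eq_intg fr|apply: ae_eq_intg fi] => //;
  apply: filterS fg => x /= ->.
Qed.

End complex_integration.

Lemma cmeas_comp d1 d2 (T1 : measurableType d1) (T2 : measurableType d2)
    (R : realType) (phi : T1 -> T2) (f : T2 -> cplx R) :
  measurable_fun setT phi -> cmeas f -> cmeas (fun x => f (phi x)).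
Proof.
by move=> mp [fr fi]; split; [exact: (measurableT_comp fr)|exact: (measurableT_comp fi)].
Qed.

Section complex_fubini.
Context d1 d2 (T1 : measurableType d1) (T2 : measurableType d2) (R : realType).
Variables (m1 : {sigma_finite_measure set T1 -> \bar R})
  (m2 : {sigma_finite_measure set T2 -> \bar R}).

Lemma cint_prod12 (f : T1 * T2 -> cplx R) : cintg (m1 \x m2)%E f ->
  (forall x, cintg m2 (fun y => f (x, y))) ->
  cintg m1 (fun x => cint m2 (fun y => f (x, y))) /\
  cint (m1 \x m2)%E f = cint m1 (fun x => cint m2 (fun y => f (x, y))).
Proof.
move=> [fr fi] f2.
have [r1 r2] := Rintegral_prod12 fr (fun x => (f2 x).1).
have [i1 i2] := Rintegral_prod12 fi (fun x => (f2 x).2).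
by split=> //; apply: complex_eq.
Qed.

Lemma cint_prod21 (f : T1 * T2 -> cplx R) : cintg (m1 \x m2)%E f ->
  (forall y, cintg m1 (fun x => f (x, y))) ->
  cintg m2 (fun y => cint m1 (fun x => f (x, y))) /\
  cint (m1 \x m2)%E f = cint m2 (fun y => cint m1 (fun x => f (x, y))).
Proof.
move=> [fr fi] f1.
have [r1 r2] := Rintegral_prod21 fr (fun x => (f1 x).1).
have [i1 i2] := Rintegral_prod21 fi (fun x => (f1 x).2).
by split=> //; apply: complex_eq.
Qed.

Lemma cintg_prod_mul (f : T1 -> cplx R) (g : T2 -> cplx R) :
  cintg m1 f -> cintg m2 g -> cintg (m1 \x m2)%E (fun p => f p.1 * g p.2).
Proof.
move=> fi gi; have [fr fm] := cintg_cmeas fi; have [gr gm] := cintg_cmeas gi.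
apply: (cintg_le (g := fun p => normc (f p.1) * normc (g p.2))).
- by apply: cmeasM; [apply: (cmeas_comp measurable_fst)|
    apply: (cmeas_comp measurable_snd)]; split.
- by move=> p; rewrite ComplexField.Normc.normcM.
- exact: (intg_prod_mul (intg_normc fi) (intg_normc gi)).
Qed.

End complex_fubini.

Section rV_succ.
Context (R : realType) (n : nat).
Local Notation leb := (@lebesgue_measure R).

Lemma intg_rVS (f : 'rV[R]_n.+1 -> R) : intg (lebesgue_rV n.+1) f ->
  intg (leb \x lebesgue_rV n)%E (f \o @rV_cons R n) /\
  \int[lebesgue_rV n.+1]_x f x =
    \int[(leb \x lebesgue_rV n)%E]_p f (rV_cons p).
Proof.
move=> fi; have fci := integrable_rVS fi; split => //.
by congr fine; rewrite integral_rVS// -(integral12_prod_meas1 fci).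
Qed.

Lemma intg_rVS_inv (f : 'rV[R]_n.+1 -> R) : measurable_fun setT f ->
  intg (leb \x lebesgue_rV n)%E (f \o @rV_cons R n) ->
  intg (lebesgue_rV n.+1) f.
Proof.
move=> mf /integrableP[_ fi]; apply/integrableP; split; first exact/measurable_EFinP.
have mnf : measurable_fun setT (fun x => `|(EFin \o f) x|%E).
  by apply: measurableT_comp => //; exact/measurable_EFinP.
rewrite ge0_integral_rVS//.
rewrite fubini_tonelli1// in fi.
apply: (measurableT_comp mnf); exact: measurable_rV_cons.
Qed.

Lemma cint_rVS (f : 'rV[R]_n.+1 -> cplx R) : cintg (lebesgue_rV n.+1) f ->
  cintg (leb \x lebesgue_rV n)%E (f \o @rV_cons R n) /\
  cint (lebesgue_rV n.+1) f = cint (leb \x lebesgue_rV n)%E (f \o @rV_cons R n).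
Proof.
move=> [/intg_rVS[r1 r2] /intg_rVS[i1 i2]].
by split=> //; apply: complex_eq.
Qed.

End rV_succ.

(** * Integrals of products of one-variable functions *)

Section tensor_integral.
Context (R : realType).
Local Notation leb := (@lebesgue_measure R).

Lemma rV_cons0 n (a : R) (y : 'rV[R]_n) : rV_cons (a, y) ord0 ord0 = a.
Proof. by rewrite /rV_cons mxE unlift_none. Qed.

Lemma rV_consS n (a : R) (y : 'rV[R]_n) j : rV_cons (a, y) ord0 (lift ord0 j) = y ord0 j.
Proof. by rewrite /rV_cons mxE liftK. Qed.

(** Induction on the dimension: the first factor depends on the first coordinate alone, and Fubini
    separates it from the others. In dimension 0 the measure is a point mass and both sides are
    1. *)
Lemma cint_tensor n (k : 'I_n -> R -> cplx R) : (forall i, cintg leb (k i)) ->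
  cintg (lebesgue_rV n) (fun x => \prod_i k i (x ord0 i)) /\
  cint (lebesgue_rV n) (fun x => \prod_i k i (x ord0 i)) = \prod_i cint leb (k i).
Proof.
elim: n k => [|n ih] k ki.
  have -> : (fun x : 'rV[R]_0 => \prod_i k i (x ord0 i)) = cst 1.
    by apply/funext => x; rewrite big_ord0.
  split; last first.
    rewrite big_ord0; apply: complex_eq; rewrite /cint /Rintegral /lebesgue_rV.
      by rewrite /= integral_dirac// diracT mul1e.
    by rewrite /= integral_dirac// diracT mul1e.
  by split; exact: (finite_measure_integrable_cst (@dirac _ 'rV[R]_0 0 R)).
have [ihi ihe] := ih (fun i => k (lift ord0 i)) (fun i => ki _).
have mk : cmeas (fun x : 'rV[R]_n.+1 => \prod_i k i (x ord0 i)).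
  apply: cmeas_prod => i; have [kr kim] := cintg_cmeas (ki i).
  by split; [apply: (measurableT_comp kr)|apply: (measurableT_comp kim)];
    exact: measurable_rV_coord.
have E : (fun x : 'rV[R]_n.+1 => \prod_i k i (x ord0 i)) \o @rV_cons R n =
  fun p => k ord0 p.1 * \prod_i k (lift ord0 i) (p.2 ord0 i).
  apply/funext => -[a y] /=; rewrite big_ord_recl rV_cons0; congr (_ * _).
  by apply: eq_bigr => j _; rewrite rV_consS.
have kpi := cintg_prod_mul (ki ord0) ihi.
have ki1 : cintg (lebesgue_rV n.+1) (fun x => \prod_i k i (x ord0 i)).
  have [kr kim] : cintg (leb \x lebesgue_rV n)%E
      ((fun x : 'rV[R]_n.+1 => \prod_i k i (x ord0 i)) \o @rV_cons R n).
    by rewrite E.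
  by case: mk => mkr mki; split; apply: intg_rVS_inv.
split=> //; have [_ ->] := cint_rVS ki1; rewrite E.
have [_ ->] := cint_prod12 kpi (fun x => cintgZ (k ord0 x) ihi).
rewrite [X in cint _ X](_ : _ = fun a => k ord0 a * cint (lebesgue_rV n)
    (fun y => \prod_i k (lift ord0 i) (y ord0 i))); last first.
  by apply/funext => a; rewrite -(cintZ _ ihi).
by rewrite cintZr// ihe big_ord_recl.
Qed.

End tensor_integral.

Section tensor_real.
Context (R : realType).
Local Notation leb := (@lebesgue_measure R).

Lemma Rintegral_tensor n (k : 'I_n -> R -> R) : (forall i, intg leb (k i)) ->
  intg (lebesgue_rV n) (fun x => \prod_i k i (x ord0 i)) /\
  \int[lebesgue_rV n]_x (\prod_i k i (x ord0 i)) = \prod_i \int[leb]_t k i t.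
Proof.
move=> ki; pose kc i t : cplx R := (k i t)%:C.
have kci i : cintg leb (kc i) by split => //=; exact: integrable0.
have E : (fun x : 'rV[R]_n => \prod_i kc i (x ord0 i)) =
    fun x => (\prod_i k i (x ord0 i))%:C.
  by apply/funext => x; rewrite /kc rmorph_prod.
have [] := cint_tensor kci; rewrite E => -[i1 _].
rewrite (eq_bigr (fun i => (\int[leb]_t k i t)%:C)); last first.
  by move=> i _; apply: complex_eq => //=; rewrite Rintegral_cst// mul0r.
by rewrite -rmorph_prod => -[].
Qed.

Lemma intg_oneDsqrV : intg leb (fun t : R => (1 + t ^+ 2)^-1).
Proof.
have mf : measurable_fun setT (fun t : R => (1 + t ^+ 2)^-1).
  exact: (continuous_measurable_fun (@continuous_oneDsqrV R)).
apply/integrableP; split; first exact/measurable_EFinP.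
have E (t : R) : (`|(EFin \o (fun t : R => (1 + t ^+ 2)^-1)%R) t| = (oneDsqr t)^-1%:E)%E.
  by rewrite /= ger0_norm ?invr_ge0 ?addr_ge0 ?sqr_ge0.
under eq_integral do rewrite E.
rewrite ge0_symfun_integralT; last 3 first.
- by move=> t; rewrite invr_ge0 (le_trans ler01).
- exact: continuous_oneDsqrV.
- by move=> t; rewrite /= /oneDsqr sqrrN.
rewrite (_ : [set x | _] = `[0, +oo[%classic); last first.
  by apply/seteqP; split => t /=; rewrite in_itv/= andbT.
by rewrite integral0y_oneDsqr -EFinM ltry.
Qed.

End tensor_real.

(** * Schwartz functions *)

Section weight.
Context (R : realType) (n : nat).

(** A polynomial substitute for powers of <x>: it dominates <x>, and its product form makes its
    inverse integrable and compatible with slicing. *)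
Definition rV_weight (x : 'rV[R]_n) : R := \prod_i (1 + x ord0 i ^+ 2).

Lemma rV_weight_ge1 x : 1 <= rV_weight x.
Proof.
apply: (big_ind (fun y => 1 <= y)) => //; first exact: mulr_ege1.
by move=> i _; rewrite lerDl sqr_ge0.
Qed.

Lemma rV_weight_gt0 x : 0 < rV_weight x.
Proof. by rewrite (lt_le_trans ltr01)// rV_weight_ge1. Qed.

Lemma intg_weightV : intg (lebesgue_rV n) (fun x => (rV_weight x)^-1).
Proof.
have [+ _] := Rintegral_tensor (k := fun (_ : 'I_n) (t : R) => (1 + t ^+ 2)^-1)
  (fun=> @intg_oneDsqrV R).
by under [fun x => \prod_i _]eq_fun do rewrite prodfV.
Qed.

Lemma monomial_cat a b (x : 'rV[R]_n) :
  monomial (a ++ b) x = monomial a x * monomial b x.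
Proof. by rewrite /monomial big_cat. Qed.

Lemma monomial_cons i a (x : 'rV[R]_n) : monomial (i :: a) x = x ord0 i * monomial a x.
Proof. by rewrite /monomial big_cons. Qed.

(** Expanding the product, each factor contributes either 1 or x_i^2; every term is a monomial in
    which each direction occurs twice. *)
Lemma weight_monomials (r : seq 'I_n) : exists S : seq (seq 'I_n), forall x : 'rV[R]_n,
  \prod_(i <- r) (1 + x ord0 i ^+ 2) <= \sum_(a <- S) `|monomial a x|.
Proof.
elim: r => [|i r [S hS]].
  by exists [:: [::]] => x; rewrite big_nil big_seq1 /monomial big_nil normr1.
exists (S ++ [seq i :: i :: a | a <- S]) => x.
rewrite big_cons big_cat big_map/=.
rewrite (le_trans (ler_wpM2l _ (hS x)))// ?addr_ge0 ?sqr_ge0//.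
rewrite mulrDl mul1r lerD2l mulr_sumr le_eqVlt; apply/orP; left; apply/eqP.
apply: eq_bigr => a _; rewrite !monomial_cons !normrM mulrA; congr (_ * _).
by rewrite -normrM -expr2 ger0_norm// sqr_ge0.
Qed.

End weight.

(** * Directional derivatives *)

Section directional_derivative.
Context (R : realType) (V : normedModType R).
Implicit Types (f g : V -> R) (x v : V).

Lemma is_deriveDf f g x v df dg : is_derive x v f df -> is_derive x v g dg ->
  is_derive x v (fun y => f y + g y) (df + dg).
Proof. exact: is_deriveD. Qed.

Lemma is_deriveMf f g x v df dg : is_derive x v f df -> is_derive x v g dg ->
  is_derive x v (fun y => f y * g y) (f x * dg + g x * df).
Proof. exact: is_deriveM. Qed.

Lemma is_deriveZf (c : R) f x v df : is_derive x v f df ->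
  is_derive x v (fun y => c * f y) (c * df).
Proof. exact: is_deriveZ. Qed.

Lemma is_deriveNf f x v df : is_derive x v f df ->
  is_derive x v (fun y => - f y) (- df).
Proof. exact: is_deriveN. Qed.

(** Restriction to a line turns directional derivatives into one-variable ones, for which the chain
    rule is at hand. *)
Lemma is_derive_line f x v l :
  is_derive x v f l <-> is_derive (0 : R) (1 : R) (fun t : R => f (t *: v + x)) l.
Proof.
have E : (fun h : R => h^-1 *: (f (h *: v + x) - f x)) =
  (fun h : R => h^-1 *: ((fun t : R => f (t *: v + x)) (h *: (1:R) + 0) - f (0 *: v + x))).
  by apply/funext => h; rewrite scale0r add0r addr0 [_ *: 1]mulr1.
split=> -[dl <-].
  by apply: DeriveDef; rewrite /derivable /derive -E.
by apply: DeriveDef; rewrite /derivable /derive E.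
Qed.

Lemma is_derive_affine (a b t : R) : is_derive t (1 : R) (fun s => s * a + b) a.
Proof.
by apply: is_derive_eq; rewrite scaler0 add0r addr0 [_%:A]mulr1.
Qed.

Lemma is_derive_compf f (h : R -> R) x v l k : is_derive x v f l ->
  is_derive (f x) 1 h k -> is_derive x v (fun y => h (f y)) (l * k).
Proof.
move=> /is_derive_line fl hk; apply/is_derive_line.
have := @is_derive1_comp _ h (fun t : R => f (t *: v + x)) 0 k l.
by rewrite scale0r add0r [k * l]mulrC; apply.
Qed.

Lemma is_derive_line_at f v x (t : R) l : is_derive (t *: v + x) v f l ->
  is_derive t (1 : R) (fun t : R => f (t *: v + x)) l.
Proof.
move=> /is_derive_line h.
have -> : (fun t : R => f (t *: v + x)) =
    (fun s : R => f (s *: v + (t *: v + x))) \o (fun s => s * 1 - t).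
  by apply/funext => s /=; rewrite mulr1 addrA -scalerDl subrK.
have := @is_derive1_comp _ (fun s : R => f (s *: v + (t *: v + x)))
  (fun s : R => s * 1 - t) t l 1.
by rewrite mulr1 subrr mulr1; apply => //; exact: is_derive_affine.
Qed.

End directional_derivative.

Lemma is_derive_coord (R : realType) n (x v : 'rV[R]_n) i :
  is_derive x v (fun y : 'rV[R]_n => y ord0 i) (v ord0 i).
Proof.
apply/is_derive_line.
rewrite [X in is_derive _ _ X](_ : _ = fun t : R => t * v ord0 i + x ord0 i); last first.
  by apply/funext => t; rewrite !mxE.
exact: is_derive_affine.
Qed.

(** * Closure properties and decay of real Schwartz functions *)

Section real_schwartz.
Context (R : realType) (n : nat).
Implicit Types (f g : 'rV[R]_n -> R) (x v : 'rV[R]_n) (i j : 'I_n) (a b : seq 'I_n).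
Local Notation e_ i := (delta_mx ord0 i : 'rV[R]_n).

Definition rschwartz g := smooth g /\
  forall a b, exists M : R, forall x, `|monomial a x| * `|partial b g x| <= M.

(** A coinduction principle: x^a d^b g is reached from g by partial derivatives followed by
    multiplications by coordinates, so it stays in a class stable under both and is bounded like
    every member of it. *)
Lemma rschwartz_coind (K : set ('rV[R]_n -> R)) :
  (forall g, K g -> continuous g) ->
  (forall g i x, K g -> derivable g x (e_ i)) ->
  (forall g i, K g -> K (fun x => 'D_(e_ i) g x)) ->
  (forall g i, K g -> K (fun x => x ord0 i * g x)) ->
  (forall g, K g -> exists M : R, forall x, `|g x| <= M) ->
  forall g, K g -> rschwartz g.
Proof.
move=> Kc Kd KD Kx Kb g Kg.
have Kp b : K (partial b g) by elim: b => [//|i b ih]; exact: KD.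
have Km a h : K h -> K (fun x => monomial a x * h x).
  move=> Kh; elim: a => [|i a ih].
    by under eq_fun do rewrite /monomial big_nil mul1r.
  by under eq_fun do rewrite monomial_cons -mulrA; exact: Kx.
split=> [b|a b]; first by split=> [|i x]; [exact: Kc|exact: Kd].
have [M hM] := Kb _ (Km a _ (Kp b)).
by exists M => x; rewrite -normrM.
Qed.

Lemma rschwartz_continuous g : rschwartz g -> continuous g.
Proof. by move=> [/(_ [::])[]]. Qed.

Lemma rschwartz_derivable g i x : rschwartz g -> derivable g x (e_ i).
Proof. by move=> [/(_ [::])[_]]. Qed.

Lemma rschwartz_bounded g : rschwartz g -> exists M : R, forall x, `|g x| <= M.
Proof.
move=> [_ /(_ [::] [::])[M hM]]; exists M => x.
by have := hM x; rewrite /monomial big_nil normr1 mul1r.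
Qed.

Lemma rschwartz_derive g i : rschwartz g -> rschwartz (fun x => 'D_(e_ i) g x).
Proof.
have E b : partial b (fun x => 'D_(e_ i) g x) = partial (rcons b i) g.
  by rewrite /partial foldr_rcons.
move=> [sg bg]; split=> [b|a b]; rewrite E; first exact: sg.
exact: bg.
Qed.

(* Closing a family under multiplication by coordinates makes it stable under
   derivation as soon as the derivatives of its members belong to the closure. *)
Inductive poly_span (B : set ('rV[R]_n -> R)) : set ('rV[R]_n -> R) :=
| span_base f of B f : poly_span B f
| span_mul i f of poly_span B f : poly_span B (fun x => x ord0 i * f x)
| span_add f g of poly_span B f & poly_span B g : poly_span B (fun x => f x + g x)
| span_scale (c : R) f of poly_span B f : poly_span B (fun x => c * f x).

Lemma poly_span_rschwartz (B : set ('rV[R]_n -> R)) :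
  (forall f, B f -> continuous f) ->
  (forall f i x, B f -> derivable f x (e_ i)) ->
  (forall f i, B f -> poly_span B (fun x => 'D_(e_ i) f x)) ->
  (forall f a, B f -> exists M : R, forall x, `|monomial a x * f x| <= M) ->
  forall f, poly_span B f -> rschwartz f.
Proof.
move=> Bc Bd BD Bb f; move: f; apply: rschwartz_coind.
- move=> g; elim=> {g}.
  + by move=> f /Bc.
  + by move=> i f _ cf x; exact: (cvgM (@coord_continuous R 1 n ord0 i x) (cf x)).
  + by move=> f g _ cf _ cg x; exact: (cvgD (cf x) (cg x)).
  + by move=> c f _ cf x; exact: (cvgM (cvg_cst c) (cf x)).
- move=> g i x; elim=> {g}.
  + by move=> f /Bd.
  + move=> j f _ /derivableP df.
    by have [] := is_deriveMf (is_derive_coord x (e_ i) j) df.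
  + by move=> f g _ /derivableP df _ /derivableP dg; have [] := is_deriveDf df dg.
  + by move=> c f _ /derivableP df; have [] := is_deriveZf c df.
(* Differentiability and membership of the derivative go through the induction together, because the
   product rule for x_j f uses both for f. *)
- move=> g i Kg; suff [] : (forall x, derivable g x (e_ i)) /\
    poly_span B (fun x => 'D_(e_ i) g x) by [].
  elim: Kg => {g}.
  + move=> f Bf; split; [by move=> x; exact: Bd|exact: BD].
  + move=> j f Kf [df Kdf].
    have d x := is_deriveMf (is_derive_coord x (e_ i) j) (derivableP (df x)).
    split; first by move=> x; have [] := d x.
    rewrite [X in poly_span B X](_ : _ = fun x =>
      x ord0 j * 'D_(e_ i) f x + (e_ i) ord0 j * f x).
      by apply: span_add; [exact: span_mul|exact: span_scale].
    by apply/funext => x; have [_ ->] := d x; rewrite [f x * _]mulrC.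
  + move=> f g Kf [df Kdf] Kg [dg Kdg].
    have d x := is_deriveDf (derivableP (df x)) (derivableP (dg x)).
    split; first by move=> x; have [] := d x.
    rewrite [X in poly_span B X](_ : _ = fun x => 'D_(e_ i) f x + 'D_(e_ i) g x).
      exact: span_add.
    by apply/funext => x; have [_ ->] := d x.
  + move=> c f Kf [df Kdf].
    have d x := is_deriveZf c (derivableP (df x)).
    split; first by move=> x; have [] := d x.
    rewrite [X in poly_span B X](_ : _ = fun x => c * 'D_(e_ i) f x).
      exact: span_scale.
    by apply/funext => x; have [_ ->] := d x.
- by move=> g i; exact: span_mul.
(* The bound is proved for all monomials at once: a coordinate factor of g is absorbed into the
   monomial. *)
- move=> g Kg; suff /(_ [::])[M hM] : forall a, exists M : R, forall x, `|monomial a x * g x| <= M.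
    by exists M => x; have := hM x; rewrite /monomial big_nil mul1r.
  elim: Kg => {g}.
  + by move=> f Bf a; exact: Bb.
  + move=> i f _ ih a; have [M hM] := ih (rcons a i); exists M => x.
    by rewrite mulrA; have := hM x; rewrite -cats1 monomial_cat /monomial big_seq1.
  + move=> f g _ ihf _ ihg a; have [M hM] := ihf a; have [N hN] := ihg a.
    by exists (M + N) => x; rewrite mulrDr (le_trans (ler_normD _ _))// lerD.
  + move=> c f _ ih a; have [M hM] := ih a; exists (`|c| * M) => x.
    by rewrite mulrCA normrM ler_wpM2l.
Qed.

(** Taking the Schwartz functions themselves as generators yields their stability under sums,
    scalars and coordinates. *)
Lemma schwartz_span_rschwartz f : poly_span rschwartz f -> rschwartz f.
Proof.
apply: poly_span_rschwartz => {}f.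
- exact: rschwartz_continuous.
- by move=> i x; exact: rschwartz_derivable.
- by move=> i sf; exact/span_base/rschwartz_derive.
- by move=> a [_ hf]; have [M hM] := hf a [::]; exists M => x; rewrite normrM.
Qed.

Lemma rschwartz_mulx i f : rschwartz f -> rschwartz (fun x => x ord0 i * f x).
Proof. by move=> sf; apply: schwartz_span_rschwartz; exact/span_mul/span_base. Qed.

Lemma rschwartzD f g : rschwartz f -> rschwartz g -> rschwartz (fun x => f x + g x).
Proof.
by move=> sf sg; apply: schwartz_span_rschwartz; apply: span_add; exact: span_base.
Qed.

Lemma rschwartzZ c f : rschwartz f -> rschwartz (fun x => c * f x).
Proof. by move=> sf; apply: schwartz_span_rschwartz; exact/span_scale/span_base. Qed.

Lemma rschwartz_weight (r : seq 'I_n) f : rschwartz f ->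
  rschwartz (fun x => \prod_(i <- r) (1 + x ord0 i ^+ 2) * f x).
Proof.
move=> sf; elim: r => [|i r ih].
  by under eq_fun do rewrite big_nil mul1r.
under eq_fun do rewrite big_cons -mulrA mulrDl mul1r expr2 -mulrA.
by apply: rschwartzD => //; do 2 apply: rschwartz_mulx.
Qed.

Lemma rschwartz_weight_iter k f : rschwartz f ->
  rschwartz (fun x => rV_weight x ^+ k * f x).
Proof.
move=> sf; elim: k => [|k ih]; first by under eq_fun do rewrite expr0 mul1r.
under eq_fun do rewrite exprS -mulrA.
exact: rschwartz_weight ih.
Qed.

(** One more power of the weight is still bounded, and this extra power provides the integrable
    factor. *)
Lemma rschwartz_decay k f : rschwartz f -> exists M : R, forall x,
  rV_weight x ^+ k * `|f x| <= M * (rV_weight x)^-1.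
Proof.
move=> sf; have [M hM] := rschwartz_bounded (rschwartz_weight_iter k.+1 sf).
exists M => x; rewrite ler_pdivlMr ?rV_weight_gt0// mulrAC -exprSr.
have := hM x; rewrite normrM ger0_norm// exprn_ge0// ltW// rV_weight_gt0//.
Qed.

Lemma rschwartz_measurable f : rschwartz f -> measurable_fun setT f.
Proof. by move=> sf; apply: continuous_measurable_rV; exact: rschwartz_continuous. Qed.

Lemma rV_weight_measurable : measurable_fun setT (@rV_weight R n).
Proof.
apply: measurable_prod => i _; apply: measurable_funD => //.
by apply: measurable_funX; exact: measurable_rV_coord.
Qed.

Lemma intg_rschwartz_weight k f : rschwartz f ->
  intg (lebesgue_rV n) (fun x => rV_weight x ^+ k * f x).
Proof.
move=> sf; have [M hM] := rschwartz_decay k sf.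
apply: (intg_le (g := fun x => M * (rV_weight x)^-1)).
- apply: measurable_funM; last exact: rschwartz_measurable.
  by apply: measurable_funX; exact: rV_weight_measurable.
- by move=> x; rewrite normrM ger0_norm// exprn_ge0// ltW// rV_weight_gt0.
- exact/intgZ/intg_weightV.
Qed.

Lemma intg_rschwartz f : rschwartz f -> intg (lebesgue_rV n) f.
Proof.
move=> /(intg_rschwartz_weight 0).
by rewrite (_ : (fun x => _) = f)//; apply/funext => x; rewrite expr0 mul1r.
Qed.

End real_schwartz.

(** * Oscillatory integrals and the Fourier transform *)

Section one_dim.
Context (R : realType).
Local Notation leb := (@lebesgue_measure R).

Lemma is_derive_derivative (f g : R -> R) :
  (forall t : R, is_derive t (1 : R) f (g t)) -> continuous f.
Proof.
move=> fg t; apply/differentiable_continuous/derivable1_diffP.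
by have [] := fg t.
Qed.

(** Over [-(N+1), N+1] the integral is a difference of boundary values of [u], which tends to 0 by
    the bound on [u]. Dominated convergence, with the bound on [du], passes to the whole line. *)
Lemma Rintegral_derive0 (u du : R -> R) (M : R) :
  (forall t : R, is_derive t (1 : R) u (du t)) -> continuous du ->
  (forall t, `|u t| <= M * (1 + t ^+ 2)^-1) ->
  (forall t, `|du t| <= M * (1 + t ^+ 2)^-1) ->
  \int[leb]_t du t = 0.
Proof.
move=> dudu cdu uM duM.
have cu := is_derive_derivative dudu.
pose I (N : nat) : set R := `[- N.+1%:R, N.+1%:R]%classic.
pose f_ N : R -> R := du \_ (I N).
have mdu : measurable_fun setT du by exact: continuous_measurable_fun.
have wi := intgZ M (intg_oneDsqrV R).
have dui : intg leb du := intg_le (mu := leb) mdu duM wi.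
have f_int N : \int[leb]_t f_ N t = u N.+1%:R - u (- N.+1%:R).
  rewrite -Rintegral_mkcond /Rintegral (@continuous_FTC2 _ _ u).
  - by [].
  - by rewrite gtrN.
  - exact: continuous_subspaceT.
  - split.
    + by move=> t _; have [] := dudu t.
    + exact: (cvg_at_right_filter (cu _)).
    + exact: (cvg_at_left_filter (cu _)).
  - by move=> t _; rewrite derive1E; have [_ ->] := dudu t.
have f_cvg t : f_ N t @[N --> \oo] --> du t.
  apply: cvg_near_cst; near=> N.
  rewrite /f_ patchE mem_set//= /I /= in_itv/= -ler_norml.
  rewrite (@le_trans _ _ N%:R) ?ler_nat//.
  by near: N; exact: nbhs_infty_ger.
have mf_ N : measurable_fun setT (f_ N).
  apply: (measurable_restrictT du (measurable_itv _)).1.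
  exact: measurable_funTS.
have f_M N t : `|f_ N t| <= M * (1 + t ^+ 2)^-1.
  rewrite /f_ patchE; case: ifP => // _.
  by rewrite normr0 (le_trans (normr_ge0 _) (duM t)).
have [_ cv] := dominated_cvg_Rintegral (mu := leb) mf_ f_cvg wi f_M.
have u0 : (fun N : nat => \int[leb]_t f_ N t) @ \oo --> (0 : R).
  apply: norm_cvg0.
  have M0 : 0 <= M by have := le_trans (normr_ge0 _) (uM 0); rewrite expr0n addr0 invr1 mulr1.
  apply: (@squeeze_cvgr _ _ _ _ (cst 0) (fun N : nat => 2 * M * harmonic N)).
  - near=> N; rewrite /= normr_ge0/= f_int.
    have mono : (1 + N.+1%:R ^+ 2)^-1 <= N.+1%:R^-1 :> R.
      rewrite lef_pV2 ?posrE ?ltr0n ?ltr_wpDr ?sqr_ge0//.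
      by rewrite (@le_trans _ _ (N.+1%:R ^+ 2)) ?lerDr// expr2 ler_peMl// ler1n.
    rewrite (le_trans (ler_normB _ _))// -mulrA mulr_natl mulr2n lerD//.
      by rewrite (le_trans (uM _))// ler_wpM2l.
    by rewrite (le_trans (uM _))// sqrrN ler_wpM2l.
  - exact: cvg_cst.
  - rewrite -[X in _ --> X](mulr0 (2 * M)); apply: cvgM; first exact: cvg_cst.
    exact: cvg_harmonic.
by rewrite -(cvg_unique _ cv u0).
Unshelve. all: end_near.
Qed.

End one_dim.

(** * Differentiation under the integral and integration by parts *)

Section differentiation.
Context d (T : measurableType d) (R : realType) (mu : {measure set T -> \bar R}).
Variables (h dh : R -> R).
Hypothesis hd : forall t : R, is_derive t (1 : R) h (dh t).
Hypothesis dh1 : forall t, `|dh t| <= 1.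
Hypothesis h1 : forall t, `|h t| <= 1.

Lemma derive_bounded_lipschitz u v : `|h u - h v| <= `|u - v|.
Proof.
wlog uv : u v / v <= u.
  move=> hw; have [/hw//|/ltW/hw] := leP v u.
  by rewrite distrC (distrC u).
have ch := is_derive_derivative hd.
have [c _ ->] := @MVT_segment R h dh v u uv (fun x _ => hd x) (continuous_subspaceT ch).
by rewrite normrM ler_piMl.
Qed.

(** In the applications [t] is one coordinate of the frequency, [X] the matching coordinate of x,
    and [Y] the part of the phase that does not move. *)
Lemma is_derive_integral (f X Y : T -> R) (t : R) :
  intg mu f -> measurable_fun setT X -> measurable_fun setT Y ->
  intg mu (fun x => f x * X x) ->
  is_derive t (1 : R) (fun t => \int[mu]_x (f x * h (t * X x + Y x)))
    (\int[mu]_x (f x * X x * dh (t * X x + Y x))).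
Proof.
move=> fi mX mY fXi.
have ch := is_derive_derivative hd.
pose F (t : R) x := f x * h (t * X x + Y x).
have dF x (s : R) : is_derive s (1 : R) (F ^~ x) (f x * X x * dh (s * X x + Y x)).
  rewrite -mulrA; apply: is_deriveZf; apply: is_derive_compf => //.
  exact: is_derive_affine.
have E x s : partial1of2 F s x = f x * X x * dh (s * X x + Y x).
  by rewrite partial1of2E; have [_ ->] := dF x s.
(* The side conditions are established once because two facts use them, differentiability and the
   value of the derivative. The dominating function is |f X|, since |dh| <= 1. *)
have H P : (forall (Ia : `](t - 1)%R, (t + 1)%R[%classic t)
  (i : forall s, `](t - 1), (t + 1)[%classic s -> mu.-integrable setT (EFin \o F s))
  (dr : forall (x : R) (y : T), `](t - 1), (t + 1)[%classic x -> setT y -> derivable (F^~ y) x 1)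
  (G0 : forall y : T, 0 <= `|f y * X y|)
  (iG : mu.-integrable setT (EFin \o (fun y => `|f y * X y|)))
  (ub : forall (x : R) (y : T), `](t-1), (t+1)[%classic x -> setT y ->
     `|partial1of2 F x y| <= `|f y * X y|), P) -> P.
  apply.
  - by rewrite /= in_itv/= ltrBlDr !ltrDl ltr01.
  - move=> s _; apply: (intg_bounded_mul (M := 1)) => //.
    apply: (measurableT_comp (continuous_measurable_fun ch)).
    by apply: measurable_funD => //; exact: measurable_funM.
  - by move=> s y _ _; have [] := dF y s.
  - by [].
  - exact: intg_norm.
  - by move=> s y _ _; rewrite E normrM ler_piMr.
apply: H => Ia i dr G0 iG ub.
apply: DeriveDef; first exact: (derivable_under_integral _ Ia i dr G0 iG ub).
rewrite -derive1E (differentiation_under_integral _ Ia i dr G0 iG ub)//.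
by apply: eq_Rintegral => x _; rewrite E.
Qed.

End differentiation.

Section slices.
Context (R : realType) (n : nat).

Lemma ball_continuous (U V : pseudoMetricType R) (phi : U -> V) :
  (forall (e : R) x y, 0 < e -> ball x e y -> ball (phi x) e (phi y)) -> continuous phi.
Proof.
move=> hphi x; apply/cvg_ballP => e e0.
by near=> y; apply: hphi => //; near: y; exact: nbhsx_ballx.
Unshelve. all: end_near. Qed.

Lemma rV_cons_continuousr (a : R) : continuous (fun y : 'rV[R]_n => rV_cons (a, y)).
Proof.
apply: ball_continuous => e x y e0 [_ xy]; split=> // i j; rewrite !mxE.
by case: unliftP => [k _|_] /=; [exact: xy|exact: ballxx].
Qed.

Lemma rV_cons_continuousl (y : 'rV[R]_n) : continuous (fun a : R => rV_cons (a, y)).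
Proof.
apply: ball_continuous => e a b e0 ab; split=> // i j; rewrite !mxE.
by case: unliftP => [k _|_] //=; exact: ballxx.
Qed.

Lemma rV_weight_cons (a : R) (y : 'rV[R]_n) :
  rV_weight (rV_cons (a, y)) = (1 + a ^+ 2) * rV_weight y.
Proof.
rewrite /rV_weight big_ord_recl rV_cons0; congr (_ * _).
by apply: eq_bigr => i _; rewrite rV_consS.
Qed.

Lemma rV_cons_addl (t a : R) (y : 'rV[R]_n) :
  t *: delta_mx ord0 ord0 + rV_cons (a, y) = rV_cons (t + a, y).
Proof.
apply/rowP => i; rewrite !mxE /=; case: unliftP => [j ->|->] /=.
  by rewrite mulr0 add0r.
by rewrite mulr1.
Qed.

Lemma rV_cons_addr (t a : R) (y : 'rV[R]_n) (j : 'I_n) :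
  t *: delta_mx ord0 (lift ord0 j) + rV_cons (a, y) =
  rV_cons (a, t *: delta_mx ord0 j + y).
Proof.
apply/rowP => i; rewrite !mxE /=; case: unliftP => [k ->|->] /=.
  by rewrite !mxE /= (inj_eq lift_inj).
by rewrite mulr0 add0r.
Qed.

End slices.

(** Induction on the dimension. If the derivative is along the first coordinate, the integral in
    that variable vanishes on each slice by the one-dimensional case; otherwise the integral over
    the other coordinates vanishes by induction. The product form of the weight lets the bounds pass
    to slices. *)
Lemma Rintegral_partial0 (R : realType) n (j : 'I_n) (f g : 'rV[R]_n -> R) (M : R) :
  (forall x, is_derive x (delta_mx ord0 j : 'rV[R]_n) f (g x)) -> continuous g ->
  (forall x, `|f x| <= M * (rV_weight x)^-1) ->
  (forall x, `|g x| <= M * (rV_weight x)^-1) ->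
  \int[lebesgue_rV n]_x g x = 0.
Proof.
elim: n j f g M => [[]//|n ih] j f g M fg cg fM gM.
have mg := continuous_measurable_rV cg.
have gi : intg (lebesgue_rV n.+1) g.
  by apply: (intg_le mg gM); exact/intgZ/intg_weightV.
have [gci ->] := intg_rVS gi.
have M_split a (y : 'rV[R]_n) : M * (rV_weight (rV_cons (a, y)))^-1 =
    M * (1 + a ^+ 2)^-1 * (rV_weight y)^-1.
  by rewrite rV_weight_cons invfM mulrA.
have cga a : continuous (fun y => g (rV_cons (a, y))).
  move=> y; apply: continuous_comp; [exact: rV_cons_continuousr|exact: cg].
have cgy y : continuous (fun a => g (rV_cons (a, y))).
  move=> a; apply: continuous_comp; [exact: rV_cons_continuousl|exact: cg].
case: (unliftP ord0 j) => [k jk|j0].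
- have slice a : intg (lebesgue_rV n) (fun y => g (rV_cons (a, y))) /\
      \int[lebesgue_rV n]_y g (rV_cons (a, y)) = 0.
    have gaM y : `|g (rV_cons (a, y))| <= M * (1 + a ^+ 2)^-1 * (rV_weight y)^-1.
      by rewrite -M_split.
    split.
      apply: (intg_le _ gaM); first exact: continuous_measurable_rV.
      exact/intgZ/intg_weightV.
    apply: (ih k (fun y => f (rV_cons (a, y))) _ (M * (1 + a ^+ 2)^-1)) => //.
    + move=> y; apply/is_derive_line.
      under eq_fun do rewrite -rV_cons_addr -jk.
      by have /is_derive_line := fg (rV_cons (a, y)).
    + by move=> y; rewrite -M_split.
  have [_ ->] := Rintegral_prod12 gci (fun a => (slice a).1).
  under eq_Rintegral do rewrite /= (slice _).2.
  by rewrite Rintegral_cst// mul0r.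
- have slice y : intg (@lebesgue_measure R) (fun a => g (rV_cons (a, y))) /\
      \int[@lebesgue_measure R]_a g (rV_cons (a, y)) = 0.
    have gyM a : `|g (rV_cons (a, y))| <= M * (rV_weight y)^-1 * (1 + a ^+ 2)^-1.
      by rewrite mulrAC -M_split.
    split.
      apply: (intg_le (mu := @lebesgue_measure R) (continuous_measurable_fun (cgy y)) gyM).
      exact/intgZ/intg_oneDsqrV.
    apply: (Rintegral_derive0 (u := fun a => f (rV_cons (a, y))) _ (cgy y) _ gyM).
    + move=> a; have h : is_derive (a *: delta_mx ord0 ord0 + rV_cons (0, y))
          (delta_mx ord0 ord0 : 'rV[R]_n.+1) f (g (rV_cons (a, y))).
        by rewrite rV_cons_addl addr0 -j0.
      have := is_derive_line_at h.
      by under [X in is_derive _ _ X]eq_fun do rewrite rV_cons_addl addr0.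
    + by move=> a; rewrite mulrAC -M_split.
  have [_ ->] := Rintegral_prod21 gci (fun y => (slice y).1).
  under eq_Rintegral do rewrite /= (slice _).2.
  by rewrite Rintegral_cst// mul0r.
Qed.

Section real_continuity.
Context (R : realType) (T : topologicalType).
Implicit Types f g : T -> R.

Lemma real_continuousD f g : continuous f -> continuous g ->
  continuous (fun x => f x + g x).
Proof. by move=> cf cg x; exact: (cvgD (cf x) (cg x)). Qed.

Lemma real_continuousM f g : continuous f -> continuous g ->
  continuous (fun x => f x * g x).
Proof. by move=> cf cg x; exact: (cvgM (cf x) (cg x)). Qed.

Lemma real_continuousZ (c : R) f : continuous f -> continuous (fun x => c * f x).
Proof. by move=> cf x; exact: (cvgM (cvg_cst c) (cf x)). Qed.

Lemma real_continuous_comp f (h : R -> R) : continuous f -> continuous h ->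
  continuous (fun x => h (f x)).
Proof. by move=> cf ch x; exact: (continuous_comp (cf x) (ch _)). Qed.

End real_continuity.

(** * Cosine and sine transforms *)

Section trig_transform.
Context (R : realType) (n : nat).
Implicit Types (f : 'rV[R]_n -> R) (x xi v : 'rV[R]_n) (h dh : R -> R).
Local Notation e_ i := (delta_mx ord0 i : 'rV[R]_n).
Local Notation mu := (lebesgue_rV n).

Lemma dotC x y : dot x y = dot y x :> R.
Proof. by apply: eq_bigr => i _; rewrite mulrC. Qed.

Lemma dotDr x y z : dot x (y + z) = dot x y + dot x z :> R.
Proof. by rewrite -big_split; apply: eq_bigr => i _ /=; rewrite mxE mulrDr. Qed.

Lemma dotZr (t : R) x y : dot x (t *: y) = t * dot x y.
Proof. by rewrite mulr_sumr; apply: eq_bigr => i _; rewrite mxE mulrCA. Qed.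

Lemma dot_e x i : dot x (e_ i) = x ord0 i.
Proof.
rewrite /dot (bigD1 i)//= mxE !eqxx mulr1 big1 ?addr0// => j ji.
by rewrite mxE eqxx (negbTE ji) mulr0.
Qed.

Lemma dot_line x xi (t : R) i : dot x (t *: e_ i + xi) = t * x ord0 i + dot x xi.
Proof. by rewrite dotDr dotZr dot_e. Qed.

Lemma measurable_dot xi : measurable_fun setT (fun x => dot x xi).
Proof.
apply: measurable_sum => i; apply: measurable_funM => //.
exact: measurable_rV_coord.
Qed.

(** Keeping the kernel [h] abstract, with [h] and its derivative bounded by 1, treats the cosine and
    sine transforms together. They are the pieces of the real and imaginary parts of Fourier
    integrals. *)
Definition trig_transform h f xi : R := \int[mu]_x (f x * h (dot x xi)).

Section kernel.
Variables h dh : R -> R.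
Hypothesis hd : forall t : R, is_derive t (1 : R) h (dh t).
Hypothesis dh1 : forall t, `|dh t| <= 1.
Hypothesis h1 : forall t, `|h t| <= 1.

Lemma measurable_kernel xi : measurable_fun setT (fun x => h (dot x xi)).
Proof.
apply: (measurableT_comp (continuous_measurable_fun (is_derive_derivative hd))).
exact: measurable_dot.
Qed.

Lemma intg_kernel f xi : intg mu f -> intg mu (fun x => f x * h (dot x xi)).
Proof. by move=> fi; apply: (intg_bounded_mul (M := 1)) => //; exact: measurable_kernel. Qed.

Lemma trig_transform_le f xi : intg mu f ->
  `|trig_transform h f xi| <= \int[mu]_x `|f x|.
Proof.
move=> fi; have ki := intg_kernel xi fi.
rewrite (le_trans (le_normr_Rintegral _ ki))//.
apply: le_Rintegral => //; [exact: intg_norm|exact: intg_norm|].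
by move=> x _; rewrite normrM ler_piMr.
Qed.

(** Sequential dominated convergence is transferred to neighbourhoods through a modulus. For eta
    within 1/(N+1) of xi the kernels differ by at most [m N x], the minimum of 2 and [k x] / (N+1),
    because [h] is bounded by 1 and 1-Lipschitz; the integral of |f| [m N] tends to 0. *)
Lemma trig_transform_continuous f : intg mu f -> continuous (trig_transform h f).
Proof.
move=> fi xi.
pose k x : R := \sum_i `|x ord0 i|.
have mk : measurable_fun setT k.
  apply: measurable_sum => i; apply: measurableT_comp => //.
  exact: measurable_rV_coord.
have k0 x : 0 <= k x by apply: sumr_ge0.
pose m (N : nat) x : R := Num.min 2 (k x * harmonic N).
have m0 N x : 0 <= m N x by rewrite le_min ler0n mulr_ge0// harmonic_ge0.
have m2 N x : m N x <= 2 by rewrite ge_min lexx.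
have mm N : measurable_fun setT (m N).
  by apply: measurable_minr => //; exact: measurable_funM.
have fmi N : intg mu (fun x => `|f x| * m N x).
  apply: (intg_bounded_mul (M := 2)) => //; last exact: intg_norm.
  by move=> x; rewrite ger0_norm.
have [_ rcv] : intg mu (fun=> 0 : R) /\
    \int[mu]_x (`|f x| * m N x) @[N --> \oo] --> \int[mu]_x (0 : R).
  apply: (dominated_cvg_Rintegral (g := fun x => `|f x| * 2)).
  - by move=> N; exact: intg_measurable (fmi N).
  - move=> x; rewrite -[X in _ --> X](mulr0 `|f x|).
    apply: cvgM; first exact: cvg_cst.
    apply: (@squeeze_cvgr _ _ _ _ (cst 0) (fun N => k x * harmonic N)).
    + by apply: nearW => N; rewrite /= m0 /= /m ge_min lexx orbT.
    + exact: cvg_cst.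
    + rewrite -[X in _ --> X](mulr0 (k x)).
      by apply: cvgM; [exact: cvg_cst|exact: cvg_harmonic].
  - under [_ \o _]eq_fun do rewrite /= mulrC.
    exact/intgZ/intg_norm.
  - by move=> N x; rewrite normrM normr_id ler_wpM2l// ger0_norm.
rewrite Rintegral_cst// mul0r in rcv.
apply/(@cvgrPdist_lt R R 'rV[R]_n (nbhs (xi : 'rV[R]_n)) (nbhs_filter _)) => e e0.
have [N _ /(_ N (leqnn N)) rN] := cvgr_lt 0 rcv _ e0.
near=> eta.
have close i : `|xi ord0 i - eta ord0 i| <= harmonic N.
  have : ball xi (harmonic N) eta by near: eta; exact/nbhsx_ballx/harmonic_gt0.
  by move=> [_ /(_ ord0 i)]; rewrite /ball/= => /ltW.
rewrite /trig_transform -RintegralB//; [|exact: intg_kernel|exact: intg_kernel].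
apply: le_lt_trans rN; apply: le_trans.
  by apply: le_normr_Rintegral => //; apply: intgB; exact: intg_kernel.
apply: le_Rintegral => //.
  by apply/intg_norm/intgB; exact: intg_kernel.
move=> x _; rewrite -mulrBr normrM ler_wpM2l// /m le_min; apply/andP; split.
  by rewrite (le_trans (ler_normB _ _))// -[leRHS]/(1 + 1) lerD.
rewrite (le_trans (derive_bounded_lipschitz hd dh1 _ _))//.
rewrite /dot -sumrB (le_trans (ler_norm_sum _ _ _))// mulr_suml ler_sum// => i _.
by rewrite -mulrBr normrM ler_wpM2l.
Unshelve. all: end_near. Qed.

Lemma trig_transform_derive f xi i : intg mu f -> intg mu (fun x => x ord0 i * f x) ->
  is_derive xi (e_ i) (trig_transform h f) (trig_transform dh (fun x => x ord0 i * f x) xi).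
Proof.
move=> fi xfi; apply/is_derive_line.
have mi : measurable_fun setT (fun x : 'rV[R]_n => x ord0 i) by exact: measurable_rV_coord.
have fxi : intg mu (fun x => f x * x ord0 i).
  by under [_ \o _]eq_fun do rewrite /= mulrC.
have H := is_derive_integral hd dh1 h1 0 fi mi (measurable_dot xi) fxi.
rewrite [X in is_derive _ _ X](_ : _ =
   (fun t => \int[mu]_x (f x * h (t * x ord0 i + dot x xi)))); last first.
  by apply/funext => t; apply: eq_Rintegral => x _; rewrite dot_line.
apply: is_derive_eq H _; apply: eq_Rintegral => x _.
by rewrite mul0r add0r [f x * _]mulrC.
Qed.

(** Integration by parts: the derivative along e_i of f(x) h(x . xi) has integral 0, and the product
    rule splits it into the two terms of the identity. *)
Lemma trig_transform_partial f xi i : rschwartz f -> continuous dh ->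
  xi ord0 i * trig_transform dh f xi =
  - trig_transform h (fun x => 'D_(e_ i) f x) xi.
Proof.
move=> sf cdh; have sdf := rschwartz_derive i sf.
have fi := intg_rschwartz sf; have dfi := intg_rschwartz sdf.
have mdh : measurable_fun setT (fun x => dh (dot x xi)).
  exact: measurableT_comp (continuous_measurable_fun cdh) (measurable_dot xi).
have fdhi : intg mu (fun x => f x * dh (dot x xi)).
  exact: (intg_bounded_mul (M := 1)).
pose g x := f x * (xi ord0 i * dh (dot x xi)) + h (dot x xi) * 'D_(e_ i) f x.
have dg x : is_derive x (e_ i) (fun x => f x * h (dot x xi)) (g x).
  apply: is_deriveMf.
    by apply: derivableP; exact: rschwartz_derivable.
  apply: is_derive_compf => //; apply/is_derive_line.
  under [X in is_derive _ _ X]eq_fun do rewrite dotC dot_line dotC.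
  exact: is_derive_affine.
have cdot : continuous (fun x => dot x xi).
  rewrite /dot; elim: (index_enum _) => [|j r ih] x.
    rewrite [X in continuous_at _ X](_ : _ = fun=> 0); last first.
      by apply/funext => y; rewrite big_nil.
    exact: (@cst_continuous 'rV[R]_n R 0 x).
  rewrite [X in continuous_at _ X](_ : _ = fun y : 'rV[R]_n =>
      y ord0 j * xi ord0 j + \sum_(l <- r) y ord0 l * xi ord0 l); last first.
    by apply/funext => y; rewrite big_cons.
  exact: (cvgD (cvgM (@coord_continuous R 1 n ord0 j x) (cvg_cst _)) (ih x)).
have ch := is_derive_derivative hd.
have cc (k : R -> R) (ck : continuous k) : continuous (fun x => k (dot x xi)).
  by move=> x; exact: (continuous_comp (cdot x) (ck _)).
have [M hM] := rschwartz_decay 0 sf; have [M' hM'] := rschwartz_decay 0 sdf.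
have M0 : 0 <= M.
  have := hM 0; rewrite expr0 mul1r => /(le_trans (normr_ge0 _)).
  by rewrite pmulr_lge0// invr_gt0 rV_weight_gt0.
have : \int[mu]_x g x = 0.
  (* A single constant has to dominate both the product, which needs M, and its derivative, which
     needs M |xi_i| + M'. *)
  apply: (Rintegral_partial0 (j := i) (f := fun x => f x * h (dot x xi))
    (M := M * (1 + `|xi ord0 i|) + M')) => //.
  - have c2 := real_continuousM (cc h ch) (rschwartz_continuous sdf).
    have c3 := real_continuousZ (c := xi ord0 i) (cc dh cdh).
    have c1 := real_continuousM (rschwartz_continuous sf) c3.
    have c4 := real_continuousD c1 c2.
    exact: c4.
  - move=> x; rewrite normrM (le_trans (ler_piMr _ (h1 _)))//.
    have := hM x; rewrite expr0 mul1r => /le_trans; apply.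
    rewrite ler_wpM2r ?invr_ge0 ?(ltW (rV_weight_gt0 _))//.
    have M'0 : 0 <= M'.
      have := hM' 0; rewrite expr0 mul1r => /(le_trans (normr_ge0 _)).
      by rewrite pmulr_lge0// invr_gt0 rV_weight_gt0.
    by rewrite mulrDr mulr1 -addrA lerDl addr_ge0// mulr_ge0.
  - move=> x; rewrite (le_trans (ler_normD _ _))// mulrDl lerD//.
      rewrite mulrAC normrM ler_pM//.
        by have := hM x; rewrite expr0 mul1r.
      by rewrite normrM (le_trans (ler_piMr _ (dh1 _)))// lerDr.
    rewrite normrM (le_trans (ler_piMl _ (h1 _)))//.
    by have := hM' x; rewrite expr0 mul1r.
rewrite RintegralD//; last 2 first.
- under [_ \o _]eq_fun do rewrite /= mulrCA; exact: intgZ.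
- under [_ \o _]eq_fun do rewrite /= mulrC; exact: intg_kernel.
under eq_Rintegral do rewrite mulrCA; rewrite RintegralZl//.
under [X in _ + X]eq_Rintegral do rewrite mulrC.
by move/eqP; rewrite addr_eq0 => /eqP.
Qed.

End kernel.

Lemma cos_derive (t : R) : is_derive t (1 : R) cos (- sin t).
Proof. exact: is_derive_cos. Qed.

Lemma norm_sinN_le1 (t : R) : `|- sin t| <= 1.
Proof. by rewrite normrN sin_max. Qed.

Lemma trig_transformN h f xi : trig_transform (fun t => - h t) f xi =
  trig_transform h (fun x => - f x) xi.
Proof. by apply: eq_Rintegral => x _; rewrite mulrN mulNr. Qed.

Lemma rschwartzN f : rschwartz f -> rschwartz (fun x => - f x).
Proof. by move=> /(rschwartzZ (-1)); under eq_fun do rewrite mulN1r. Qed.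

(** Coinduction on the class of all cosine and sine transforms of Schwartz functions.
    Differentiating multiplies the function by a coordinate, multiplying by a coordinate
    differentiates it, and both exchange cosine and sine up to sign. *)
Lemma rschwartz_trig f : rschwartz f ->
  rschwartz (trig_transform cos f) /\ rschwartz (trig_transform sin f).
Proof.
pose K : set ('rV[R]_n -> R) := [set k | exists2 f, rschwartz f &
  k = trig_transform cos f \/ k = trig_transform sin f].
have cD g xi i : rschwartz g -> is_derive xi (e_ i) (trig_transform cos g)
    (trig_transform sin (fun x => - (x ord0 i * g x)) xi).
  move=> sg; rewrite -trig_transformN.
  apply: (trig_transform_derive cos_derive norm_sinN_le1 (@cos_max R)).
    exact: intg_rschwartz.
  exact/intg_rschwartz/rschwartz_mulx.
have sD g xi i : rschwartz g -> is_derive xi (e_ i) (trig_transform sin g)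
    (trig_transform cos (fun x => x ord0 i * g x) xi).
  move=> sg; apply: (trig_transform_derive (@is_derive_sin R) (@cos_max R) (@sin_max R)).
    exact: intg_rschwartz.
  exact/intg_rschwartz/rschwartz_mulx.
suff KS : forall k, K k -> rschwartz k.
  by move=> sf; split; apply: KS; exists f => //; [left|right].
apply: rschwartz_coind.
- move=> k [g /intg_rschwartz gi [->|->]].
    exact: (trig_transform_continuous cos_derive norm_sinN_le1 (@cos_max R)).
  exact: (trig_transform_continuous (@is_derive_sin R) (@cos_max R) (@sin_max R)).
- move=> k i xi [g sg [->|->]].
    by have [] := cD g xi i sg.
  by have [] := sD g xi i sg.
- move=> k i [g sg [->|->]].
    exists (fun x => - (x ord0 i * g x)); first exact/rschwartzN/rschwartz_mulx.
    by right; apply/funext => xi; have [_ ->] := cD g xi i sg.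
  exists (fun x => x ord0 i * g x); first exact: rschwartz_mulx.
  by left; apply/funext => xi; have [_ ->] := sD g xi i sg.
- move=> k i [g sg [->|->]].
    exists (fun x => - 'D_(e_ i) g x); first exact/rschwartzN/rschwartz_derive.
    right; apply/funext => xi.
    rewrite (trig_transform_partial (@is_derive_sin R) (@cos_max R) (@sin_max R) _ _ sg);
      last exact: continuous_cos.
    rewrite /trig_transform -RintegralN//.
      by apply: eq_Rintegral => x _; rewrite mulNr.
    apply: (intg_kernel (@is_derive_sin R) (@sin_max R)).
    exact/intg_rschwartz/rschwartz_derive.
  exists (fun x => 'D_(e_ i) g x); first exact: rschwartz_derive.
  left; apply/funext => xi.
  have cNs : continuous (fun t : R => - sin t).
    by move=> t; apply: cvgN; exact: continuous_sin.
  have := trig_transform_partial cos_derive norm_sinN_le1 (@cos_max R) xi i sg cNs.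
  rewrite /trig_transform; under eq_Rintegral do rewrite mulrN.
  rewrite RintegralN; last first.
    by apply: (intg_kernel (@is_derive_sin R) (@sin_max R)); exact: intg_rschwartz.
  by rewrite mulrN => /oppr_inj.
- move=> k [g /intg_rschwartz gi [->|->]]; exists (\int[mu]_x `|g x|) => xi.
    exact: (trig_transform_le cos_derive (@cos_max R)).
  exact: (trig_transform_le (@is_derive_sin R) (@sin_max R)).
Qed.

End trig_transform.

(** * The Fourier transform on complex Schwartz functions *)

Section schwartz_complex.
Context (R : realType) (n : nat).
Implicit Types (f g phi : cfun R n) (x xi : 'rV[R]_n).
Local Notation Re := (@complex.Re R).
Local Notation Im := (@complex.Im R).
Local Notation mu := (lebesgue_rV n).

Lemma schwartzP phi : schwartz phi <->
  rschwartz (fun x => Re (phi x)) /\ rschwartz (fun x => Im (phi x)).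
Proof.
split=> [[sr si b]|[[sr br] [si bi]]].
  split; split; [exact: sr| |exact: si|] => a b'; have [M hM] := b a b'; exists M => x;
    apply: le_trans (hM x); apply: ler_wpM2l (normr_ge0 _) _ _ _.
  - exact: (normRe_le (cpartial b' phi x)).
  - exact: (normIm_le (cpartial b' phi x)).
split; [exact: sr|exact: si|] => a b; have [M hM] := br a b; have [M' hM'] := bi a b.
exists (M + M') => x; rewrite (le_trans (ler_wpM2l _ (normc_le _)))//.
by rewrite mulrDr lerD.
Qed.

Lemma schwartz_cintg phi : schwartz phi -> cintg mu phi.
Proof. by move=> /schwartzP[? ?]; split; exact: intg_rschwartz. Qed.

Lemma schwartz_real (f : 'rV[R]_n -> R) : rschwartz f -> schwartz (fun x => (f x)%:C).
Proof.
move=> sf; apply/schwartzP; split=> //=.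
by have := rschwartzZ 0 sf; under eq_fun do rewrite mul0r.
Qed.

Lemma schwartzD f g : schwartz f -> schwartz g -> schwartz (f + g).
Proof.
move=> /schwartzP[fr fi] /schwartzP[gr gi]; apply/schwartzP; split.
- by under eq_fun do rewrite cReD; exact: rschwartzD.
- by under eq_fun do rewrite cImD; exact: rschwartzD.
Qed.

Lemma schwartzZ (k : cplx R) f : schwartz f -> schwartz (fun x => k * f x).
Proof.
move=> /schwartzP[fr fi]; apply/schwartzP; split.
- under eq_fun do rewrite cReM -mulNr.
  by apply: rschwartzD; exact: rschwartzZ.
- under eq_fun do rewrite cImM.
  by apply: rschwartzD; exact: rschwartzZ.
Qed.

Lemma schwartzB f g : schwartz f -> schwartz g -> schwartz (f - g).
Proof.
move=> sf sg; apply: schwartzD => //.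
rewrite (_ : - g = fun x => -1 * g x); first exact: schwartzZ.
by apply/funext => x; rewrite mulN1r.
Qed.

Lemma normc_expi (t : R) : normc (expi t) = 1.
Proof. by rewrite normc_ReIm /= cos2Dsin2 sqrtr1. Qed.

Lemma expiD (s t : R) : expi (s + t) = expi s * expi t.
Proof. by apply: complex_eq; rewrite ?cReM ?cImM /= ?cosD ?sinD// addrC. Qed.

Lemma expi0 : expi (0 : R) = 1.
Proof. by apply: complex_eq; rewrite /= ?cos0 ?sin0. Qed.

Lemma expi_sum (I : finType) (F : I -> R) :
  expi (\sum_i F i) = \prod_i expi (F i).
Proof. by apply: (big_morph _ expiD expi0). Qed.

(** The sign [e] is -1 for the Fourier transform and 1 for the inverse one without its factor (2
    pi)^-n. The condition e^2 = 1 lets both be treated at once. *)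
Definition oscillatory (e : R) phi : cfun R n :=
  fun xi => cint mu (fun x => expi (e * dot x xi) * phi x).

Lemma fourierE phi : fourier phi = oscillatory (-1) phi.
Proof.
by apply/funext => xi; congr (cint mu _); apply/funext => x; rewrite mulN1r.
Qed.

Lemma inv_fourierE phi xi :
  inv_fourier phi xi = ((2 * pi) ^- n)%:C * oscillatory 1 phi xi.
Proof.
by congr (_ * cint mu _); apply/funext => x; rewrite mul1r.
Qed.

Lemma cmeas_expi d (T : measurableType d) (f : T -> R) : measurable_fun setT f ->
  cmeas (fun t => expi (f t)).
Proof.
move=> mf; split => /=.
- exact: measurableT_comp (continuous_measurable_fun (@continuous_cos R)) mf.
- exact: measurableT_comp (continuous_measurable_fun (@continuous_sin R)) mf.
Qed.

Section sign.
Variables (e : R) (e1 : e ^+ 2 = 1).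

Lemma sign_cases : e = 1 \/ e = -1.
Proof. by move/eqP: e1; rewrite sqrf_eq1 => /orP[] /eqP; [left|right]. Qed.

Lemma cos_sign t : cos (e * t) = cos t.
Proof. by case: sign_cases => ->; rewrite ?mul1r// mulN1r cosN. Qed.

Lemma sin_sign t : sin (e * t) = e * sin t.
Proof. by case: sign_cases => ->; rewrite ?mul1r// !mulN1r sinN. Qed.

Lemma cintg_oscillatory phi xi : cintg mu phi ->
  cintg mu (fun x => expi (e * dot x xi) * phi x).
Proof.
move=> ip; under [X in cintg _ X]eq_fun do rewrite mulrC.
apply: (cintg_mul_bounded (M := 1)) => //.
  by apply: cmeas_expi; apply: measurable_funM => //; exact: measurable_dot.
by move=> x; rewrite normc_expi.
Qed.

Lemma oscillatory_ReIm phi xi : cintg mu phi ->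
  Re (oscillatory e phi xi) = trig_transform cos (fun x => Re (phi x)) xi +
    - e * trig_transform sin (fun x => Im (phi x)) xi /\
  Im (oscillatory e phi xi) = trig_transform cos (fun x => Im (phi x)) xi +
    e * trig_transform sin (fun x => Re (phi x)) xi.
Proof.
move=> [pr pi]; have kc := intg_kernel (@cos_derive R) (@cos_max R).
have ks := intg_kernel (@is_derive_sin R) (@sin_max R).
split=> /=.
- under eq_Rintegral do rewrite cReM /= cos_sign sin_sign -!mulrA -mulNr.
  under eq_Rintegral do rewrite [cos _ * _]mulrC [sin _ * _]mulrC.
  rewrite RintegralD//; [|exact: kc|exact/intgZ/ks].
  by rewrite RintegralZl//; exact: ks.
- under eq_Rintegral do rewrite cImM /= cos_sign sin_sign -!mulrA.
  under eq_Rintegral do rewrite [cos _ * _]mulrC [sin _ * _]mulrC.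
  rewrite RintegralD//; [|exact: kc|exact/intgZ/ks].
  by rewrite RintegralZl//; exact: ks.
Qed.

Lemma oscillatory_schwartz phi : schwartz phi -> schwartz (oscillatory e phi).
Proof.
move=> sp; have ip := schwartz_cintg sp.
have /schwartzP[/rschwartz_trig[rc rs] /rschwartz_trig[ic is_]] := sp.
apply/schwartzP; split.
- under eq_fun do rewrite (oscillatory_ReIm _ ip).1.
  by apply: rschwartzD => //; exact: rschwartzZ.
- under eq_fun do rewrite (oscillatory_ReIm _ ip).2.
  by apply: rschwartzD => //; exact: rschwartzZ.
Qed.

Lemma oscillatory_continuous phi : cintg mu phi ->
  continuous (fun xi => Re (oscillatory e phi xi)) /\
  continuous (fun xi => Im (oscillatory e phi xi)).
Proof.
move=> ip; have [pr pi] := ip.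
have kc := trig_transform_continuous (@cos_derive R) (@norm_sinN_le1 R) (@cos_max R).
have ks := trig_transform_continuous (@is_derive_sin R) (@cos_max R) (@sin_max R).
split.
- under [X in continuous X]eq_fun do rewrite (oscillatory_ReIm _ ip).1.
  apply: real_continuousD; first exact: kc.
  by apply: real_continuousZ; exact: ks.
- under [X in continuous X]eq_fun do rewrite (oscillatory_ReIm _ ip).2.
  apply: real_continuousD; first exact: kc.
  by apply: real_continuousZ; exact: ks.
Qed.

Lemma normc_oscillatory phi xi : cintg mu phi ->
  normc (oscillatory e phi xi) <= \int[mu]_x normc (phi x).
Proof.
move=> ip; rewrite (le_trans (normc_cint (cintg_oscillatory xi ip)))//.
rewrite le_eqVlt; apply/orP; left; apply/eqP; apply: eq_Rintegral => x _.
by rewrite ComplexField.Normc.normcM normc_expi mul1r.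
Qed.

(** Fubini for f(x) g(y) expi(e x . y), which is integrable on the product and has a kernel
    symmetric in x and y. *)
Lemma oscillatory_duality f g : cintg mu f -> cintg mu g ->
  cint mu (fun xi => oscillatory e f xi * g xi) =
  cint mu (fun x => f x * oscillatory e g x).
Proof.
move=> fi gi; have fgi := cintg_prod_mul fi gi.
pose F (p : 'rV[R]_n * 'rV[R]_n) := f p.1 * g p.2 * expi (e * dot p.1 p.2).
have Fi : cintg (mu \x mu)%E F.
  apply: (cintg_mul_bounded (M := 1) fgi); last by move=> p; rewrite normc_expi.
  apply: cmeas_expi; apply: measurable_funM => //.
  apply: measurable_sum => i; apply: measurable_funM.
    exact: (measurableT_comp (measurable_rV_coord i) measurable_fst).
  exact: (measurableT_comp (measurable_rV_coord i) measurable_snd).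
have E1 x : (fun y => F (x, y)) = fun y => f x * (expi (e * dot y x) * g y).
  by apply/funext => y; rewrite /F /= dotC; ring.
have E2 y : (fun x => F (x, y)) = fun x => g y * (expi (e * dot x y) * f x).
  by apply/funext => x; rewrite /F /=; ring.
have F1 x : cintg mu (fun y => F (x, y)).
  by rewrite E1; exact/cintgZ/cintg_oscillatory.
have F2 y : cintg mu (fun x => F (x, y)).
  by rewrite E2; exact/cintgZ/cintg_oscillatory.
have [_ I1] := cint_prod12 Fi F1; have [_ I2] := cint_prod21 Fi F2.
transitivity (cint (mu \x mu)%E F).
  rewrite I2; congr (cint mu _); apply/funext => y.
  by rewrite E2 (cintZ _ (cintg_oscillatory y fi)) mulrC.
rewrite I1; congr (cint mu _); apply/funext => x.
by rewrite E1 (cintZ _ (cintg_oscillatory x gi)).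
Qed.

End sign.

Lemma sqrN1 : (-1) ^+ 2 = 1 :> R. Proof. by rewrite sqrrN expr1n. Qed.

Lemma fourier_schwartz phi : schwartz phi -> schwartz (fourier phi).
Proof. by move=> sp; rewrite fourierE; exact: (oscillatory_schwartz sqrN1 sp). Qed.

Lemma inv_fourier_schwartz phi : schwartz phi -> schwartz (inv_fourier phi).
Proof.
move=> /(oscillatory_schwartz (expr1n _ 2)) /(schwartzZ ((2 * pi) ^- n)%:C).
by under eq_fun do rewrite -inv_fourierE.
Qed.

End schwartz_complex.

(** * Weighted L^1 norms of transforms bounded by Schwartz seminorms *)

Section quantitative_decay.
Context (R : realType) (n : nat).
Implicit Types (f g : 'rV[R]_n -> R) (x xi : 'rV[R]_n) (a b : seq 'I_n).
Local Notation mu := (lebesgue_rV n).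
Local Notation e_ i := (delta_mx ord0 i : 'rV[R]_n).

(** Each integration by parts trades a coordinate of xi for a derivative of f and swaps cosine and
    sine. The list is reversed because [partial] applies its last direction first. *)
Lemma monomial_trig_le a f xi : rschwartz f ->
  `|monomial a xi * trig_transform cos f xi| <= \int[mu]_x `|partial (rev a) f x| /\
  `|monomial a xi * trig_transform sin f xi| <= \int[mu]_x `|partial (rev a) f x|.
Proof.
elim: a f => [|i a ih] f sf.
  rewrite /monomial big_nil !mul1r; have fi := intg_rschwartz sf; split.
    exact: (trig_transform_le (@cos_derive R) (@cos_max R)).
  exact: (trig_transform_le (@is_derive_sin R) (@sin_max R)).
have [hc hs] := ih _ (rschwartz_derive i sf).
have E : partial (rev (i :: a)) f = partial (rev a) (fun x => 'D_(e_ i) f x).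
  by rewrite rev_cons /partial foldr_rcons.
rewrite E monomial_cons [xi _ _ * _]mulrC -!mulrA; split.
  rewrite (trig_transform_partial (@is_derive_sin R) (@cos_max R) (@sin_max R) _ _ sf).
    by rewrite mulrN normrN.
  exact: continuous_cos.
have cNs : continuous (fun t : R => - sin t).
  by move=> t; apply: cvgN; exact: continuous_sin.
have := trig_transform_partial (@cos_derive R) (@norm_sinN_le1 R) (@cos_max R) xi i sf cNs.
rewrite {1}/trig_transform; under eq_Rintegral do rewrite mulrN.
rewrite RintegralN; last first.
  by apply: (intg_kernel (@is_derive_sin R) (@sin_max R)); exact: intg_rschwartz.
by rewrite mulrN => /oppr_inj ->.
Qed.

Lemma weight_le_monomials (k : nat) : exists S : seq (seq 'I_n), forall f x (c : R),
  (forall a, a \in S -> `|monomial a x * f x| <= c) ->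
  rV_weight x ^+ k * `|f x| <= (size S)%:R * c.
Proof.
have [S hS] := @weight_monomials R n (flatten (nseq k (index_enum 'I_n))).
exists S => f x c hc.
have -> : rV_weight x ^+ k =
    \prod_(i <- flatten (nseq k (index_enum 'I_n))) (1 + x ord0 i ^+ 2).
  elim: k {S hS hc} => [|k ih]; first by rewrite big_nil expr0.
  by rewrite /= big_cat exprS ih.
rewrite (le_trans (ler_wpM2r _ (hS x)))// mulr_suml.
elim: S hc {hS} => [|a S ih] hc; first by rewrite big_nil mul0r.
rewrite big_cons /= mulrS mulrDl mul1r lerD//.
  by rewrite -normrM hc// mem_head.
by apply: ih => b bS; rewrite hc// in_cons bS orbT.
Qed.

(** Continuity of the transform from the Schwartz space to weighted L^1, in quantitative form: N and
    C depend on the dimension and on k only. It is what makes restrictions of functionals on B^s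
    tempered. *)
Lemma trig_small (k : nat) : exists (N : nat) (C : R), forall f (d : R), rschwartz f ->
  (forall a b, (size a <= N)%N -> (size b <= N)%N ->
    forall x, `|monomial a x| * `|partial b f x| <= d) ->
  \int[mu]_xi (rV_weight xi ^+ k * `|trig_transform cos f xi|) <= C * d /\
  \int[mu]_xi (rV_weight xi ^+ k * `|trig_transform sin f xi|) <= C * d.
Proof.
(* The power k + 1 leaves one inverse weight, integrable in xi. Likewise [S1] below controls one
   weight in x and makes the derivatives of f integrable with an explicit bound. *)
have [S hS] := weight_le_monomials k.+1.
have [S1 hS1] := weight_le_monomials 1.
pose q := \int[mu]_x (rV_weight x)^-1 : R.
(* N bounds both the number of derivatives, coming from [S], and the degree of the monomials in x,
   coming from [S1]. *)
pose N := (\max_(a <- S) size a + \max_(a <- S1) size a)%N.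
exists N, ((size S)%:R * ((size S1)%:R * q) * q) => f d sf hd.
have szS a : a \in S -> (size a <= N)%N.
  by move=> aS; apply: leq_trans (leq_addr _ _); apply: leq_bigmax_seq aS _.
have szS1 a : a \in S1 -> (size a <= N)%N.
  by move=> aS; apply: leq_trans (leq_addl _ _); apply: leq_bigmax_seq aS _.
have sp b : rschwartz (partial b f).
  by elim: b => [//|i b ih]; exact: rschwartz_derive.
have pb b : (size b <= N)%N -> \int[mu]_x `|partial b f x| <= (size S1)%:R * d * q.
  move=> sb; rewrite /q -RintegralZl//; last exact: intg_weightV.
  apply: le_Rintegral => //.
  - exact/intg_norm/intg_rschwartz.
  - exact/intgZ/intg_weightV.
  - move=> x _; rewrite ler_pdivlMr ?rV_weight_gt0// mulrC -{1}[rV_weight x]expr1.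
    by apply: hS1 => a aS1; rewrite normrM hd// szS1.
suff H T : rschwartz T -> (forall a xi, `|monomial a xi * T xi| <=
    \int[mu]_x `|partial (rev a) f x|) ->
    \int[mu]_xi (rV_weight xi ^+ k * `|T xi|) <=
      (size S)%:R * ((size S1)%:R * q) * q * d.
  have [rc rs] := rschwartz_trig sf.
  by split; apply: H => // a xi; have [] := monomial_trig_le a xi sf.
move=> sT hT; rewrite mulrAC /q -[leRHS]RintegralZl//; last exact: intg_weightV.
apply: le_Rintegral => //.
- have := intg_norm (intg_rschwartz_weight k sT); congr (is_true (integrable _ _ _)).
  apply/funext => x /=; congr EFin.
  by rewrite normrM ger0_norm// exprn_ge0// ltW// rV_weight_gt0.
- exact/intgZ/intg_weightV.
- move=> xi _; rewrite ler_pdivlMr ?rV_weight_gt0// mulrAC -exprSr -!mulrA.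
  apply: hS => a aS; rewrite (le_trans (hT _ _))// (le_trans (pb _ _)) ?size_rev ?szS//.
  by rewrite mulrAC mulrA.
Qed.

End quantitative_decay.

(** * Gaussians *)

Section gaussian.
Context (R : realType).
Local Notation leb := (@lebesgue_measure R).
Implicit Types (t a u xi : R).

Definition gauss t a u := expR (- (t * (u - a) ^+ 2)).

Lemma gauss_ge0 t a u : 0 <= gauss t a u. Proof. exact: expR_ge0. Qed.

Lemma gauss_derive t a u : is_derive u (1 : R) (gauss t a) (- (2 * t * (u - a)) * gauss t a u).
Proof.
have h : is_derive u (1 : R) (fun u => u * 1 - a) 1 by exact: is_derive_affine.
have := is_derive_compf (is_deriveNf (is_deriveZf t (is_deriveMf h h)))
  (is_derive_expR _).
rewrite (_ : (fun y => expR _) = gauss t a); last first.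
  by apply/funext => y; rewrite /gauss mulr1 expr2.
move=> /is_derive_eq; apply; rewrite /gauss !mulr1 -expr2; congr (_ * _); ring.
Qed.

Lemma gauss_continuous t a : continuous (gauss t a).
Proof. exact: is_derive_derivative (gauss_derive t a). Qed.

Lemma gauss_integral t a : 0 < t ->
  intg leb (gauss t a) /\ \int[leb]_u gauss t a u = Num.sqrt (pi / t).
Proof.
(* With variance 1/(2t), the Gaussian is the normal density centred at a, up to its peak value. *)
move=> t0; pose s := Num.sqrt (2 * t)^-1.
have s2 : s ^+ 2 = (2 * t)^-1 by rewrite sqr_sqrtr// invr_ge0 mulr_ge0// ltW.
have s0 : s != 0 by rewrite gt_eqF// sqrtr_gt0 invr_gt0 mulr_gt0.
have t_neq0 : t != 0 by rewrite gt_eqF.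
have s22 : s ^+ 2 *+ 2 = t^-1 by rewrite s2 -mulr_natl; field.
have p0 := normal_peak_gt0 s0.
have E : gauss t a = fun u => (normal_peak s)^-1 * normal_pdf a s u.
  apply/funext => u; rewrite normal_pdfE// mulrA mulVf ?gt_eqF// mul1r.
  by rewrite /normal_fun s22 invrK mulNr mulrC.
have ni : intg leb (normal_pdf a s) by exact: integrable_normal_pdf.
split; first by rewrite E; exact: intgZ.
rewrite E RintegralZl// /Rintegral integral_normal_pdf/= mulr1.
by rewrite /normal_peak invrK -mulrnAl s22 mulrC.
Qed.

(** Completing the square gives m z <= t z^2 + m^2/(4t) with z = |u - a|; combined with |u| <= z +
    |a| this yields the constant. *)
Lemma gauss_bound t a (m : R) : 0 < t -> 0 <= m -> exists M : R, 0 <= M /\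
  forall u, expR (m * `|u|) * gauss t a u <= M.
Proof.
move=> t0 m0; exists (expR (m * `|a| + m ^+ 2 / (4 * t))); split.
  exact: expR_ge0.
move=> u; rewrite -expRD ler_expR.
have ua : `|u| <= `|u - a| + `|a| by rewrite -{1}(subrK a u) ler_normD.
have -> : (u - a) ^+ 2 = `|u - a| ^+ 2 by rewrite real_normK// num_real.
set z := `|u - a| in ua *.
have hz : m * z <= t * z ^+ 2 + m ^+ 2 / (4 * t).
  have t_neq0 : t != 0 by rewrite gt_eqF.
  rewrite -subr_ge0 (_ : _ - _ = t * (z - m / (2 * t)) ^+ 2); last by field.
  by rewrite mulr_ge0 ?sqr_ge0// ltW.
have := ler_wpM2l m0 ua; lra.
Qed.

Lemma gauss_decay t a : 0 < t -> exists M : R, 0 <= M /\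
  forall u, (1 + `|u|) * gauss t a u <= M * (1 + u ^+ 2)^-1.
Proof.
(* The exponent 3 comes from (1 + |u|)(1 + u^2) <= (1 + |u|)^3 <= exp(3 |u|). *)
move=> t0; have [M [M0 hM]] := gauss_bound a t0 (ler0n R 3).
exists M; split=> // u.
rewrite ler_pdivlMr; last by rewrite ltr_pwDl// sqr_ge0.
apply: le_trans (hM u); rewrite mulrAC ler_wpM2r ?gauss_ge0//.
have e1 : 1 + `|u| <= expR `|u| by exact: expR_ge1Dx.
have -> : expR (3 * `|u|) = expR `|u| * expR `|u| ^+ 2.
  by rewrite -exprS -expRM_natl mulr_natl -mulr_natl.
rewrite ler_pM// ?addr_ge0 ?sqr_ge0//.
apply: (@le_trans _ _ ((1 + `|u|) ^+ 2)); last by rewrite lerXn2r ?nnegrE ?addr_ge0 ?expR_ge0.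
rewrite sqrrD expr1n real_normK ?num_real// -addrA lerD2l lerDr mul1r.
by rewrite mulrn_wge0.
Qed.

Lemma measurable_gauss t a : measurable_fun setT (gauss t a).
Proof. by apply: continuous_measurable_fun; exact: gauss_continuous. Qed.

Lemma intg_gauss_mulx t a : 0 < t -> intg leb (fun u => gauss t a u * u).
Proof.
move=> t0; have [M [_ hM]] := gauss_decay a t0.
have mf : measurable_fun setT (fun u => gauss t a u * u).
  by apply: measurable_funM => //; exact: measurable_gauss.
apply: (intg_le (mu := leb) mf (g := fun u => M * (1 + u ^+ 2)^-1)).
  move=> u; rewrite normrM mulrC (ger0_norm (gauss_ge0 _ _ _)).
  by apply: le_trans (hM u); rewrite ler_wpM2r ?gauss_ge0// lerDr.
exact/intgZ/intg_oneDsqrV.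
Qed.

Section kernel.
Variables h dh : R -> R.
Hypothesis hd : forall t : R, is_derive t (1 : R) h (dh t).
Hypothesis h1 : forall t, `|h t| <= 1.
Hypothesis dh1 : forall t, `|dh t| <= 1.
Hypothesis cdh : continuous dh.

(** The summand 0 in the argument is the constant [Y] of [is_derive_integral], kept so that the two
    forms match. *)
Lemma measurable_scale (k : R -> R) xi : continuous k ->
  measurable_fun setT (fun u => k (xi * u + 0)).
Proof.
move=> ck; apply: (measurableT_comp (continuous_measurable_fun ck)).
by apply: measurable_funD => //; exact: measurable_funM.
Qed.

(* Integrating the derivative of gauss * h(xi u) over R gives 0. For h = cos, sin this is
   the linear ODE in xi that determines the Fourier transform of a Gaussian. *)
Lemma gauss_parts t a xi : 0 < t ->
  2 * t * \int[leb]_u (gauss t a u * u * h (xi * u + 0)) =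
  2 * t * a * \int[leb]_u (gauss t a u * h (xi * u + 0)) +
  xi * \int[leb]_u (gauss t a u * dh (xi * u + 0)).
Proof.
move=> t0; have [gi _] := gauss_integral a t0.
have gui := intg_gauss_mulx a t0.
have ch := is_derive_derivative hd.
have mh := measurable_scale xi ch; have mdh := measurable_scale xi cdh.
have I0 : intg leb (fun u => gauss t a u * h (xi * u + 0)).
  exact: (intg_bounded_mul (mu := leb) (M := 1) mh).
have I1 : intg leb (fun u => gauss t a u * u * h (xi * u + 0)).
  exact: (intg_bounded_mul (mu := leb) (M := 1) mh).
have I2 : intg leb (fun u => gauss t a u * dh (xi * u + 0)).
  exact: (intg_bounded_mul (mu := leb) (M := 1) mdh).
pose du u := xi * (gauss t a u * dh (xi * u + 0)) +
  (- (2 * t) * (gauss t a u * u * h (xi * u + 0)) +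
   2 * t * a * (gauss t a u * h (xi * u + 0))).
have dE u : is_derive u (1 : R) (fun u => gauss t a u * h (xi * u + 0)) (du u).
  have l : is_derive u (1 : R) (fun u => xi * u + 0) xi.
    by under [X in is_derive _ _ X]eq_fun do rewrite mulrC; exact: is_derive_affine.
  apply: is_derive_eq (is_deriveMf (gauss_derive t a u) (is_derive_compf l (hd _))) _.
  rewrite /du; ring.
have cdu : continuous du.
  have cs (k : R -> R) : continuous k -> continuous (fun u => k (xi * u + 0)).
    move=> ck; apply: real_continuous_comp ck.
    by under [X in continuous X]eq_fun do rewrite addr0; apply: real_continuousZ => u.
  have cg : continuous (gauss t a) by exact: gauss_continuous.
  have ci : continuous (@id R) by move=> u.
  exact: (real_continuousD (real_continuousZ (c := xi) (real_continuousM cg (cs _ cdh)))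
    (real_continuousD
      (real_continuousZ (c := - (2 * t)) (real_continuousM (real_continuousM cg ci) (cs _ ch)))
      (real_continuousZ (c := 2 * t * a) (real_continuousM cg (cs _ ch))))).
have [M [M0 hM]] := gauss_decay a t0.
(* The 1 covers the function itself; the other summands are the sizes of the three coefficients in
   [du]. *)
pose K := M * (1 + (`|xi| + (2 * t + 2 * t * `|a|))).
have K0 : `|xi| + (2 * t + 2 * t * `|a|) >= 0.
  by rewrite !addr_ge0 ?mulr_ge0// ltW.
have uK u : `|gauss t a u * h (xi * u + 0)| <= K * (1 + u ^+ 2)^-1.
  rewrite normrM ger0_norm ?gauss_ge0//.
  apply: (@le_trans _ _ (M * (1 + u ^+ 2)^-1)).
    apply: le_trans (hM u); rewrite mulrC ler_wpM2r ?gauss_ge0//.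
    by rewrite (le_trans (h1 _))// lerDl.
  rewrite ler_wpM2r ?invr_ge0 ?addr_ge0 ?sqr_ge0//.
  by rewrite /K ler_peMr// lerDl.
have duK u : `|du u| <= K * (1 + u ^+ 2)^-1.
  have g0 := gauss_ge0 t a u.
  have t20 : 0 <= 2 * t by rewrite mulr_ge0// ltW.
  apply: (@le_trans _ _ ((`|xi| + (2 * t + 2 * t * `|a|)) * ((1 + `|u|) * gauss t a u))).
    rewrite /du (le_trans (ler_normD _ _))//.
    apply: (@le_trans _ _ (`|xi| * gauss t a u + (2 * t * (gauss t a u * `|u|) +
        2 * t * `|a| * gauss t a u))).
      apply: lerD.
        by rewrite !normrM (ger0_norm g0) ler_wpM2l// ler_piMr.
      apply: le_trans (ler_normD _ _) _; apply: lerD.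
        rewrite normrM normrN (ger0_norm t20) ler_wpM2l// !normrM (ger0_norm g0).
        by rewrite ler_piMr// mulr_ge0.
      rewrite normrM (normrM _ a) (ger0_norm t20).
      rewrite (ler_wpM2l (mulr_ge0 t20 (normr_ge0 a)))//.
      by rewrite normrM (ger0_norm g0) ler_piMr.
    rewrite -subr_ge0 (_ : _ - _ = `|xi| * `|u| * gauss t a u + 2 * t * gauss t a u +
      2 * t * `|a| * `|u| * gauss t a u); last by ring.
    by rewrite !addr_ge0 ?mulr_ge0// ltW.
  rewrite /K [M * (1 + _)]mulrC -(mulrA _ M); apply: ler_pM => //.
    by rewrite mulr_ge0// addr_ge0.
  by rewrite lerDr.
have := Rintegral_derive0 dE cdu uK duK.
rewrite /du RintegralD//; last 2 first.
- exact: intgZ.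
- by apply: intgD; exact: intgZ.
rewrite RintegralD//; [|exact: intgZ|exact: intgZ].
rewrite !RintegralZl// => H; lra.
Qed.

End kernel.

(** As functions of the frequency x, the two transforms c and s solve the linear system c' = -(a s +
    x/(2t) c), s' = a c - x/(2t) s, whose value at 0 is known from the Gaussian integral. *)
Lemma gauss_trig_integral t a xi : 0 < t ->
  \int[leb]_u (gauss t a u * cos (xi * u + 0)) =
    Num.sqrt (pi / t) * gauss (1 / (4 * t)) 0 xi * cos (a * xi) /\
  \int[leb]_u (gauss t a u * sin (xi * u + 0)) =
    Num.sqrt (pi / t) * gauss (1 / (4 * t)) 0 xi * sin (a * xi).
Proof.
move=> t0; have [gi g1] := gauss_integral a t0; have gui := intg_gauss_mulx a t0.
have t_neq0 : t != 0 by rewrite gt_eqF.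
pose c x := \int[leb]_u (gauss t a u * cos (x * u + 0)).
pose s x := \int[leb]_u (gauss t a u * sin (x * u + 0)).
have cNs : continuous (fun t : R => - sin t).
  by move=> y; apply: cvgN; exact: continuous_sin.
have mid : measurable_fun setT (@id R) by [].
have mcst : measurable_fun (setT : set R) (cst (0 : R)) by exact: measurable_cst.
have dc x : is_derive x (1 : R) c (- (a * s x + x / (2 * t) * c x)).
  have H := is_derive_integral (mu := leb) (@cos_derive R) (@norm_sinN_le1 R)
    (@cos_max R) x gi mid mcst gui.
  apply: is_derive_eq H _.
  have p := gauss_parts (@is_derive_sin R) (@sin_max R) (@cos_max R)
    (@continuous_cos R) a x t0.
  under eq_Rintegral do rewrite mulrN.
  rewrite RintegralN; last first.
    apply: (intg_bounded_mul (mu := leb) (M := 1) _ _ gui).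
      exact: measurable_scale (@continuous_sin R).
    by move=> u; exact: sin_max.
  congr (- _); apply: (mulfI (x := 2 * t)); first by rewrite mulf_neq0 ?pnatr_eq0.
  by rewrite p -/(c x) -/(s x); field.
have ds x : is_derive x (1 : R) s (a * c x - x / (2 * t) * s x).
  have H := is_derive_integral (mu := leb) (@is_derive_sin R) (@cos_max R)
    (@sin_max R) x gi mid mcst gui.
  apply: is_derive_eq H _.
  have p := gauss_parts (@cos_derive R) (@cos_max R) (@norm_sinN_le1 R) cNs a x t0.
  apply: (mulfI (x := 2 * t)); first by rewrite mulf_neq0 ?pnatr_eq0.
  rewrite p -/(c x); under [X in _ + _ * X = _]eq_Rintegral do rewrite mulrN.
  rewrite RintegralN; last first.
    apply: (intg_bounded_mul (mu := leb) (M := 1) _ _ gi).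
      exact: measurable_scale (@continuous_sin R).
    by move=> u; exact: sin_max.
  by rewrite -/(s x); field.
pose E x := expR (1 / (4 * t) * (x * x)).
have dE x : is_derive x (1 : R) E (x / (2 * t) * E x).
  have H := is_derive_compf (is_deriveZf (1 / (4 * t)) (is_deriveMf (is_derive_id x 1)
    (is_derive_id x 1))) (is_derive_expR _).
  apply: is_derive_eq H _; rewrite /= -/(E x); congr (_ * _); field.
  by rewrite ?pnatr_eq0.
have dl x : is_derive x (1 : R) (fun y => a * y) a.
  by apply: is_derive_eq (is_deriveZf a (is_derive_id x 1)) _; rewrite mulr1.
have dC x : is_derive x (1 : R) (fun x => cos (a * x)) (a * - sin (a * x)).
  exact: (is_derive_compf (dl x) (is_derive_cos (a * x))).
have dS x : is_derive x (1 : R) (fun x => sin (a * x)) (a * cos (a * x)).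
  exact: (is_derive_compf (dl x) (is_derive_sin (a * x))).
(* Multiplying by the integrating factor exp(x^2/(4t)) and rotating the pair (c, s) by the angle a x
   turns both components into constants. *)
have P0 : E xi * (c xi * cos (a * xi) + s xi * sin (a * xi)) =
    E 0 * (c 0 * cos (a * 0) + s 0 * sin (a * 0)).
  apply: (is_derive_0_is_cst (f := fun x => E x * (c x * cos (a * x) + s x * sin (a * x)))) => x.
  have H := is_deriveMf (dE x)
    (is_deriveDf (is_deriveMf (dc x) (dC x)) (is_deriveMf (ds x) (dS x))).
  by apply: is_derive_eq H _; ring.
have Q0 : E xi * (s xi * cos (a * xi) + - c xi * sin (a * xi)) =
    E 0 * (s 0 * cos (a * 0) + - c 0 * sin (a * 0)).
  apply: (is_derive_0_is_cst (f := fun x => E x * (s x * cos (a * x) + - c x * sin (a * x)))) => x.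
  have H := is_deriveMf (dE x)
    (is_deriveDf (is_deriveMf (ds x) (dC x)) (is_deriveMf (is_deriveNf (dc x)) (dS x))).
  by apply: is_derive_eq H _; ring.
have E0 : E 0 = 1 by rewrite /E mulr0 mulr0 expR0.
have c0 : c 0 = Num.sqrt (pi / t).
  by rewrite -g1; apply: eq_Rintegral => u _; rewrite mul0r addr0 cos0 mulr1.
have s0 : s 0 = 0.
  rewrite -[RHS](mul0r (fine (leb setT))) -Rintegral_cst//.
  by apply: eq_Rintegral => u _; rewrite mul0r addr0 sin0 mulr0.
rewrite E0 mulr0 cos0 sin0 c0 s0 !mulr0 !mulr1 !mul1r ?oppr0 ?addr0 in P0 Q0.
have EG : gauss (1 / (4 * t)) 0 xi * E xi = 1.
  by rewrite /gauss /E -expRD subr0 expr2 addNr expR0.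
have cs1 := cos2Dsin2 (a * xi).
rewrite -/(c xi) -/(s xi).
set G := gauss _ _ _ in EG *; set q := Num.sqrt _ in P0 *.
set C := cos _ in P0 Q0 cs1 *; set S := sin _ in P0 Q0 cs1 *.
have h1 : c xi * C + s xi * S = q * G.
  by rewrite -[LHS]mul1r -EG -mulrA P0 mulrC.
have h2 : s xi * C - c xi * S = 0.
  by rewrite -[LHS]mul1r -EG -mulrA -mulNr Q0 mulr0.
split.
- transitivity ((c xi * C + s xi * S) * C - (s xi * C - c xi * S) * S).
    by rewrite -[LHS]mulr1 -cs1; ring.
  by rewrite h1 h2 mul0r subr0.
- transitivity ((c xi * C + s xi * S) * S + (s xi * C - c xi * S) * C).
    by rewrite -[LHS]mulr1 -cs1; ring.
  by rewrite h1 h2 mul0r addr0.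
Qed.

Lemma gauss_expi t a xi : 0 < t ->
  cintg leb (fun u => expi (u * xi) * (gauss t a u)%:C) /\
  cint leb (fun u => expi (u * xi) * (gauss t a u)%:C) =
  (Num.sqrt (pi / t) * gauss (1 / (4 * t)) 0 xi)%:C * expi (a * xi).
Proof.
move=> t0; have [gi _] := gauss_integral a t0.
have [hc hs] := gauss_trig_integral a xi t0.
have Er u : complex.Re (expi (u * xi) * (gauss t a u)%:C) = gauss t a u * cos (xi * u + 0).
  by rewrite cReM /= mulr0 subr0 addr0 mulrC [u * _]mulrC.
have Ei u : complex.Im (expi (u * xi) * (gauss t a u)%:C) = gauss t a u * sin (xi * u + 0).
  by rewrite cImM /= mulr0 add0r addr0 mulrC [u * _]mulrC.
split.
  split.
    rewrite (_ : (fun u => _) = fun u => gauss t a u * cos (xi * u + 0)); last exact/funext.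
    apply: (intg_bounded_mul (mu := leb) (M := 1) _ _ gi).
      exact: measurable_scale (@continuous_cos R).
    by move=> u; exact: cos_max.
  rewrite (_ : (fun u => _) = fun u => gauss t a u * sin (xi * u + 0)); last exact/funext.
  apply: (intg_bounded_mul (mu := leb) (M := 1) _ _ gi).
    exact: measurable_scale (@continuous_sin R).
  by move=> u; exact: sin_max.
apply: complex_eq.
- transitivity (\int[leb]_u (gauss t a u * cos (xi * u + 0))).
    by apply: eq_Rintegral => u _; exact: Er.
  by rewrite hc cReM /= mul0r subr0.
- transitivity (\int[leb]_u (gauss t a u * sin (xi * u + 0))).
    by apply: eq_Rintegral => u _; exact: Ei.
  by rewrite hs cImM /= mul0r addr0.
Qed.

End gaussian.

(** * Gaussians on R^n and their transforms *)

Section tensor_gaussian.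
Context (R : realType) (n : nat).
Local Notation e_ i := (delta_mx ord0 i : 'rV[R]_n).
Implicit Types (t : R) (a x xi : 'rV[R]_n).

Definition gaussN t a x := \prod_i gauss t (a ord0 i) (x ord0 i).

Lemma gaussN_ge0 t a x : 0 <= gaussN t a x.
Proof. by apply: prodr_ge0 => i _; exact: gauss_ge0. Qed.

Lemma gaussN_continuous t a : continuous (gaussN t a).
Proof.
rewrite /gaussN; elim: (index_enum _) => [|i r ih].
  rewrite (_ : (fun x => _) = fun=> 1); first by move=> x; exact: (@cst_continuous 'rV[R]_n R).
  by apply/funext => x; rewrite big_nil.
rewrite (_ : (fun x => _) = fun x : 'rV[R]_n => gauss t (a ord0 i) (x ord0 i) *
    \prod_(j <- r) gauss t (a ord0 j) (x ord0 j)); last first.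
  by apply/funext => x; rewrite big_cons.
apply: real_continuousM ih; apply: real_continuous_comp.
  by move=> x; exact: (@coord_continuous R 1 n ord0 i x).
exact: gauss_continuous.
Qed.

Lemma gaussN_derive t a x i : is_derive x (e_ i) (gaussN t a)
  (- (2 * t * (x ord0 i - a ord0 i)) * gaussN t a x).
Proof.
apply/is_derive_line.
pose K := \prod_(j | j != i) gauss t (a ord0 j) (x ord0 j).
have E s : gaussN t a (s *: e_ i + x) = K * gauss t (a ord0 i) (s * 1 + x ord0 i).
  rewrite /gaussN (bigD1 i)//= mulrC !mxE !eqxx; congr (_ * _).
  by apply: eq_bigr => j ji; rewrite !mxE eqxx (negbTE ji) mulr0 add0r.
under [X in is_derive _ _ X]eq_fun do rewrite E.
have H := is_deriveZf K (is_derive_compf (is_derive_affine 1 (x ord0 i) 0)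
  (gauss_derive t (a ord0 i) _)).
apply: is_derive_eq H _; have := E 0; rewrite scale0r add0r mul0r add0r => ->.
ring.
Qed.

(** A crude bound chosen because it factors over the coordinates: a monomial times a Gaussian is
    then estimated by [gauss_bound] in each variable. *)
Lemma norm_monomial_le (l : seq 'I_n) x :
  `|monomial l x| <= \prod_i expR ((size l)%:R * `|x ord0 i|).
Proof.
rewrite -expR_sum; elim: l => [|i l ih].
  by rewrite /monomial big_nil normr1 -[leLHS]expR0 ler_expR sumr_ge0// => i _; rewrite mul0r.
rewrite monomial_cons normrM.
apply: (@le_trans _ _ (expR (\sum_j `|x ord0 j|) * expR (\sum_j (size l)%:R * `|x ord0 j|))).
  apply: ler_pM => //; apply: (@le_trans _ _ (expR `|x ord0 i|)).
    by apply: le_trans (expR_ge1Dx _); rewrite lerDr.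
  by rewrite ler_expR (bigD1 i)//= lerDl sumr_ge0.
rewrite -expRD ler_expR -big_split le_eqVlt; apply/orP; left; apply/eqP.
by apply: eq_bigr => j _; rewrite [size (_ :: _)]/= mulrS mulrDl mul1r.
Qed.

Lemma gaussN_rschwartz t a : 0 < t -> rschwartz (gaussN t a).
Proof.
(* One generator suffices, since each partial derivative of the Gaussian is an affine function of a
   coordinate times the Gaussian. *)
move=> t0; apply: (@poly_span_rschwartz _ _ [set gaussN t a]); last exact: span_base.
- by move=> f ->; exact: gaussN_continuous.
- by move=> f i x ->; have [] := gaussN_derive t a x i.
- move=> f i ->.
  rewrite (_ : (fun x => _) = fun x => - (2 * t) * (x ord0 i * gaussN t a x) +
      2 * t * a ord0 i * gaussN t a x).
    apply: span_add; apply: span_scale; last exact: span_base.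
    exact/span_mul/span_base.
  by apply/funext => x; have [_ ->] := gaussN_derive t a x i; ring.
- move=> f l ->; have /choice[M hM] i := gauss_bound (a ord0 i) t0 (ler0n R (size l)).
  exists (\prod_i M i) => x; rewrite normrM (ger0_norm (gaussN_ge0 _ _ _)).
  apply: le_trans (ler_wpM2r (gaussN_ge0 _ _ _) (norm_monomial_le l x)) _.
  rewrite /gaussN -big_split; apply: ler_prod => i _ /=.
  by rewrite mulr_ge0 ?expR_ge0 ?gauss_ge0// (hM i).2.
Qed.

Section inversion.
Variables (e t : R) (a : 'rV[R]_n).
Hypotheses (e1 : e ^+ 2 = 1) (t0 : 0 < t).

Lemma oscillatory_gaussN xi : oscillatory e (fun x => (gaussN t a x)%:C) xi =
  \prod_i ((Num.sqrt (pi / t) * gauss (1 / (4 * t)) 0 (xi ord0 i))%:C *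
           expi (e * (a ord0 i * xi ord0 i))).
Proof.
rewrite /oscillatory.
rewrite (_ : (fun x => _) = fun x : 'rV[R]_n => \prod_i
    (expi (x ord0 i * (e * xi ord0 i)) * (gauss t (a ord0 i) (x ord0 i))%:C)).
  rewrite (cint_tensor (k := fun i u => expi (u * (e * xi ord0 i)) *
    (gauss t (a ord0 i) u)%:C) _).2; last first.
    by move=> i; exact: (gauss_expi _ _ t0).1.
  apply: eq_bigr => i _; rewrite (gauss_expi _ _ t0).2 mulrCA; congr (_%:C * _).
  by rewrite /gauss !subr0 exprMn e1 (mul1r (_ ^+ 2)).
apply/funext => x; rewrite /gaussN rmorph_prod /dot mulr_sumr expi_sum -big_split.
by apply: eq_bigr => i _; rewrite mulrCA.
Qed.

(** The transform of a Gaussian is a modulated Gaussian of parameter 1/(4t), so the one-variable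
    formula applies a second time. The two constants of each coordinate multiply to 2 pi. *)
Lemma oscillatory_gaussN_inv x :
  oscillatory (- e) (oscillatory e (fun x => (gaussN t a x)%:C)) x =
  ((2 * pi) ^+ n * gaussN t a x)%:C.
Proof.
have s0 : 0 < 1 / (4 * t) by rewrite divr_gt0// mulr_gt0.
have t_neq0 : t != 0 by rewrite gt_eqF.
rewrite {1}/oscillatory.
(* The phase left by the centre a and the phase of the second transform combine, in coordinate i, to
   the frequency e (a_i - x_i). *)
pose k i u : cplx R := (Num.sqrt (pi / t))%:C *
  (expi (u * (e * (a ord0 i - x ord0 i))) * (gauss (1 / (4 * t)) 0 u)%:C).
rewrite (_ : (fun xi => _) = fun xi : 'rV[R]_n => \prod_i k i (xi ord0 i)); last first.
  apply/funext => xi; rewrite oscillatory_gaussN /dot mulr_sumr expi_sum -big_split.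
  apply: eq_bigr => i _ /=; rewrite /k rmorphM /=.
  have -> : xi ord0 i * (e * (a ord0 i - x ord0 i)) =
    - e * (xi ord0 i * x ord0 i) + e * (a ord0 i * xi ord0 i) by ring.
  rewrite expiD; ring.
have gi i := gauss_expi 0 (e * (a ord0 i - x ord0 i)) s0.
rewrite (cint_tensor (k := k) _).2; last by move=> i; apply: cintgZ; exact: (gi i).1.
have -> : (2 * pi) ^+ n = \prod_(i < n) (2 * pi) :> R by rewrite prodr_const card_ord.
rewrite /gaussN -big_split rmorph_prod.
apply: eq_bigr => i _; rewrite /k (cintZ _ (gi i).1) (gi i).2 mul0r expi0 mulr1 -rmorphM /=.
congr (_%:C); rewrite mulrA -sqrtrM ?divr_ge0 ?pi_ge0 ?ltW//.
have -> : pi / t * (pi / (1 / (4 * t))) = (2 * pi) ^+ 2 :> R by field.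
rewrite sqrtr_sqr ger0_norm ?mulr_ge0 ?pi_ge0//; congr (_ * expR (- _)).
have -> : (e * (a ord0 i - x ord0 i) - 0) ^+ 2 = (x ord0 i - a ord0 i) ^+ 2.
  by rewrite subr0 exprMn e1 mul1r -sqrrN opprB.
by field.
Qed.

End inversion.

End tensor_gaussian.

(** * Functions orthogonal to all Gaussians *)

Section smoothing.
Context (R : realType).
Local Notation leb := (@lebesgue_measure R).

(** For k > 0, the ramp rising from 0 at a to 1 at a + 1/k: a Lipschitz approximation of the
    indicator of ]a, +oo[. *)
Definition smooth_step (a : R) (k : nat) (u : R) : R :=
  Num.min 1 (Num.max 0 (k%:R * (u - a))).

Lemma smooth_step_itv a k u : 0 <= smooth_step a k u <= 1.
Proof. by rewrite /smooth_step le_min ler01 le_max lexx/= ge_min lexx. Qed.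

Lemma smooth_step_lipschitz a k u v :
  `|smooth_step a k u - smooth_step a k v| <= k%:R * `|u - v|.
Proof.
pose M (z : R) := Num.min 1 (Num.max 0 z).
have M0 z : z <= 0 -> M z = 0 by move=> z0; rewrite /M max_l// min_r.
have Mz z : 0 <= z -> z <= 1 -> M z = z by move=> z0 z1; rewrite /M max_r// min_r.
have M1 z : 1 <= z -> M z = 1.
  by move=> z1; rewrite /M max_r ?min_l// (le_trans ler01).
have HM z : [\/ z <= 0 /\ M z = 0, 0 <= z <= 1 /\ M z = z | 1 <= z /\ M z = 1].
  have [z0|/ltW z0] := lerP z 0; first by apply: Or31; rewrite M0.
  have [z1|/ltW z1] := lerP z 1; first by apply: Or32; rewrite Mz ?z0.
  by apply: Or33; rewrite M1.
have H p q : `|M p - M q| <= `|p - q|.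
  have n1 := ler_norm (p - q); have n2 := ler_norm (q - p); rewrite distrC in n2.
  by rewrite ler_norml; case: (HM p) => -[hp ->]; case: (HM q) => -[hq ->];
    apply/andP; split; lra.
by rewrite (le_trans (H _ _))// -mulrBr normrM normr_nat opprB addrA subrK.
Qed.

Lemma measurable_smooth_step a k : measurable_fun setT (smooth_step a k).
Proof.
apply: measurable_minr => //; apply: measurable_maxr => //.
by apply: measurable_funM => //; exact: measurable_funB.
Qed.

Lemma smooth_step_cvg a u : smooth_step a k u @[k --> \oo] --> ((a < u)%R%:R : R).
Proof.
apply: cvg_near_cst; have [au|ua] := ltP a u; last first.
  near=> k; rewrite /smooth_step (_ : Num.max _ _ = 0) ?min_r//.
  by apply/max_idPl; rewrite mulr_ge0_le0// subr_le0.
have ua0 : 0 < u - a by rewrite subr_gt0.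
near=> k; rewrite /smooth_step; apply/min_idPl; rewrite le_max; apply/orP; right.
rewrite -ler_pdivrMr// mul1r; near: k; exact: nbhs_infty_ger.
Unshelve. all: end_near. Qed.

(** For t > 0, the average of [kap] under the normal law with mean u and variance 1/(2t). *)
Definition gauss_mean (t : R) (kap : R -> R) (u : R) : R :=
  (Num.sqrt (pi / t))^-1 * \int[leb]_v (kap v * gauss t u v).

Section mean.
Variables (t : R) (t0 : 0 < t) (kap : R -> R).
Hypotheses (mk : measurable_fun setT kap) (k1 : forall v, 0 <= kap v <= 1).

Lemma intg_gauss_mean u : intg leb (fun v => kap v * gauss t u v).
Proof.
have [gi _] := gauss_integral u t0.
under [_ \o _]eq_fun do rewrite /= mulrC.
apply: (intg_bounded_mul (mu := leb) (M := 1) mk _ gi).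
by move=> v; have /andP[h0 h1] := k1 v; rewrite ger0_norm.
Qed.

Lemma sqrt_gauss_gt0 : 0 < Num.sqrt (pi / t).
Proof. by rewrite sqrtr_gt0 divr_gt0// pi_gt0. Qed.

Lemma gauss_mean_itv u : 0 <= gauss_mean t kap u <= 1.
Proof.
have q0 := sqrt_gauss_gt0; have [gi ge] := gauss_integral u t0.
apply/andP; split.
  rewrite mulr_ge0 ?invr_ge0 ?(ltW q0)//; apply: Rintegral_ge0 => v _.
  by rewrite mulr_ge0 ?gauss_ge0//; have /andP[] := k1 v.
rewrite /gauss_mean mulrC ler_pdivrMr// mul1r -ge; apply: le_Rintegral => //.
  exact: intg_gauss_mean.
by move=> v _; rewrite ler_piMl ?gauss_ge0//; have /andP[] := k1 v.
Qed.

End mean.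

(** With t = 2 k^2, one half of the exponent absorbs the Lipschitz factor: x <= exp(x^2) at x = k |v
    - u| bounds |v - u| [gauss t u v] by [gauss (k ^+ 2) u v] / k. The two Gaussians have masses in
    the ratio sqrt 2, which is at most 2. *)
Lemma gauss_mean_close (k : R) (kap : R -> R) (c u : R) : 0 < k -> 0 <= c ->
  measurable_fun setT kap -> (forall v, 0 <= kap v <= 1) ->
  (forall v w, `|kap v - kap w| <= c * `|v - w|) ->
  `|gauss_mean (2 * k ^+ 2) kap u - kap u| <= 2 * c / k.
Proof.
move=> k0 c0 mk k1 kc; set t := 2 * k ^+ 2.
have k20 : 0 < k ^+ 2 by rewrite exprn_gt0.
have t0 : 0 < t by rewrite mulr_gt0.
have q0 := sqrt_gauss_gt0 t0; have [gi ge] := gauss_integral u t0.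
have [hi he] := gauss_integral u k20.
have kgi := intg_gauss_mean t0 mk k1 u.
have E : gauss_mean t kap u - kap u =
    (Num.sqrt (pi / t))^-1 * \int[leb]_v ((kap v - kap u) * gauss t u v).
  under eq_Rintegral do rewrite mulrBl.
  rewrite RintegralB//; last exact: intgZ.
  by rewrite RintegralZl// ge mulrBr mulrCA mulVf ?gt_eqF// mulr1.
have sq : Num.sqrt (pi / k ^+ 2) = Num.sqrt 2 * Num.sqrt (pi / t).
  rewrite -sqrtrM//; congr Num.sqrt; rewrite /t; field.
  by rewrite gt_eqF.
have s2 : Num.sqrt 2 <= 2 :> R.
  rewrite -[leRHS]ger0_norm// -sqrtr_sqr ler_wsqrtr//.
  by rewrite expr2 ler_peMl// ler1n.
rewrite E normrM ger0_norm ?invr_ge0 ?(ltW q0)// mulrC ler_pdivrMr//.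
have dgi : intg leb (fun v => (kap v - kap u) * gauss t u v).
  under [_ \o _]eq_fun do rewrite /= mulrBl.
  by apply: intgB => //; exact: intgZ.
rewrite (le_trans (le_normr_Rintegral _ dgi))//.
apply: (@le_trans _ _ (\int[leb]_v (c / k * gauss (k ^+ 2) u v))).
  apply: le_Rintegral => //; [exact: intg_norm|exact: intgZ|move=> v _].
  rewrite normrM (ger0_norm (gauss_ge0 _ _ _)).
  apply: (@le_trans _ _ (c * (`|v - u| * gauss t u v))).
    by rewrite mulrA ler_wpM2r ?gauss_ge0.
  rewrite -mulrA ler_wpM2l// ler_pdivlMl// mulrA.
  have -> : gauss t u v = expR (- (k * `|v - u|) ^+ 2) * gauss (k ^+ 2) u v.
    by rewrite /gauss -expRD /t exprMn real_normK ?num_real//; congr expR; ring.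
  rewrite mulrA ler_piMl ?gauss_ge0// expRN.
  set x := k * _; rewrite ler_pdivrMr ?expR_gt0// mul1r.
  apply: le_trans (expR_ge1Dx _).
  have [x1|/ltW x1] := lerP x 1; first by rewrite (le_trans x1)// lerDl sqr_ge0.
  by rewrite expr2 (@le_trans _ _ (x * x)) ?lerDr// ler_peMl// (le_trans ler01).
rewrite RintegralZl// he sq mulrA ler_wpM2r ?(ltW q0)//.
rewrite (mulrC 2 c) -!mulrA.
by rewrite ler_wpM2l// (mulrC k^-1) ler_wpM2r// invr_ge0 ltW.
Qed.

End smoothing.

Lemma prodr_itv01 (R : realDomainType) (I : finType) (F : I -> R) :
  (forall i, 0 <= F i <= 1) -> 0 <= \prod_i F i <= 1.
Proof.
move=> F01; apply: (big_ind (fun z => 0 <= z <= 1)) => //; first by rewrite ler01 lexx.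
move=> a b /andP[a0 a1] /andP[b0 b1]; rewrite mulr_ge0//=.
by rewrite (le_trans (ler_wpM2r b0 a1))// mul1r.
Qed.

(** * From Gaussians to orthants to measurable sets *)

Section gaussian_uniqueness.
Context (R : realType) (n : nat).
Local Notation mu := (lebesgue_rV n).

Lemma gauss_sym (t a u : R) : gauss t a u = gauss t u a.
Proof. by rewrite /gauss -sqrrN opprB. Qed.

Lemma gaussN_sym t (a x : 'rV[R]_n) : gaussN t a x = gaussN t x a.
Proof. by apply: eq_bigr => i _; exact: gauss_sym. Qed.

Lemma intg_gaussN t (a : 'rV[R]_n) : 0 < t -> intg mu (gaussN t a).
Proof. by move=> t0; exact/intg_rschwartz/gaussN_rschwartz. Qed.

Lemma measurable_gaussN2 t : measurable_fun setT
  (fun p : 'rV[R]_n * 'rV[R]_n => gaussN t p.1 p.2).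
Proof.
apply: measurable_prod => i _.
have mu1 : measurable_fun setT (fun p : 'rV[R]_n * 'rV[R]_n => p.1 ord0 i).
  exact: (measurableT_comp (measurable_rV_coord i) measurable_fst).
have mu2 : measurable_fun setT (fun p : 'rV[R]_n * 'rV[R]_n => p.2 ord0 i).
  exact: (measurableT_comp (measurable_rV_coord i) measurable_snd).
apply: (measurableT_comp (@measurable_expR R)).
apply: measurableT_comp => //; apply: measurable_funM => //.
by apply: measurable_funX; exact: measurable_funB.
Qed.

Section smoothed.
Variables (f : 'rV[R]_n -> R) (fi : intg mu f).
Hypothesis f0 : forall t y, 0 < t -> \int[mu]_x (f x * gaussN t y x) = 0.

(* By Fubini, orthogonality to all translates of a Gaussian passes to their mixtures,
   which approximate indicators of orthants, a pi-system generating the Borel sets. *)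
Lemma Rintegral_gauss_mean (t : R) (kap : 'I_n -> R -> R) : 0 < t ->
  (forall i, measurable_fun setT (kap i)) ->
  (forall i v, 0 <= kap i v <= 1) ->
  intg mu (fun x => f x * \prod_i gauss_mean t (kap i) (x ord0 i)) /\
  \int[mu]_x (f x * \prod_i gauss_mean t (kap i) (x ord0 i)) = 0.
Proof.
move=> t0 mk k1; have mf := intg_measurable fi.
pose q := \prod_(i < n) Num.sqrt (pi / t) : R.
have gint (x : 'rV[R]_n) : \int[mu]_y gaussN t x y = q.
  rewrite (Rintegral_tensor (k := fun i => gauss t (x ord0 i)) _).2.
    by apply: eq_bigr => i _; have [] := gauss_integral (x ord0 i) t0.
  by move=> i; have [] := gauss_integral (x ord0 i) t0.
pose K (y : 'rV[R]_n) := \prod_i kap i (y ord0 i).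
have mK : measurable_fun setT K.
  apply: measurable_prod => i _; apply: (measurableT_comp (mk i)).
  exact: measurable_rV_coord.
have K1 y : `|K y| <= 1.
  have /andP[K0 K1] : 0 <= K y <= 1 by exact: prodr_itv01.
  by rewrite ger0_norm.
pose H (p : 'rV[R]_n * 'rV[R]_n) := f p.1 * gaussN t p.1 p.2.
have mH : measurable_fun setT H.
  apply: measurable_funM; first exact: (measurableT_comp mf measurable_fst).
  exact: measurable_gaussN2.
have Hi : intg (mu \x mu)%E H.
  apply/integrable12ltyP; first exact/measurable_EFinP.
  have Z x : (\int[mu]_y `|(EFin \o H) (x, y)| = `|f x|%:E * q%:E)%E.
    have mg := intg_measurable (intg_gaussN x t0).
    transitivity (\int[mu]_y (`|f x|%:E * (gaussN t x y)%:E))%E.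
      by apply: eq_integral => y _; rewrite /= /H normrM (ger0_norm (gaussN_ge0 _ _ _)) EFinM.
    rewrite ge0_integralZl_EFin//.
    - by rewrite -(EFin_Rintegral (intg_gaussN x t0)) gint.
    - by move=> y _; rewrite lee_fin; exact: gaussN_ge0.
    - exact/measurable_EFinP.
  under eq_integral do rewrite Z.
  rewrite ge0_integralZr//; last 2 first.
  - exact/measurable_EFinP/measurableT_comp.
  - by rewrite lee_fin; apply: prodr_ge0 => i _; rewrite sqrtr_ge0.
  by rewrite -EFin_Rintegral ?ltry//; exact: intg_norm.
pose F p := H p * K p.2.
have Fi : intg (mu \x mu)%E F.
  apply: (intg_bounded_mul (M := 1) _ _ Hi); last by move=> p; exact: K1.
  exact: (measurableT_comp mK measurable_snd).
have KgN x : intg mu (fun y => gaussN t x y * K y).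
  by apply: (intg_bounded_mul (M := 1)) => //; exact: intg_gaussN.
have F1 x : intg mu (fun y => F (x, y)).
  under [_ \o _]eq_fun do rewrite /= /F /H /= -mulrA.
  exact: intgZ.
have fgi y : intg mu (fun x => f x * gaussN t y x).
  apply: (intg_bounded_mul (M := 1)) => //.
    exact: intg_measurable (intg_gaussN y t0).
  move=> x; rewrite ger0_norm ?gaussN_ge0//.
  have /andP[]// : 0 <= gaussN t y x <= 1.
  apply: prodr_itv01 => i; rewrite gauss_ge0/= /gauss -[leRHS]expR0 ler_expR.
  by rewrite oppr_le0 mulr_ge0 ?sqr_ge0// ltW.
have F2 y : intg mu (fun x => F (x, y)).
  under [_ \o _]eq_fun do rewrite /= /F /H /= gaussN_sym mulrC.
  exact: intgZ.
have [_ I1] := Rintegral_prod12 Fi F1; have [_ I2] := Rintegral_prod21 Fi F2.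
have I20 : \int[(mu \x mu)%E]_p F p = 0.
  rewrite I2; under eq_Rintegral => y _.
    under eq_Rintegral do rewrite /F /H /= gaussN_sym mulrC.
    rewrite RintegralZl// f0// mulr0; over.
  by rewrite Rintegral_cst// mul0r.
have q0 : 0 < q by apply: prodr_gt0 => i _; exact: sqrt_gauss_gt0.
have [Fii _] := Rintegral_prod12 Fi F1.
have E : (fun x => f x * \prod_i gauss_mean t (kap i) (x ord0 i)) =
    fun x => q^-1 * \int[mu]_y F (x, y).
  apply/funext => x.
  under [X in _ = _ * X]eq_Rintegral do rewrite /F /H /= -mulrA.
  rewrite RintegralZl// mulrCA; congr (_ * _).
  rewrite /gauss_mean big_split /= prodfV; congr (_ * _).
  rewrite -(Rintegral_tensor (k := fun i v => kap i v * gauss t (x ord0 i) v) _).2; last first.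
    by move=> i; exact: intg_gauss_mean.
  apply: eq_Rintegral => y _; rewrite /gaussN /K -big_split /=.
  by apply: eq_bigr => i _; rewrite mulrC.
rewrite E; split; first exact: intgZ.
by rewrite RintegralZl// -I1 I20 mulr0.
Qed.

Lemma Rintegral_orthant (a : 'rV[R]_n) :
  intg mu (fun x => f x * \prod_i (a ord0 i < x ord0 i)%R%:R) /\
  \int[mu]_x (f x * \prod_i (a ord0 i < x ord0 i)%R%:R) = 0.
Proof.
have mf := intg_measurable fi.
pose kap k i := smooth_step (a ord0 i) k.
(* The step of index k has slope k, while the averaging error is twice the slope over (k+1)^2; hence
   it is at most 2/(k+1). *)
pose t (k : nat) : R := 2 * (k.+1%:R ^+ 2) ^+ 2.
have t0 k : 0 < t k by rewrite mulr_gt0// !exprn_gt0.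
pose F k x := f x * \prod_i gauss_mean (t k) (kap k i) (x ord0 i).
have F0 k : intg mu (F k) /\ \int[mu]_x F k x = 0.
  apply: Rintegral_gauss_mean => //.
  - by move=> i; exact: measurable_smooth_step.
  - by move=> i v; exact: smooth_step_itv.
have gm1 k i u := gauss_mean_itv (t0 k) (measurable_smooth_step (a ord0 i) k)
  (smooth_step_itv (a ord0 i) k) u.
have mcv i u : gauss_mean (t k) (kap k i) u @[k --> \oo] --> ((a ord0 i < u)%R%:R : R).
  have sc := @smooth_step_cvg R (a ord0 i) u.
  suff d0 : (fun k => gauss_mean (t k) (kap k i) u - smooth_step (a ord0 i) k u) @ \oo --> (0 : R).
    rewrite -[X in _ --> X]add0r (_ : (fun k => _) = fun k =>
      gauss_mean (t k) (kap k i) u - smooth_step (a ord0 i) k u + smooth_step (a ord0 i) k u).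
      exact: cvgD d0 sc.
    by apply/funext => k; rewrite subrK.
  apply: norm_cvg0.
  apply: (@squeeze_cvgr _ _ _ _ (cst 0) (fun k : nat => 2 * harmonic k)).
  - near=> k; rewrite /= normr_ge0/=.
    have h := gauss_mean_close u (k := k.+1%:R ^+ 2) _ (ler0n R k)
      (measurable_smooth_step (a ord0 i) k) (smooth_step_itv (a ord0 i) k)
      (smooth_step_lipschitz (a ord0 i) k).
    apply: le_trans (h _) _; first by rewrite exprn_gt0.
    rewrite -mulrA ler_wpM2l// ler_pdivrMr ?exprn_gt0// expr2 mulrA mulVf ?pnatr_eq0//.
    by rewrite mul1r ler_nat.
  - exact: cvg_cst.
  - rewrite -[X in _ --> X](mulr0 2); apply: cvgM; first exact: cvg_cst.
    exact: cvg_harmonic.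
have prod_cvg (x : 'rV[R]_n) : \prod_i gauss_mean (t k) (kap k i) (x ord0 i) @[k --> \oo] -->
    (\prod_i (a ord0 i < x ord0 i)%R%:R : R).
  elim: (index_enum _) => [|i r ih].
    rewrite big_nil; under eq_fun do rewrite big_nil; exact: cvg_cst.
  rewrite big_cons; under eq_fun do rewrite big_cons.
  exact: (cvgM (mcv i (x ord0 i)) ih).
have mF k : measurable_fun setT (F k) by exact: intg_measurable (F0 k).1.
have Fb k x : `|F k x| <= `|f x|.
  rewrite normrM ler_piMr//.
  have /andP[p0 p1] : 0 <= \prod_i gauss_mean (t k) (kap k i) (x ord0 i) <= 1.
    by apply: prodr_itv01 => i; exact: gm1.
  by rewrite ger0_norm.
have [ii cv] := dominated_cvg_Rintegral (mu := mu) mF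
  (fun x => cvgM (cvg_cst (f x)) (prod_cvg x)) (intg_norm fi) Fb.
split=> //; rewrite -(cvg_lim _ cv)//; under eq_fun do rewrite (F0 _).2.
exact: lim_cst.
Unshelve. all: end_near. Qed.

(** With all profiles equal to 1 the mixture of Gaussians is the constant 1. This is the whole-space
    case of the Dynkin argument. *)
Lemma Rintegral_gaussian_ortho0 : \int[mu]_x f x = 0.
Proof.
have m1 (i : 'I_n) : measurable_fun setT (fun _ : R => 1 : R) by exact: measurable_cst.
have [_] := Rintegral_gauss_mean (t := 1) (kap := fun _ _ => 1) ltr01 m1 (fun _ _ => introT andP (conj ler01 (lexx _))).
have E (x : 'rV[R]_n) : \prod_(i < n) gauss_mean 1 (fun=> 1) (x ord0 i) = 1.
  apply: big1 => i _; rewrite /gauss_mean.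
  under eq_Rintegral do rewrite mul1r.
  have [_ ->] := gauss_integral (x ord0 i) ltr01.
  by rewrite mulVf// gt_eqF// sqrt_gauss_gt0.
by under eq_Rintegral do rewrite E mulr1.
Qed.

Definition orthant (a : 'rV[R]_n) : set 'rV[R]_n :=
  [set x | forall i, a ord0 i < x ord0 i].

Lemma orthant_measurable : @measurable _ 'rV[R]_n = <<s range orthant >>.
Proof.
set G := range orthant.
apply/seteqP; split; last first.
  apply: smallest_sub; first exact: sigma_algebra_measurable.
  move=> _ [a _ <-]; have -> : orthant a =
      \bigcap_(i in [set: 'I_n]) (@rV_coord _ R n i @^-1` `]a ord0 i, +oo[%classic).
    apply/seteqP; split => x /= h i; first by move=> _; rewrite /= in_itv/= andbT; exact: h.
    by have := h i I; rewrite /= in_itv/= andbT.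
  apply: fin_bigcap_measurable => // i _.
  by rewrite -[X in measurable X]setTI; exact: measurable_rV_coord.
apply: smallest_sub; first exact: smallest_sigma_algebra.
move=> A; rewrite -bigcup_seq => -[i /= _] [C mC <-]; rewrite setTI.
have mC' : (@ocitv R).-sigma.-measurable C := mC.
rewrite RGenOInfty.measurableE in mC'; move: (mC' : <<s @RGenOInfty.G R >> C).
apply: (smallest_sub (X := [set B | <<s G >> (@rV_coord _ R n i @^-1` B)])).
  split => /=.
  - by rewrite preimage_set0; exact: sigma_algebra0.
  - by move=> B mB; rewrite setTD preimage_setC -setTD; exact: sigma_algebraCD.
  - by move=> F mF; rewrite preimage_bigcup; exact: sigma_algebra_bigcup.
move=> _ [r ->] /=.
(* A half-space r < x_i is the increasing union of the orthants whose corner is r in direction i and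
   -k in the other directions. *)
rewrite (_ : _ @^-1` _ = \bigcup_k orthant (\row_l (if l == i then r else - k%:R))).
  apply: sigma_algebra_bigcup => k; apply: sub_sigma_algebra.
  by exists (\row_l (if l == i then r else - k%:R)).
apply/seteqP; split => x /=; rewrite /rV_coord in_itv/= andbT; last first.
  by move=> [k _ /(_ i)]; rewrite mxE eqxx.
move=> rx; pose M : R := \sum_j `|x ord0 j|.
exists (Num.bound M) => // j; rewrite mxE; case: eqP => [->//|_].
rewrite ltrNl (@le_lt_trans _ _ M)//.
  rewrite (le_trans (ler_norm _))// normrN /M (bigD1 j)//= lerDl sumr_ge0//.
by apply: archi_boundP; exact: sumr_ge0.
Qed.

(** The sets over which the integrable function f has integral 0 form a Dynkin system containing the
    orthants. These are stable under intersection, the corner being the coordinatewise maximum. *)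
Lemma gaussian_ortho_ae_eq0 : {ae mu, forall x, f x = 0}.
Proof.
suff H A : measurable A -> (\int[mu]_(x in A) (f x)%:E = 0)%E.
  have : ae_eq mu setT (EFin \o f) (cst 0%E).
    by apply: integral_ae_eq => // E _ mE; rewrite H// integral0_eq.
  by apply: filterS => x /(_ I) /= [].
rewrite orthant_measurable; move: A; apply: dynkin_induction.
- exact: orthant_measurable.
- move=> _ _ [a _ <-] [b _ <-]; exists (\row_i Num.max (a ord0 i) (b ord0 i)) => //.
  apply/seteqP; split => x /=.
    by move=> h; split=> i; have := h i; rewrite mxE gt_max => /andP[].
  by move=> [ha hb] i; rewrite mxE gt_max ha hb.
- by rewrite -EFin_Rintegral// Rintegral_gaussian_ortho0.
- move=> _ [a _ <-] /=; have [ii i0] := Rintegral_orthant a.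
  rewrite integral_mkcond -[RHS]/(0%:E) -i0 EFin_Rintegral//.
  apply: eq_integral => x _; rewrite patchE; case: ifPn => [|].
    by rewrite inE => ax; rewrite big1 ?mulr1// => i _; rewrite ax.
  rewrite notin_setE => /existsNP[i /negP nax].
  by rewrite (bigD1 i)//= (negbTE nax) mul0r mulr0.
- move=> S mS S0.
  have := congr1 EFin Rintegral_gaussian_ortho0; rewrite EFin_Rintegral//.
  rewrite -(setUv S) integral_setU_EFin//.
  + by rewrite S0 add0e.
  + exact: measurableC.
  + by rewrite setUv; exact: intg_measurable fi.
  + by apply/disj_setPS; rewrite setICr.
- move=> F mF tF F0; rewrite (integral_bigcup tF mF).
    by apply: eseries0 => k _ _; exact: F0.
  apply: integrableS fi => //; exact: bigcup_measurable.
Qed.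

End smoothed.

(** Multiplication by a fixed Gaussian makes g integrable without changing its zeros. Orthogonality
    survives because a product of two Gaussians is a multiple of a third. *)
Lemma gaussian_test_ae_eq0 (g : 'rV[R]_n -> R) : measurable_fun setT g ->
  (forall t a, 0 < t -> intg mu (fun x => g x * gaussN t a x) /\
     \int[mu]_x (g x * gaussN t a x) = 0) ->
  {ae mu, forall x, g x = 0}.
Proof.
move=> mg gg; pose f x := g x * gaussN 1 0 x.
have fi : intg mu f by exact: (gg 1 0 ltr01).1.
suff : {ae mu, forall x, f x = 0}.
  apply: filterS => x /eqP; rewrite mulf_eq0 => /orP[/eqP//|].
  by rewrite gt_eqF// prodr_gt0// => i _; exact: expR_gt0.
apply: gaussian_ortho_ae_eq0 => // t y t0.
have t1 : 0 < 1 + t by rewrite addr_gt0.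
(* The constant left by completing the square: x^2 + t (x - y)^2 = (1 + t)(x - t y/(1 + t))^2 + t
   y^2/(1 + t). *)
pose c i := expR (- (t / (1 + t) * y ord0 i ^+ 2)).
have E x : f x * gaussN t y x =
    \prod_i c i * (g x * gaussN (1 + t) ((t / (1 + t)) *: y) x).
  rewrite /f -mulrA [RHS]mulrCA; congr (_ * _).
  rewrite /gaussN -!big_split /=; apply: eq_bigr => i _.
  rewrite /gauss /c -!expRD !mxE; congr expR; field.
  by rewrite gt_eqF.
under eq_Rintegral do rewrite E.
by rewrite RintegralZl ?(gg _ _ t1).2 ?mulr0//; exact: (gg _ _ t1).1.
Qed.

End gaussian_uniqueness.

(** * The dual of L^1 *)

Section L1_dual.
Local Open Scope charge_scope.
Context d (T : measurableType d) (R : realType)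
  (mu : {sigma_finite_measure set T -> \bar R}).
Variables (e : T -> R) (e_gt0 : forall x, 0 < e x) (ei : intg mu e).
Variables (Lam : (T -> R) -> R) (M : R) (M0 : 0 <= M).
Hypothesis LamL : forall (c : R) f g, intg mu f -> intg mu g ->
  Lam (fun x => c * f x + g x) = c * Lam f + Lam g.
Hypothesis LamM : forall f, intg mu f -> `|Lam f| <= M * \int[mu]_x `|f x|.

Lemma intg0 : intg mu (fun=> 0 : R).
Proof. exact: integrable0. Qed.

Lemma functional0 : Lam (fun=> 0) = 0.
Proof.
have := LamM intg0; rewrite normr0 Rintegral_cst// mul0r mulr0.
by rewrite normr_le0 => /eqP.
Qed.

Lemma functionalZ c f : intg mu f -> Lam (fun x => c * f x) = c * Lam f.
Proof.
move=> fi; have := LamL c fi intg0; rewrite functional0 addr0 => <-.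
by congr Lam; apply/funext => x; rewrite addr0.
Qed.

Lemma functionalD f g : intg mu f -> intg mu g ->
  Lam (fun x => f x + g x) = Lam f + Lam g.
Proof.
move=> fi gi; have := LamL 1 fi gi; rewrite mul1r => <-.
by congr Lam; apply/funext => x; rewrite mul1r.
Qed.

Lemma functionalB f g : intg mu f -> intg mu g ->
  Lam (fun x => f x - g x) = Lam f - Lam g.
Proof.
move=> fi gi; rewrite functionalD//; last exact: intgN.
congr (_ + _); rewrite -mulN1r -functionalZ//.
by congr Lam; apply/funext => x; rewrite mulN1r.
Qed.

Lemma functional_sum (I : Type) (r : seq I) (F : I -> T -> R) :
  (forall i, intg mu (F i)) ->
  Lam (fun x => \sum_(i <- r) F i x) = \sum_(i <- r) Lam (F i).
Proof.
move=> Fi; elim: r => [|i r ih].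
  rewrite (_ : (fun x => _) = fun=> 0); first by rewrite functional0 big_nil.
  by apply/funext => x; rewrite big_nil.
rewrite big_cons -ih -functionalD//; last exact: intg_sum.
by congr Lam; apply/funext => x; rewrite big_cons.
Qed.

Lemma intg_weight_indic A : measurable A -> intg mu (fun x => e x * \1_A x).
Proof.
move=> mA; apply: (intg_bounded_mul (M := 1)) => //.
by move=> x; rewrite ger0_norm// indicE lern1 leq_b1.
Qed.

(* The factor [e] makes this a finite charge although [mu] is only sigma-finite. *)
Definition functional_charge (A : set T) : \bar R := (Lam (fun x => e x * \1_A x))%:E.

Let functional_charge0 : functional_charge set0 = 0%E.
Proof.
rewrite /functional_charge (_ : (fun x => _) = fun=> 0); first by rewrite functional0.
by apply/funext => x; rewrite indic0 mulr0.
Qed.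

Let functional_charge_finite A : measurable A -> functional_charge A \is a fin_num.
Proof. by []. Qed.

Lemma indic_bigcup_cvg (F : (set T)^nat) x : trivIset setT F ->
  \sum_(0 <= k < n) (\1_(F k) x : R) @[n --> \oo] --> (\1_(\bigcup_k F k) x : R).
Proof.
move=> tF; apply: cvg_near_cst.
have [[k _ Fkx]|nF] := pselect ((\bigcup_k F k) x); last first.
  near=> n; rewrite indicE memNset// big1_seq// => k _.
  by rewrite indicE memNset// => Fk; apply: nF; exists k.
near=> n.
have kn : (k < n)%N by near: n; exact: nbhs_infty_gt.
rewrite indicE mem_set; last by exists k.
rewrite (big_cat_nat _ (n := k.+1))//= big_nat_recr//= indicE mem_set//.
rewrite !big_seq !big1 ?add0r ?addr0// => j; rewrite mem_index_iota => /andP[j1 j2];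
  rewrite indicE memNset// => Fj.
- by have := tF j k I I (ex_intro _ x (conj Fj Fkx)) => jk; rewrite jk ltnn in j1.
- by have := tF j k I I (ex_intro _ x (conj Fj Fkx)) => jk; rewrite jk ltnn in j2.
Unshelve. all: end_near. Qed.

Lemma sum_indic_itv01 (F : (set T)^nat) n x : trivIset setT F ->
  0 <= \sum_(0 <= k < n) (\1_(F k) x : R) <= 1.
Proof.
move=> tF; rewrite sumr_ge0//=.
have nd : nondecreasing_seq (fun n => \sum_(0 <= k < n) (\1_(F k) x : R)).
  by apply/nondecreasing_seqP => m; rewrite big_nat_recr//= lerDl.
have cv := @indic_bigcup_cvg F x tF.
apply: le_trans (nondecreasing_cvgn_le nd _ n) _; first by apply/cvg_ex; eexists; exact: cv.
by rewrite (cvg_lim _ cv)// indicE lern1 leq_b1.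
Qed.

Let functional_charge_sigma_additive : semi_sigma_additive functional_charge.
Proof.
move=> F mF tF mUF; rewrite /functional_charge.
under eq_fun do rewrite sumEFin.
apply: cvg_EFin; first exact: nearW.
rewrite /=.
(* [g n] is the indicator of the union of the sets of index at least n. Dominated by [e], the
   functions e g_n tend to 0 in L^1, so their images under [Lam] tend to 0. *)
pose g n x : R := \1_(\bigcup_k F k) x - \sum_(0 <= k < n) \1_(F k) x.
have mg n : measurable_fun setT (g n).
  apply: measurable_funB; first by apply: measurable_indic; exact: mUF.
  by apply: measurable_sum => k; apply: measurable_indic; exact: mF.
have g1 n x : `|g n x| <= 1.
  have /andP[s0 s1] := sum_indic_itv01 n x tF.
  have [i0 i1] : 0 <= (\1_(\bigcup_k F k) x : R) /\ (\1_(\bigcup_k F k) x : R) <= 1.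
    by rewrite indicE ler0n lern1 leq_b1.
  by rewrite ler_norml; apply/andP; split; rewrite /g; lra.
have egi n : intg mu (fun x => e x * g n x) by exact: (intg_bounded_mul (M := 1)).
have E n : \sum_(0 <= i < n) Lam (fun x => e x * \1_(F i) x) =
    Lam (fun x => e x * \1_(\bigcup_k F k) x) - Lam (fun x => e x * g n x).
  rewrite -functionalB//; last exact: intg_weight_indic.
  rewrite -functional_sum; last by move=> k; exact: intg_weight_indic.
  by congr Lam; apply/funext => x; rewrite -mulrBr /g opprB addrC subrK mulr_sumr.
under eq_fun do rewrite E.
pose L0 := Lam (fun x => e x * \1_(\bigcup_k F k) x).
suff : (L0 - Lam (fun x => e x * g n x)) @[n --> \oo] --> L0 - 0 by rewrite subr0.
apply: cvgB; first exact: cvg_cst.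
apply: norm_cvg0.
have [_ cv] : intg mu (fun=> 0 : R) /\
    \int[mu]_x `|e x * g n x| @[n --> \oo] --> \int[mu]_x (0 : R).
  apply: (dominated_cvg_Rintegral (g := e)) => //.
  - by move=> n; apply: measurableT_comp => //; exact: intg_measurable (egi n).
  - move=> x; rewrite -[X in _ --> X](normr0 R); apply: cvg_norm.
    rewrite -[X in _ --> X](mulr0 (e x)); apply: cvgM; first exact: cvg_cst.
    rewrite -[X in _ --> X](subrr (\1_(\bigcup_k F k) x)).
    by apply: cvgB; [exact: cvg_cst|exact: indic_bigcup_cvg].
  - by move=> n x; rewrite normr_id normrM (ger0_norm (ltW (e_gt0 x))) ler_piMr// ltW.
rewrite Rintegral_cst// mul0r in cv.
apply: (@squeeze_cvgr _ _ _ _ (cst 0) (fun n => M * \int[mu]_x `|e x * g n x|)).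
- by near=> n; rewrite /= normr_ge0/= LamM.
- exact: cvg_cst.
- by rewrite -[X in _ --> X](mulr0 M); apply: cvgM => //; exact: cvg_cst.
Unshelve. all: end_near. Qed.

HB.instance Definition _ := isCharge.Build _ T R functional_charge
  functional_charge0 functional_charge_finite functional_charge_sigma_additive.

Lemma functional_charge_dominates : functional_charge `<< mu.
Proof.
apply/null_content_dominatesP => A mA muA; rewrite /functional_charge.
suff : Lam (fun x => e x * \1_A x) = 0 by move=> ->.
apply/eqP; rewrite -normr_le0 (le_trans (LamM (intg_weight_indic mA)))//.
rewrite (_ : \int[mu]_x _ = 0) ?mulr0//.
rewrite (_ : 0 = \int[mu]_x (0 : R)); last by rewrite Rintegral_cst// mul0r.
apply: ae_eq_Rintegral => //.
- exact: intg_measurable (intg_norm (intg_weight_indic mA)).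
- exists A; split=> // x /= nx; apply: contrapT => nAx; apply: nx.
  by rewrite indicE memNset// mulr0 normr0.
Qed.

Lemma functional_density : exists q, intg mu q /\
  forall A, measurable A -> Lam (fun x => e x * \1_A x) = \int[mu]_x (q x * \1_A x).
Proof.
have dom := functional_charge_dominates.
have qi := Radon_Nikodym_integrable dom.
have E : EFin \o (fun x => fine (('d functional_charge '/d mu) x)) =
    'd functional_charge '/d mu.
  by apply/funext => x /=; rewrite fineK// Radon_Nikodym_fin_num.
exists (fun x => fine (('d functional_charge '/d mu) x)); rewrite E; split=> // A mA.
apply: EFin_inj; rewrite -[LHS]/(functional_charge A) (Radon_Nikodym_integral dom mA).
rewrite EFin_Rintegral; last first.
  apply: (intg_bounded_mul (M := 1)); rewrite ?E// => x.
  by rewrite ger0_norm// indicE lern1 leq_b1.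
rewrite [LHS]integral_mkcond; apply: eq_integral => x _; rewrite patchE.
case: ifPn => xA; first by rewrite indicE xA mulr1 fineK// Radon_Nikodym_fin_num.
by rewrite indicE (negbTE xA) mulr0.
Qed.

(** The hypothesis is tested on the set where q - M e is positive: the integral there is at most 0,
    so the positive part vanishes almost everywhere. *)
Lemma ae_le_of_integral (q : T -> R) : intg mu q ->
  (forall A, measurable A -> \int[mu]_x (q x * \1_A x) <= M * \int[mu]_x (e x * \1_A x)) ->
  {ae mu, forall x, q x <= M * e x}.
Proof.
move=> qi hq; pose f x := q x - M * e x.
have fi : intg mu f by apply: intgB => //; exact: intgZ.
pose A := [set x | 0 < f x].
have mA : measurable A.
  rewrite -[A]setTI (_ : A = f @^-1` `]0, +oo[); last first.
    by apply/seteqP; split=> x /=; rewrite /A/= in_itv/= andbT.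
  by apply: (intg_measurable fi).
have b1 x : `|\1_A x : R| <= 1 by rewrite ger0_norm// indicE lern1 leq_b1.
have bi h : intg mu h -> intg mu (fun x => h x * \1_A x).
  by move=> hi; apply: (intg_bounded_mul (M := 1)).
have fA0 x : 0 <= f x * \1_A x.
  have [Ax|nAx] := pselect (A x); first by rewrite indicE mem_set// mulr1 ltW.
  by rewrite indicE memNset// mulr0.
have I0 : \int[mu]_x `|f x * \1_A x| = 0.
  under eq_Rintegral do rewrite ger0_norm//.
  apply/le_anti/andP; split; last by apply: Rintegral_ge0.
  under eq_Rintegral do rewrite /f mulrBl -mulrA.
  rewrite RintegralB; [|by []|exact: bi|exact/intgZ/bi].
  by rewrite RintegralZl ?subr_le0 ?hq//; exact: bi.
have := Rintegral_ae_eq0 (bi _ fi) I0; apply: filterS => x fx.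
rewrite leNgt; apply/negP => lt; have Ax : A x by rewrite /A/= /f subr_gt0.
by move: fx; rewrite indicE mem_set// mulr1 => fx; move: Ax; rewrite /A/= fx ltxx.
Qed.

Lemma functional_bounded_density : measurable_fun setT (fun x => (e x)^-1) ->
  exists p : T -> R, measurable_fun setT p /\
  (forall x, `|p x| <= M) /\
  forall A, measurable A -> Lam (fun x => e x * \1_A x) = \int[mu]_x (p x * (e x * \1_A x)).
Proof.
move=> mVe; have [q [qi hq]] := functional_density.
have b1 A x : `|\1_A x : R| <= 1 by rewrite ger0_norm// indicE lern1 leq_b1.
have hA A : measurable A -> `|Lam (fun x => e x * \1_A x)| <= M * \int[mu]_x (e x * \1_A x).
  move=> mA; rewrite (le_trans (LamM (intg_weight_indic mA)))//.
  rewrite le_eqVlt; apply/orP; left; apply/eqP; congr (_ * _).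
  by apply: eq_Rintegral => x _; rewrite ger0_norm// mulr_ge0// ltW.
have le1 := @ae_le_of_integral q qi.
have le2 := @ae_le_of_integral (fun x => - q x) (intgN qi).
(* Truncation makes the bound hold everywhere. It alters q / e only where |q| <= M e fails, which is
   a null set. *)
pose p x := Num.max (- M) (Num.min M (q x * (e x)^-1)).
have me := intg_measurable ei; have mq := intg_measurable qi.
have mp : measurable_fun setT p.
  apply: measurable_maxr => //; apply: measurable_minr => //.
  exact: measurable_funM.
have pM x : `|p x| <= M.
  by rewrite ler_norml /p le_max lexx/= ge_max ge_min lexx/= ge0_cp.
exists p; split=> //; split=> // A mA.
rewrite hq//; apply: ae_eq_Rintegral.
- by apply: measurable_funM => //; apply: measurable_indic.
- by apply: measurable_funM => //; apply: measurable_funM => //; apply: measurable_indic.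
have {}le1 : {ae mu, forall x, q x <= M * e x}.
  by apply: le1 => B mB; rewrite -hq// (le_trans _ (hA _ mB))// ler_norm.
have {}le2 : {ae mu, forall x, - q x <= M * e x}.
  apply: le2 => B mB; under eq_Rintegral do rewrite mulNr.
  rewrite RintegralN; last by apply: (intg_bounded_mul (M := 1)).
  by rewrite -hq// (le_trans _ (hA _ mB))// -normrN ler_norm.
move: le1 le2; apply: filterS2 => x qM NqM.
rewrite mulrA; congr (_ * _).
rewrite /p min_r ?max_r ?divfK ?gt_eqF//.
  by rewrite ler_pdivlMr// mulNr lerNl.
by rewrite ler_pdivrMr.
Qed.

Import HBNNSimple.

(* Holds because simple functions times [e] are dense in L^1. *)
Lemma functional_eq0 : measurable_fun setT (fun x => (e x)^-1) ->
  (forall A, measurable A -> Lam (fun x => e x * \1_A x) = 0) ->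
  forall f, intg mu f -> Lam f = 0.
Proof.
move=> mVe h0; have me := intg_measurable ei.
have simple (h : {nnsfun T >-> R}) : Lam (fun x => e x * h x) = 0.
  pose F (y : R) x := y * (e x * \1_(h @^-1` [set y]) x).
  have Fi y : intg mu (F y) by apply/intgZ/intg_weight_indic.
  have [s hs] : exists s : seq R, forall x, h x = \sum_(y <- s) y * \1_(h @^-1` [set y]) x.
    by eexists => x; rewrite fimfunE fsbig_finite.
  rewrite (_ : (fun x => _) = fun x => \sum_(y <- s) F y x); last first.
    apply/funext => x; rewrite hs mulr_sumr.
    by apply: eq_bigr => y _; rewrite mulrCA.
  rewrite functional_sum// big1// => i _.
  by rewrite functionalZ ?h0 ?mulr0//; exact: intg_weight_indic.
have pos f : intg mu f -> (forall x, 0 <= f x) -> Lam f = 0.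
  move=> fi f0; have mf := intg_measurable fi.
  (* Simple functions h_n increasing to f / e are used rather than approximations of f itself; then
     e h_n converges to f in L^1, and [Lam] vanishes on each e h_n. *)
  pose g x := (f x * (e x)^-1)%:E.
  have mg : measurable_fun setT g by apply/measurable_EFinP; exact: measurable_funM.
  have g0 x : setT x -> (0 <= g x)%E by move=> _; rewrite lee_fin mulr_ge0// invr_ge0 ltW.
  pose h := nnsfun_approx measurableT mg.
  have hg x : h n x @[n --> \oo] --> f x * (e x)^-1.
    by apply: (fine_cvg (cvg_nnsfun_approx measurableT mg g0 I)).
  have hle n x : e x * h n x <= f x.
    rewrite mulrC -ler_pdivlMr// -(cvg_lim _ (hg x))//.
    apply: nondecreasing_cvgn_le; last by apply/cvg_ex; eexists; exact: hg.
    by move=> a b ab; have := nd_nnsfun_approx measurableT mg ab; move/lefP; exact.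
  have h_ge0 n x : 0 <= e x * h n x by rewrite mulr_ge0// ltW.
  have ehi n : intg mu (fun x => e x * h n x).
    apply: intg_le fi; last by move=> x; rewrite ger0_norm.
    exact: measurable_funM.
  have E n : Lam f = Lam (fun x => f x - e x * h n x).
    by rewrite functionalB// simple subr0.
  have [_ cv] : intg mu (fun=> 0 : R) /\
      \int[mu]_x (f x - e x * h n x) @[n --> \oo] --> \int[mu]_x (0 : R).
    apply: (dominated_cvg_Rintegral (g := f)) => //.
    - by move=> n; exact: intg_measurable (intgB fi (ehi n)).
    - move=> x; have e0 : e x != 0 by rewrite gt_eqF.
      rewrite -[X in _ --> X](subrr (f x)); apply: cvgB; first exact: cvg_cst.
      suff : e x * h n x @[n --> \oo] --> e x * (f x * (e x)^-1).
        by rewrite mulrCA divff// mulr1.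
      by apply: cvgM; [exact: cvg_cst|exact: hg].
    - by move=> n x; rewrite ger0_norm ?subr_ge0// gerBl.
  rewrite Rintegral_cst// mul0r in cv.
  apply/eqP; rewrite -normr_le0 -(mulr0 M).
  have cvM : M * \int[mu]_x (f x - e x * h n x) @[n --> \oo] --> M * 0.
    by apply: cvgM => //; exact: cvg_cst.
  rewrite -(cvg_lim _ cvM)//; apply: limr_ge; first by apply/cvg_ex; eexists; exact: cvM.
  apply: nearW => n; rewrite (E n) (le_trans (LamM (intgB fi (ehi n))))//.
  rewrite le_eqVlt; apply/orP; left; apply/eqP; congr (_ * _).
  by apply: eq_Rintegral => x _; rewrite ger0_norm ?subr_ge0.
move=> f fi.
have fE : f = fun x => Num.max (f x) 0 - Num.max (- f x) 0.
  apply/funext => x; have [x0|x0] := leP 0 (f x).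
    by rewrite max_r ?subr0// oppr_le0.
  by rewrite max_l ?sub0r ?opprK// oppr_ge0 ltW.
have maxi g : intg mu g -> intg mu (fun x => Num.max (g x) 0).
  move=> gi; apply: intg_le (intg_norm gi).
    by apply: measurable_maxr => //; exact: intg_measurable gi.
  by move=> x; rewrite ger0_norm ?le_max ?lexx ?orbT// ge_max ler_norm/=.
rewrite fE functionalB; [|exact: maxi|exact/maxi/intgN].
by rewrite !pos ?subr0//; [exact/maxi/intgN|move=> x|exact: maxi|move=> x];
  rewrite le_max lexx orbT.
Qed.

End L1_dual.

(** The difference D between [Lam] and integration against p is again linear and bounded, now by 2
    M, and it vanishes on every e 1_A; hence it vanishes on L^1. *)
Lemma L1_dual_representation d (T : measurableType d) (R : realType)
    (mu : {sigma_finite_measure set T -> \bar R}) (e : T -> R) (Lam : (T -> R) -> R) (M : R) :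
  (forall x, 0 < e x) -> intg mu e -> measurable_fun setT (fun x => (e x)^-1) -> 0 <= M ->
  (forall (c : R) f g, intg mu f -> intg mu g ->
    Lam (fun x => c * f x + g x) = c * Lam f + Lam g) ->
  (forall f, intg mu f -> `|Lam f| <= M * \int[mu]_x `|f x|) ->
  exists p : T -> R, [/\ measurable_fun setT p, forall x, `|p x| <= M &
    forall f, intg mu f -> Lam f = \int[mu]_x (p x * f x)].
Proof.
move=> e0 ei mVe M0 LamL LamM.
have [p [mp [pM hp]]] := functional_bounded_density e0 ei M0 LamL LamM mVe.
exists p; split=> //.
have ipf f : intg mu f -> intg mu (fun x => p x * f x).
  by move=> fi; under [X in _ \o X]eq_fun do rewrite mulrC; exact: (intg_bounded_mul (M := M)).
pose D f := Lam f - \int[mu]_x (p x * f x).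
have DL (c : R) f g : intg mu f -> intg mu g -> D (fun x => c * f x + g x) = c * D f + D g.
  move=> fi gi; rewrite /D LamL//.
  under eq_Rintegral do rewrite mulrDr mulrCA.
  rewrite RintegralD//; [|exact/intgZ/ipf|exact: ipf].
  by rewrite RintegralZl//; [ring|exact: ipf].
have DM f : intg mu f -> `|D f| <= (2 * M) * \int[mu]_x `|f x|.
  move=> fi; rewrite (le_trans (ler_normB _ _))// -mulrA mulr_natl mulr2n lerD ?LamM//.
  rewrite (le_trans (le_normr_Rintegral _ _))//; first exact: ipf.
  rewrite -RintegralZl//; last exact: intg_norm.
  apply: le_Rintegral => //; [exact/intg_norm/ipf|exact/intgZ/intg_norm|].
  by move=> x _; rewrite normrM ler_wpM2r.
move=> f fi; apply/eqP; rewrite -subr_eq0 -/(D f); apply/eqP.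
apply: (functional_eq0 e0 ei DL DM mVe _ fi).
by move=> A mA; rewrite /D hp// subrr.
Qed.

(** * Fourier inversion *)

Section cplx_topology.
Context (R : realType) (n : nat).
Local Notation Re := (@complex.Re R).
Local Notation Im := (@complex.Im R).
Implicit Types u : cfun R n.

Lemma cplx_norm_lt (z : cplx R) (e : R) : (`|z| < e%:C) = (normc z < e).
Proof. by rewrite -ltcR normc_abs. Qed.

Lemma continuous_cplxP u : continuous u <->
  continuous (fun x => Re (u x)) /\ continuous (fun x => Im (u x)).
Proof.
split=> [cu|[cr ci] x].
  split=> x; apply/(@cvgrPdist_lt R R 'rV[R]_n (nbhs (x : 'rV[R]_n)) (nbhs_filter _)) => e e0;
    have /cvgrPdist_lt/(_ (e%:C)) := cu x; rewrite ltcR => /(_ e0);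
    apply: filterS => y; rewrite cplx_norm_lt; apply: le_lt_trans.
  - by rewrite -cReN -cReD normRe_le.
  - by rewrite -cImN -cImD normIm_le.
(* A positive radius in R[i] is real, its imaginary part being 0. *)
apply/(@cvgrPdist_lt R[i] (cplx R) 'rV[R]_n (nbhs (x : 'rV[R]_n)) (nbhs_filter _)) => -[e e']; rewrite ltcE/= => /andP[/eqP -> e0].
have e20 : 0 < e / 2 by rewrite divr_gt0.
have /(@cvgrPdist_lt R R 'rV[R]_n (nbhs (x : 'rV[R]_n)) (nbhs_filter _))/(_ _ e20) := cr x.
have /(@cvgrPdist_lt R R 'rV[R]_n (nbhs (x : 'rV[R]_n)) (nbhs_filter _))/(_ _ e20) := ci x.
apply: filterS2 => y hi hr; rewrite cplx_norm_lt.
rewrite (le_lt_trans (normc_le _))// [e in ltRHS]splitr ltrD// ?cReD ?cReN ?cImD ?cImN//.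
Qed.

Lemma bounded_cplxP u : [bounded u x | x in setT] <->
  exists K : R, forall x, normc (u x) <= K.
Proof.
split=> [[M [/= Mr hM]]|[K hK]].
  exists (complex.Re M + 1) => x.
  have -> : normc (u x) = complex.Re `|u x| by rewrite -normc_abs.
  have : M < (complex.Re M + 1)%:C by rewrite -(RRe_real Mr) ltcR ltrDl.
  by move=> /hM/(_ x I) /=; rewrite -normc_abs lecR.
exists K%:C; split; first by rewrite /= complex_real.
by move=> M KM x _ /=; rewrite (le_trans _ (ltW KM))// -normc_abs lecR.
Qed.

End cplx_topology.

Section positive_open.
Context (R : realType) (n : nat).
Local Notation mu := (@lebesgue_rV R n).
Local Notation leb := (@lebesgue_measure R).

Lemma Rintegral_indic_itv (a b : R) : a < b ->
  intg leb (fun u => \1_(`]a, b[%classic) u : R) /\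
  \int[leb]_u (\1_(`]a, b[%classic) u : R) = b - a.
Proof.
move=> ab; have E : (\int[leb]_u (\1_(`]a, b[%classic) u : R)%:E)%E = (b - a)%:E.
  rewrite integral_indic// setIT; have := @lebesgue_measure_itv R `]a, b[.
  by rewrite /= lte_fin ab EFinB.
split; last by rewrite /Rintegral E.
apply/integrableP; split; first by apply/measurable_EFinP; apply: measurable_indic.
under eq_integral do rewrite gee0_abs ?lee_fin//.
by rewrite E ltry.
Qed.

(** Every cube has positive measure. If f(a) were nonzero, f would have no zero on a cube around a,
    and the indicator of that cube, null almost everywhere, would have integral 0 instead of a
    product of positive side lengths. *)
Lemma continuous_ae_eq0 (f : 'rV[R]_n -> R) : continuous f ->
  {ae mu, forall x, f x = 0} -> forall x, f x = 0.
Proof.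
move=> cf f0 a; apply: contrapT => /eqP fa.
have fa0 : 0 < `|f a| by rewrite normr_gt0.
have /(@cvgrPdist_lt R R 'rV[R]_n (nbhs (a : 'rV[R]_n)) (nbhs_filter _))/(_ _ fa0) := cf a.
move=> /nbhs_ballP[d /= d0 hd].
pose k (i : 'I_n) (u : R) : R := \1_(`](a ord0 i - d), (a ord0 i + d)[%classic) u.
have ab i : a ord0 i - d < a ord0 i + d by lra.
have [ki kE] := Rintegral_tensor (k := k) (fun i => (Rintegral_indic_itv (ab i)).1).
have : \int[mu]_x (\prod_i k i (x ord0 i)) = \int[mu]_x (0 : R).
  apply: ae_eq_Rintegral => //; first exact: intg_measurable ki.
  move: f0; apply: filterS => x fx; apply: contrapT => /eqP/prodf_neq0 kx.
  suff /hd/= : ball a d x by rewrite fx subr0 ltxx.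
  split=> // i j; rewrite ord1; have := kx j isT; rewrite /k indicE.
  case: (boolP (_ \in _)) => [|_]; last by rewrite eqxx.
  by rewrite inE/= in_itv/= => /andP[h1 h2] _; rewrite /ball/= ltr_norml; apply/andP; split; lra.
rewrite kE Rintegral_cst// mul0r => /eqP; apply/negP/prodf_neq0 => i _.
by rewrite (Rintegral_indic_itv (ab i)).2 gt_eqF// subr_gt0.
Qed.

End positive_open.

(** * Comparison through Gaussians and inversion on Schwartz functions *)

Section fourier_inversion.
Context (R : realType) (n : nat).
Local Notation mu := (@lebesgue_rV R n).
Local Notation Re := (@complex.Re R).
Local Notation Im := (@complex.Im R).
Implicit Types (phi f g : cfun R n).

Local Notation gaussC t a := (fun x : 'rV[R]_n => (gaussN t a x)%:C : cplx R).

Lemma gaussC_schwartz t a : 0 < t -> schwartz (gaussC t a).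
Proof. by move=> t0; apply: schwartz_real; exact: gaussN_rschwartz. Qed.

Lemma gaussC_test_ae_eq0 g : cmeas g ->
  (forall t a, 0 < t -> cintg mu (fun x => g x * (gaussN t a x)%:C) /\
     cint mu (fun x => g x * (gaussN t a x)%:C) = 0) ->
  {ae mu, forall x, g x = 0}.
Proof.
move=> [gr gi] h.
have Er t a x : Re (g x * (gaussN t a x)%:C) = Re (g x) * gaussN t a x.
  by rewrite cReM /= mulr0 subr0.
have Ei t a x : Im (g x * (gaussN t a x)%:C) = Im (g x) * gaussN t a x.
  by rewrite cImM /= mulr0 add0r.
have r0 : {ae mu, forall x, (fun x => Re (g x)) x = 0}.
  apply: gaussian_test_ae_eq0 => // t a t0; have [[ir _] /(congr1 Re) /= e0] := h t a t0.
  split; first by under [X in _ \o X]eq_fun do rewrite -Er.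
  by under eq_Rintegral do rewrite -Er.
have i0 : {ae mu, forall x, (fun x => Im (g x)) x = 0}.
  apply: gaussian_test_ae_eq0 => // t a t0; have [[_ ii] /(congr1 Im) /= e0] := h t a t0.
  split; first by under [X in _ \o X]eq_fun do rewrite -Ei.
  by under eq_Rintegral do rewrite -Ei.
by move: r0 i0; apply: filterS2 => x /= hr hi; exact: complex_eq.
Qed.

Lemma continuous_gaussC_eq f g : continuous f -> continuous g ->
  (forall t a, 0 < t -> [/\ cintg mu (fun x => f x * (gaussN t a x)%:C),
     cintg mu (fun x => g x * (gaussN t a x)%:C) &
     cint mu (fun x => f x * (gaussN t a x)%:C) =
     cint mu (fun x => g x * (gaussN t a x)%:C)]) -> f = g.
Proof.
move=> /continuous_cplxP[fr fi] /continuous_cplxP[gr gi] h.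
pose d x := f x + -1 * g x.
have dr : continuous (fun x => Re (d x)).
  rewrite (_ : (fun x => _) = fun x => Re (f x) + -1 * Re (g x)).
    by apply: real_continuousD => //; exact: real_continuousZ.
  by apply/funext => x; rewrite /d !mulN1r cReD cReN.
have di : continuous (fun x => Im (d x)).
  rewrite (_ : (fun x => _) = fun x => Im (f x) + -1 * Im (g x)).
    by apply: real_continuousD => //; exact: real_continuousZ.
  by apply/funext => x; rewrite /d !mulN1r cImD cImN.
have d0 : {ae mu, forall x, d x = 0}.
  apply: gaussC_test_ae_eq0; first by split; exact: continuous_measurable_rV.
  move=> t a t0; have [i1 i2 e12] := h t a t0.
  rewrite (_ : (fun x => _) = fun x => f x * (gaussN t a x)%:C + -1 * (g x * (gaussN t a x)%:C)).
    split; first by apply: cintgD => //; exact: cintgZ.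
    by rewrite cintD//; [rewrite cintZ// e12 mulN1r subrr|exact: cintgZ].
  by apply/funext => x; rewrite /d mulrDl mulrA.
have d0r : {ae mu, forall x, (fun x => Re (d x)) x = 0} by move: d0; apply: filterS => x ->.
have d0i : {ae mu, forall x, (fun x => Im (d x)) x = 0} by move: d0; apply: filterS => x ->.
apply/funext => x; apply/eqP; rewrite -subr_eq0 -mulN1r -/(d x); apply/eqP/complex_eq.
- exact: (continuous_ae_eq0 dr d0r).
- exact: (continuous_ae_eq0 di d0i).
Qed.

Lemma continuous_oscillatory e f : e ^+ 2 = 1 -> cintg mu f -> continuous (oscillatory e f).
Proof. by move=> e1 /(oscillatory_continuous e1) ?; apply/continuous_cplxP. Qed.

Lemma schwartz_continuous phi : schwartz phi -> continuous phi.
Proof.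
by move=> /schwartzP[/rschwartz_continuous ? /rschwartz_continuous ?]; apply/continuous_cplxP.
Qed.

Lemma schwartz_normc_bounded phi : schwartz phi -> exists K, forall x, normc (phi x) <= K.
Proof.
move=> /schwartzP[/rschwartz_bounded[K hK] /rschwartz_bounded[K' hK']].
by exists (K + K') => x; rewrite (le_trans (normc_le _))// lerD.
Qed.

Lemma cintg_mul_schwartz f phi : cintg mu f -> schwartz phi ->
  cintg mu (fun x => f x * phi x).
Proof.
move=> fi sp; have [K hK] := schwartz_normc_bounded sp.
by apply: (cintg_mul_bounded (M := K)) => //; exact/cintg_cmeas/schwartz_cintg.
Qed.

Lemma oscillatory_inversion e phi : e ^+ 2 = 1 -> schwartz phi ->
  oscillatory (- e) (oscillatory e phi) = fun x => ((2 * pi) ^+ n)%:C * phi x.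
Proof.
move=> e1 sp; have Ne1 : (- e) ^+ 2 = 1 by rewrite sqrrN.
have so := oscillatory_schwartz e1 sp; have ip := schwartz_cintg sp.
have soo := oscillatory_schwartz Ne1 so.
apply: continuous_gaussC_eq.
- exact: schwartz_continuous.
- exact: schwartz_continuous (schwartzZ _ sp).
move=> t a t0; have sg := gaussC_schwartz a t0; split.
- exact: cintg_mul_schwartz (schwartz_cintg soo) sg.
- exact: cintg_mul_schwartz (schwartz_cintg (schwartzZ _ sp)) sg.
(* Applied twice, duality carries both transforms onto the Gaussian, in reverse order; this is why
   the formula for the Gaussian is used with the sign -e. *)
rewrite (oscillatory_duality (- e) (schwartz_cintg so) (schwartz_cintg sg)).
have sog := oscillatory_schwartz Ne1 sg.
rewrite (oscillatory_duality e ip (schwartz_cintg sog)).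
congr (cint mu _); apply/funext => x.
have := oscillatory_gaussN_inv a Ne1 t0 x.
by rewrite opprK => ->; rewrite rmorphM /=; ring.
Qed.

Lemma two_pi_expn_neq0 : ((2 * pi) ^+ n)%:C != 0 :> cplx R.
Proof. by rewrite (fmorph_eq0 (real_complex R)) expf_neq0// mulf_neq0// gt_eqF// pi_gt0. Qed.

Lemma inv_fourierK phi : schwartz phi -> inv_fourier (fourier phi) = phi.
Proof.
move=> sp; apply/funext => x; rewrite inv_fourierE fourierE.
have := oscillatory_inversion (@sqrN1 R) sp; rewrite opprK => ->.
by rewrite fmorphV mulKf// two_pi_expn_neq0.
Qed.

Lemma fourierK phi : schwartz phi -> fourier (inv_fourier phi) = phi.
Proof.
move=> sp; rewrite fourierE.
have -> : inv_fourier phi = fun x => ((2 * pi) ^- n)%:C * oscillatory 1 phi x.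
  by apply/funext => x; rewrite inv_fourierE.
have e1 : 1 ^+ 2 = 1 :> R by rewrite expr1n.
have so := schwartz_cintg (oscillatory_schwartz e1 sp).
apply/funext => xi; rewrite -[in RHS](mulKf two_pi_expn_neq0 (phi xi)).
have /(congr1 (fun f => f xi)) /= <- := oscillatory_inversion e1 sp.
rewrite /oscillatory -fmorphV -cintZ; last exact: (cintg_oscillatory _ _ so).
by congr (cint mu _); apply/funext => x; rewrite mulrCA.
Qed.

Lemma inv_fourier_oscillatory f : cintg mu f ->
  inv_fourier f = oscillatory 1 (fun x => ((2 * pi) ^- n)%:C * f x).
Proof.
move=> fi; apply/funext => xi; rewrite inv_fourierE /oscillatory -cintZ.
  by congr (cint mu _); apply/funext => x; rewrite mulrCA.
by apply: cintg_oscillatory => //; rewrite expr1n.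
Qed.

Lemma inv_fourier_duality f g : cintg mu f -> cintg mu g ->
  cint mu (fun x => inv_fourier f x * g x) = cint mu (fun x => f x * inv_fourier g x).
Proof.
move=> fi gi; rewrite (inv_fourier_oscillatory fi).
rewrite (oscillatory_duality 1 (cintgZ _ fi) gi).
by congr (cint mu _); apply/funext => x; rewrite inv_fourierE mulrCA mulrA.
Qed.

End fourier_inversion.

(** * The spectral Barron space and its dual *)

Section japanese_weight.
Context (R : realType) (n : nat).
Implicit Types x : 'rV[R]_n.

Lemma sum_le_prod1D (I : Type) (r : seq I) (a : I -> R) : (forall i, 0 <= a i) ->
  1 + \sum_(i <- r) a i <= \prod_(i <- r) (1 + a i).
Proof.
move=> a0; elim: r => [|i r ih]; first by rewrite !big_nil addr0.
rewrite !big_cons (le_trans _ (ler_wpM2l _ ih)) ?addr_ge0//.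
have s0 : 0 <= \sum_(j <- r) a j by exact: sumr_ge0.
by have := mulr_ge0 (a0 i) s0; lra.
Qed.

Lemma japanese_ge1 x : 1 <= japanese x.
Proof.
rewrite /japanese -[leLHS]sqrtr1 ler_wsqrtr// lerDl sumr_ge0// => i _.
exact: sqr_ge0.
Qed.

Lemma japanese_le_weight x : japanese x <= rV_weight x.
Proof.
have y1 : 1 <= 1 + \sum_i x 0 i ^+ 2.
  by rewrite lerDl sumr_ge0// => i _; exact: sqr_ge0.
apply: (@le_trans _ _ (1 + \sum_i x 0 i ^+ 2)).
  rewrite /japanese -[leRHS]ger0_norm ?(le_trans ler01)// -sqrtr_sqr ler_wsqrtr//.
  by rewrite expr2 ler_peMl// (le_trans ler01).
by apply: sum_le_prod1D => i; exact: sqr_ge0.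
Qed.

Lemma measurable_japanese_powR (s : R) :
  measurable_fun setT (fun x : 'rV[R]_n => japanese x `^ s).
Proof.
apply: (measurableT_comp (measurable_powR s)).
apply: (measurableT_comp (continuous_measurable_fun (@sqrt_continuous R))).
apply: measurable_funD => //; apply: measurable_sum => i.
by apply: measurable_funX; exact: (measurable_rV_coord i).
Qed.

Lemma japanese_powR_gt0 (s : R) x : 0 < japanese x `^ s.
Proof. by rewrite powR_gt0// (lt_le_trans ltr01)// japanese_ge1. Qed.

Lemma japanese_powR_ge1 (s : R) x : 0 <= s -> 1 <= japanese x `^ s.
Proof.
by move=> s0; rewrite -(powRr0 (japanese x)) ler_powR// japanese_ge1.
Qed.

(** The real power of <x> is traded for a natural power of the polynomial weight, which Schwartz
    functions absorb. *)
Lemma japanese_powR_le_weight (s : R) : exists k : nat, forall x,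
  japanese x `^ s <= rV_weight x ^+ k.
Proof.
have [k sk] : exists k : nat, s <= k%:R.
  exists (Num.bound `|s|); rewrite (le_trans (ler_norm _))// ltW//.
  exact: (archi_boundP (normr_ge0 s)).
exists k => x; rewrite (le_trans (ler_powR (japanese_ge1 x) sk))//.
rewrite powR_mulrn; last by rewrite (le_trans ler01)// japanese_ge1.
by apply: lerXn2r (japanese_le_weight x); rewrite nnegrE (le_trans ler01)//
  ?rV_weight_ge1// japanese_ge1.
Qed.

End japanese_weight.

Section representation.
Context (R : realType) (n : nat).
Local Notation mu := (@lebesgue_rV R n).
Implicit Types (phi f g h v : cfun R n) (u : cfun R n -> cplx R).

Lemma representsP g u : represents g u <->
  cmeas g /\ forall phi, schwartz phi ->
    cintg mu (fun x => g x * phi x) /\ u phi = cint mu (fun x => g x * phi x).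
Proof. by []. Qed.

Lemma represents_density u : (exists g, represents g u) -> represents (density u) u.
Proof. exact: xgetPex. Qed.

Lemma represents_lin (k : cplx R) g g' u u' : represents g u -> represents g' u' ->
  represents (fun x => k * g x + g' x) (fun phi => k * u phi + u' phi).
Proof.
move=> /representsP[mg hg] /representsP[mg' hg']; apply/representsP; split.
  by apply: cmeasD => //; apply: cmeasM => //; exact: cmeas_cst.
move=> phi sp; have [i e] := hg _ sp; have [i' e'] := hg' _ sp.
rewrite (_ : (fun x => _) = fun x => k * (g x * phi x) + g' x * phi x); last first.
  by apply/funext => x; rewrite mulrDl mulrA.
split; first by apply: cintgD => //; exact: cintgZ.
by rewrite cintD//; [rewrite cintZ// e e'|exact: cintgZ].
Qed.

(** The difference of the two functions is orthogonal to every Gaussian. This lets any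
    representative stand for the chosen [density]. *)
Lemma represents_ae g g' u u' : represents g u -> represents g' u' ->
  (forall phi, schwartz phi -> u phi = u' phi) -> {ae mu, forall x, g x = g' x}.
Proof.
move=> rg rg' uu'.
have /representsP[md hd] := represents_lin (-1) rg' rg.
have : {ae mu, forall x, -1 * g' x + g x = 0}.
  apply: (gaussC_test_ae_eq0 md) => t a t0.
  have sg := @gaussC_schwartz R n t a t0; have [i <-] := hd _ sg.
  by split=> //; rewrite uu'// mulN1r addNr.
by apply: filterS => x /eqP; rewrite mulN1r addrC subr_eq0 => /eqP.
Qed.

Lemma dist_inv_fourierE u phi : schwartz phi -> dist_inv_fourier u phi = u (inv_fourier phi).
Proof. by move=> sp; rewrite /dist_inv_fourier patchE mem_set. Qed.

Lemma dist_fourier_dist_ofE v phi : schwartz phi ->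
  dist_fourier (dist_of v) phi = cint mu (fun x => v x * fourier phi x).
Proof.
move=> sp; rewrite /dist_fourier patchE mem_set// /dist_of patchE mem_set//.
exact: fourier_schwartz.
Qed.

Lemma represents_fourierP g v : represents g (dist_fourier (dist_of v)) <->
  cmeas g /\ forall phi, schwartz phi -> cintg mu (fun x => g x * phi x) /\
    cint mu (fun x => v x * fourier phi x) = cint mu (fun x => g x * phi x).
Proof.
split=> [/representsP[mg hg]|[mg hg]].
  by split=> // phi sp; have [i e] := hg _ sp; rewrite -dist_fourier_dist_ofE.
by apply/representsP; split=> // phi sp; rewrite dist_fourier_dist_ofE//; exact: hg.
Qed.

Lemma inv_fourier_lin (k : cplx R) f g : cintg mu f -> cintg mu g ->
  inv_fourier (fun x => k * f x + g x) = fun xi => k * inv_fourier f xi + inv_fourier g xi.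
Proof.
move=> fi gi; have e1 : 1 ^+ 2 = 1 :> R by rewrite expr1n.
apply/funext => xi; rewrite !inv_fourierE mulrCA -mulrDr; congr (_ * _).
rewrite /oscillatory -cintZ; last exact: cintg_oscillatory.
rewrite -cintD; [|exact/cintgZ/cintg_oscillatory|exact: cintg_oscillatory].
by congr (cint mu _); apply/funext => x; rewrite mulrDr mulrCA.
Qed.

End representation.

(** The B^s norm read on the spectral side, as a real number. It agrees with [barron_norm] when h is
    the transform and lies in the weighted space. *)
Definition wnorm (R : realType) n (s : R) (h : cfun R n) : R :=
  \int[lebesgue_rV n]_x (japanese x `^ s * normc (h x)).

(** * B^s as a weighted L^1 space *)

Section barron_space.
Context (R : realType) (n : nat) (s : R) (s0 : 0 <= s).
Local Notation mu := (@lebesgue_rV R n).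
Local Notation w x := (japanese x `^ s).
Implicit Types (phi f g h v : cfun R n).

Definition spectrum v := density (dist_fourier (dist_of v)).

Definition weighted h := cmeas h /\ intg mu (fun x => w x * normc (h x)).

Lemma weighted_cintg h : weighted h -> cintg mu h.
Proof.
move=> [mh hi]; apply: (cintg_le mh _ hi) => x.
by rewrite ler_peMl ?normc_ge0 ?japanese_powR_ge1.
Qed.

Lemma weighted_lin (k : cplx R) h h' : weighted h -> weighted h' ->
  weighted (fun x => k * h x + h' x).
Proof.
move=> [mh hi] [mh' hi'].
have mk : cmeas (fun x => k * h x + h' x).
  by apply: cmeasD => //; apply: cmeasM => //; exact: cmeas_cst.
split=> //.
apply: intg_le (intgD (intgZ (normc k) hi) hi').
  by apply: measurable_funM; [exact: measurable_japanese_powR|exact: cmeas_normc].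
move=> x; rewrite ger0_norm ?mulr_ge0 ?normc_ge0 ?powR_ge0//.
rewrite mulrCA -mulrDr ler_wpM2l ?powR_ge0//.
by rewrite (le_trans (normcD _ _))// ComplexField.Normc.normcM.
Qed.

Lemma schwartz_weighted phi : schwartz phi -> weighted phi.
Proof.
move=> sp; have [k hk] := @japanese_powR_le_weight R n s.
have ip := schwartz_cintg sp; have /schwartzP[sr si] := sp.
split; first exact: cintg_cmeas ip.
apply: intg_le (intgD (intg_norm (intg_rschwartz_weight k sr))
  (intg_norm (intg_rschwartz_weight k si))).
  apply: measurable_funM; first exact: measurable_japanese_powR.
  exact/cmeas_normc/(cintg_cmeas ip).
move=> x; rewrite ger0_norm ?mulr_ge0 ?normc_ge0 ?powR_ge0//.
have W0 : 0 <= rV_weight x ^+ k by rewrite exprn_ge0// ltW// rV_weight_gt0.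
rewrite !normrM !(ger0_norm W0) -mulrDr (le_trans (ler_wpM2r (normc_ge0 _) (hk x)))//.
by rewrite ler_wpM2l// normc_le.
Qed.

Lemma barron_normE v g : represents g (dist_fourier (dist_of v)) ->
  barron_norm s v = (\int[mu]_x (w x * normc (g x))%:E)%E.
Proof.
move=> rg; have rd := represents_density (ex_intro _ g rg).
rewrite /barron_norm Lnorm1; apply: ae_eq_integral => //.
- apply/measurableT_comp/measurable_EFinP => //; apply: measurable_funM.
    exact: measurable_japanese_powR.
  by apply: cmeas_normc; have /representsP[] := rd.
- apply/measurable_EFinP; apply: measurable_funM; first exact: measurable_japanese_powR.
  by apply: cmeas_normc; have /representsP[] := rg.
- apply: filterS (represents_ae rd rg _) => // x /= -> _.
  by rewrite ger0_norm// mulr_ge0 ?normc_ge0// powR_ge0.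
Qed.

Lemma barron_norm_fin v h : weighted h -> represents h (dist_fourier (dist_of v)) ->
  barron_norm s v = (wnorm s h)%:E.
Proof. by move=> [mh hi] /barron_normE ->; rewrite EFin_Rintegral. Qed.

(** Duality moves the inverse transform onto [fourier phi], where inversion for Schwartz functions
    cancels it. *)
Lemma represents_inv_fourier h : cintg mu h ->
  represents h (dist_fourier (dist_of (inv_fourier h))).
Proof.
move=> hi; apply/represents_fourierP; split; first exact: cintg_cmeas hi.
move=> phi sp; split; first exact: cintg_mul_schwartz.
have sf := fourier_schwartz sp.
by rewrite inv_fourier_duality//; [rewrite inv_fourierK|exact: schwartz_cintg].
Qed.

Lemma inv_fourier_barron h : weighted h -> barron s (inv_fourier h).
Proof.
move=> wh; have hi := weighted_cintg wh; have e1 : 1 ^+ 2 = 1 :> R by rewrite expr1n.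
split.
- by rewrite (inv_fourier_oscillatory hi); exact: (continuous_oscillatory e1 (cintgZ _ hi)).
- apply/bounded_cplxP; rewrite (inv_fourier_oscillatory hi).
  exists (\int[mu]_x normc (((2 * pi) ^- n)%:C * h x)) => x.
  exact: (normc_oscillatory 1 x (cintgZ _ hi)).
- by exists h; exact: represents_inv_fourier.
- by rewrite (barron_norm_fin wh (represents_inv_fourier hi)) ltry.
Qed.

Lemma represents_spectrum v : barron s v -> represents (spectrum v) (dist_fourier (dist_of v)).
Proof. by move=> [_ _ + _]; exact: represents_density. Qed.

Lemma weighted_spectrum v : barron s v -> weighted (spectrum v).
Proof.
move=> Bv; have rs := represents_spectrum Bv; have [ms _] := rs; split=> //.
have [_ _ _] := Bv; rewrite (barron_normE rs) => lt.
apply/integrableP; split.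
  by apply/measurable_EFinP; apply: measurable_funM;
    [exact: measurable_japanese_powR|exact: cmeas_normc].
under eq_integral do rewrite gee0_abs ?lee_fin ?mulr_ge0 ?normc_ge0 ?powR_ge0//.
exact: lt.
Qed.

(** Both sides are bounded and continuous, so it suffices to pair them with Gaussians. Writing a
    Gaussian as the Fourier transform of its inverse transform brings in the defining property of
    [spectrum]. *)
Lemma inv_fourier_spectrum v : barron s v -> inv_fourier (spectrum v) = v.
Proof.
move=> Bv; have wsp := weighted_spectrum Bv; have si := weighted_cintg wsp.
have [cv /bounded_cplxP[K hK] _ _] := Bv.
have [ci /bounded_cplxP[K' hK'] _ _] := inv_fourier_barron wsp.
have cm (u : cfun R n) : continuous u -> cmeas u.
  by move=> /continuous_cplxP[? ?]; split; exact: continuous_measurable_rV.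
apply: (continuous_gaussC_eq ci cv) => t a t0; have sg := @gaussC_schwartz R n t a t0.
have ig := schwartz_cintg sg; split.
- under [X in cintg _ X]eq_fun do rewrite mulrC.
  exact: (cintg_mul_bounded (M := K') ig (cm _ ci) hK').
- under [X in cintg _ X]eq_fun do rewrite mulrC.
  exact: (cintg_mul_bounded (M := K) ig (cm _ cv) hK).
have /represents_fourierP[_ /(_ _ (inv_fourier_schwartz sg))[_]] := represents_spectrum Bv.
by rewrite fourierK// => ->; exact: inv_fourier_duality.
Qed.

Lemma spectrum_inv_fourier h : weighted h ->
  {ae mu, forall x, spectrum (inv_fourier h) x = h x}.
Proof.
move=> wh; have rs := represents_spectrum (inv_fourier_barron wh).
by apply: represents_ae rs (represents_inv_fourier (weighted_cintg wh)) _.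
Qed.

Lemma barron_linE (k : cplx R) u v : barron s u -> barron s v ->
  (fun x => k * u x + v x) = inv_fourier (fun x => k * spectrum u x + spectrum v x).
Proof.
move=> Bu Bv; rewrite inv_fourier_lin; try exact/weighted_cintg/weighted_spectrum.
by rewrite !inv_fourier_spectrum.
Qed.

Lemma barron_lin (k : cplx R) u v : barron s u -> barron s v -> barron s (fun x => k * u x + v x).
Proof.
move=> Bu Bv; rewrite (barron_linE k Bu Bv).
by apply/inv_fourier_barron/weighted_lin; exact: weighted_spectrum.
Qed.

Lemma spectrum_lin (k : cplx R) u v : barron s u -> barron s v ->
  {ae mu, forall x, spectrum (fun x => k * u x + v x) x = k * spectrum u x + spectrum v x}.
Proof.
move=> Bu Bv; rewrite (barron_linE k Bu Bv).
by apply/spectrum_inv_fourier/weighted_lin; exact: weighted_spectrum.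
Qed.

Lemma schwartz_barron phi : schwartz phi -> barron s phi.
Proof.
move=> sp; rewrite -(inv_fourierK sp).
exact/inv_fourier_barron/schwartz_weighted/fourier_schwartz.
Qed.

Lemma spectrum_schwartz phi : schwartz phi ->
  {ae mu, forall x, spectrum phi x = fourier phi x}.
Proof.
move=> sp.
suff : {ae mu, forall x, spectrum (inv_fourier (fourier phi)) x = fourier phi x}.
  by rewrite inv_fourierK.
exact/spectrum_inv_fourier/schwartz_weighted/fourier_schwartz.
Qed.

Lemma barron_norm_spectrum v : barron s v ->
  barron_norm s v = (wnorm s (spectrum v))%:E.
Proof.
by move=> Bv; apply: barron_norm_fin; [exact: weighted_spectrum|exact: represents_spectrum].
Qed.

End barron_space.

(** * The dual of the weighted L^1 space *)

Section weighted_dual.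
Context (R : realType) (n : nat) (s : R) (s0 : 0 <= s).
Local Notation mu := (@lebesgue_rV R n).
Local Notation w x := (japanese x `^ s).
Local Notation Re := (@complex.Re R).
Local Notation Im := (@complex.Im R).
Implicit Types (h : cfun R n).

Variables (Lam : cfun R n -> cplx R) (M : R).
Hypothesis LamL : forall (k : cplx R) h h', weighted s h -> weighted s h' ->
  Lam (fun x => k * h x + h' x) = k * Lam h + Lam h'.
Hypothesis LamM : forall h, weighted s h ->
  normc (Lam h) <= M * wnorm s h.
Hypothesis M0 : 0 <= M.

(** Division by the weight embeds real L^1 isometrically into the weighted complex space. *)
Let lift (f : 'rV[R]_n -> R) : cfun R n := fun x => (f x / w x)%:C.

Let wlift (f : 'rV[R]_n -> R) (x : 'rV[R]_n) : w x * normc (lift f x) = `|f x|.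
Proof.
rewrite /lift normcR normrM normfV (ger0_norm (powR_ge0 _ _)) mulrC divfK//.
by rewrite gt_eqF// japanese_powR_gt0.
Qed.

Let measurable_div (f : 'rV[R]_n -> R) : measurable_fun setT f -> measurable_fun setT (fun x : 'rV[R]_n => f x / w x).
Proof.
move=> mf; under eq_fun do rewrite -powRN.
by apply: measurable_funM => //; exact: measurable_japanese_powR.
Qed.

Let weighted_lift f : intg mu f -> weighted s (lift f).
Proof.
move=> fi; split; first by apply: cmeas_real; apply: measurable_div; exact: intg_measurable fi.
rewrite (_ : (fun x => _) = fun x => `|f x|); first exact: intg_norm.
by apply/funext => x; exact: wlift.
Qed.

Let lift_lin (c : R) f g : lift (fun x => c * f x + g x) = fun x => c%:C * lift f x + lift g x.
Proof. by apply/funext => x; rewrite /lift mulrDl -mulrA rmorphD rmorphM. Qed.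

Let lam_lin (c : R) f g : intg mu f -> intg mu g ->
  Lam (lift (fun x => c * f x + g x)) = c%:C * Lam (lift f) + Lam (lift g).
Proof. by move=> fi gi; rewrite lift_lin LamL//; exact: weighted_lift. Qed.

Let lam_bound f : intg mu f -> normc (Lam (lift f)) <= M * \int[mu]_x `|f x|.
Proof.
move=> fi; have := LamM (weighted_lift fi).
by rewrite /wnorm; under eq_Rintegral do rewrite wlift.
Qed.

(** The representation theorem is about real functionals; it is applied to the real and imaginary
    parts separately. Each density is bounded by M, whence 2 M. *)
Let lam_real : exists P : cfun R n, [/\ cmeas P, forall x, normc (P x) <= 2 * M &
  forall f, intg mu f -> Lam (lift f) = cint mu (fun x => P x * (f x)%:C)].
Proof.
have mVe : measurable_fun setT (fun x : 'rV[R]_n => ((rV_weight x)^-1)^-1).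
  by under eq_fun do rewrite invrK; exact: rV_weight_measurable.
(* The positive integrable function used to obtain a finite charge is the inverse polynomial
   weight. *)
have e0 (x : 'rV[R]_n) : 0 < (rV_weight x)^-1 by rewrite invr_gt0 rV_weight_gt0.
have ei := @intg_weightV R n.
pose lr f := Re (Lam (lift f)); pose li f := Im (Lam (lift f)).
have [p [mp pM hp]] : exists p : 'rV[R]_n -> R, [/\ measurable_fun setT p,
    forall x, `|p x| <= M & forall f, intg mu f -> lr f = \int[mu]_x (p x * f x)].
  apply: (L1_dual_representation e0 ei mVe M0) => [c f g fi gi|f fi].
    by rewrite /lr lam_lin// cReD cReM /= mul0r subr0.
  exact: le_trans (normRe_le _) (lam_bound fi).
have [q [mq qM hq]] : exists q : 'rV[R]_n -> R, [/\ measurable_fun setT q,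
    forall x, `|q x| <= M & forall f, intg mu f -> li f = \int[mu]_x (q x * f x)].
  apply: (L1_dual_representation e0 ei mVe M0) => [c f g fi gi|f fi].
    by rewrite /li lam_lin// cImD cImM /= mul0r addr0.
  exact: le_trans (normIm_le _) (lam_bound fi).
exists (fun x => p x +i* q x); split=> [|x|f fi]; first by split.
  by rewrite (le_trans (normc_le _))//= mulr_natl mulr2n lerD.
apply: complex_eq.
- by transitivity (lr f) => //; rewrite hp//; apply: eq_Rintegral => x _; rewrite cReM /= mulr0 subr0.
- by transitivity (li f) => //; rewrite hq//; apply: eq_Rintegral => x _; rewrite cImM /= mulr0 add0r.
Qed.

Lemma weighted_dual : exists g : cfun R n, [/\ cmeas g, forall x : 'rV[R]_n, normc (g x) <= 2 * M * w x &
  forall h, weighted s h -> cintg mu (fun x => g x * h x) /\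
    Lam h = cint mu (fun x => g x * h x)].
Proof.
have [P [mP PM hP]] := lam_real.
have mw : cmeas (fun x : 'rV[R]_n => (w x)%:C).
  by apply: cmeas_real; exact: measurable_japanese_powR.
exists (fun x => P x * (w x)%:C); split=> [|x|h wh]; first exact: cmeasM.
  rewrite ComplexField.Normc.normcM normcR (ger0_norm (powR_ge0 _ _)).
  by rewrite ler_wpM2r ?powR_ge0.
have [mh hi] := wh.
have [hr him] : intg mu (fun x => w x * Re (h x)) /\ intg mu (fun x => w x * Im (h x)).
  have mjp := @measurable_japanese_powR R n s.
  have [mr mi] := mh; split; apply: intg_le hi; try exact: measurable_funM; move=> x;
    rewrite normrM (ger0_norm (powR_ge0 _ _)) ler_wpM2l ?powR_ge0//.
  - exact: normRe_le.
  - exact: normIm_le.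
have w0 x : w x != 0 by rewrite gt_eqF// japanese_powR_gt0.
(* Complex linearity reduces h to the lifts of the real L^1 functions w Re h and w Im h. *)
have hE : h = fun x => (0 +i* 1) * lift (fun x => w x * Im (h x)) x +
    lift (fun x => w x * Re (h x)) x.
  apply/funext => x; rewrite /lift ![w x * _]mulrC !mulfK//.
  by apply: complex_eq; rewrite ?cReD ?cImD ?cReM ?cImM /=; ring.
have iP (f : 'rV[R]_n -> R) : intg mu f -> cintg mu (fun x => P x * (f x)%:C).
  move=> fi; under [X in cintg _ X]eq_fun do rewrite mulrC.
  apply: (cintg_mul_bounded (M := 2 * M)) => //; split=> //=.
  by under [_ \o _]eq_fun do rewrite /=; exact: intg0.
have E x : P x * (w x)%:C * h x =
    (0 +i* 1) * (P x * (w x * Im (h x))%:C) + P x * (w x * Re (h x))%:C.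
  have {1}-> : h x = (0 +i* 1) * (Im (h x))%:C + (Re (h x))%:C.
    by apply: complex_eq; rewrite ?cReD ?cImD ?cReM ?cImM /=; ring.
  by rewrite !rmorphM /=; ring.
under [X in cintg _ X]eq_fun do rewrite E.
under [X in cint _ X]eq_fun do rewrite E.
split; first by apply: cintgD; [exact/cintgZ/iP|exact: iP].
rewrite cintD; [|exact/cintgZ/iP|exact: iP].
rewrite cintZ; last exact: iP.
rewrite -!hP// {1}hE LamL//; exact: weighted_lift.
Qed.

End weighted_dual.

(** * Functionals on B^s *)

Section barron_dual.
Context (R : realType) (n : nat) (s : R) (s0 : 0 <= s).
Local Notation mu := (@lebesgue_rV R n).
Local Notation w x := (japanese x `^ s).
Implicit Types (phi psi g h v : cfun R n) (L f : cfun R n -> cplx R).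

Local Notation B := (@barron R n s).
Local Notation B' := (dual_space (@barron R n s) (@barron_norm R n s)).
Lemma spectrum_norm_ge0 v : 0 <= wnorm s (spectrum v).
Proof. by apply: Rintegral_ge0 => x _; rewrite mulr_ge0 ?powR_ge0 ?normc_ge0. Qed.

Lemma dual_spaceP L : B' L <-> [/\
  forall (k : cplx R) u v, B u -> B v -> L (fun x => k * u x + v x) = k * L u + L v,
  exists2 M : R, 0 <= M & forall v, B v -> normc (L v) <= M * wnorm s (spectrum v) &
  forall v, ~ B v -> L v = 0].
Proof.
split=> -[Ll [M]]; last first.
  move=> M0 hM L0; split=> //; exists M => v Bv.
  by rewrite (barron_norm_spectrum Bv) -EFinM lee_fin; exact: hM.
move=> hM L0; split=> //; exists `|M| => // v Bv.
have := hM v Bv; rewrite (barron_norm_spectrum Bv) -EFinM lee_fin => /le_trans; apply.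
by rewrite ler_wpM2r ?spectrum_norm_ge0// ler_norm.
Qed.

Lemma inv_fourier_norm h : weighted s h ->
  wnorm s (spectrum (inv_fourier h)) = wnorm s h.
Proof.
move=> wh; apply: EFin_inj; rewrite -(barron_norm_spectrum (inv_fourier_barron s0 wh)).
exact: (barron_norm_fin wh (represents_inv_fourier (weighted_cintg s0 wh))).
Qed.

Lemma dual_representation L (M : R) : B' L -> 0 <= M ->
  (forall v, B v -> normc (L v) <= M * wnorm s (spectrum v)) ->
  exists g, [/\ cmeas g, forall x : 'rV[R]_n, normc (g x) <= 2 * M * w x &
    forall h, weighted s h -> cintg mu (fun x => g x * h x) /\
      L (inv_fourier h) = cint mu (fun x => g x * h x)].
Proof.
move=> /dual_spaceP[Ll _ _] M0 hM.
apply: (@weighted_dual _ _ s (L \o inv_fourier) M) => // [k h h' wh wh'|h wh] /=.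
  rewrite (inv_fourier_lin k (weighted_cintg s0 wh) (weighted_cintg s0 wh')).
  by rewrite Ll//; exact: inv_fourier_barron.
by rewrite -inv_fourier_norm//; apply: hM; exact: inv_fourier_barron.
Qed.

Lemma dual_sub L L' : B' L -> B' L' -> B' (L - L').
Proof.
move=> /dual_spaceP[Ll [M M0 hM] L0] /dual_spaceP[Ll' [M' M0' hM'] L0'].
have E v : (L - L') v = L v - L' v by [].
apply/dual_spaceP; split=> [k u v Bu Bv| |v Bv].
- by rewrite !E Ll// Ll'//; ring.
- exists (M + M') => [|v Bv]; first exact: addr_ge0.
  by rewrite E mulrDl (le_trans (normcD _ _))// normcN lerD ?hM ?hM'.
- by rewrite E L0// L0'// subr0.
Qed.

(** This is the density of the Schwartz space in B^s, in dual form. The function g representing L on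
    the spectral side is orthogonal to each Gaussian, because the inverse transform of a Gaussian is
    a Schwartz function; so g vanishes almost everywhere. *)
Lemma dual_schwartz_eq0 L : B' L -> (forall phi, schwartz phi -> L phi = 0) ->
  forall v, L v = 0.
Proof.
move=> BL Ls; have /dual_spaceP[Ll [M M0 hM] L0] := BL.
have [g [mg gM hg]] := dual_representation BL M0 hM.
have g0 : {ae mu, forall x, g x = 0}.
  apply: gaussC_test_ae_eq0 => // t a t0; have sg := @gaussC_schwartz R n t a t0.
  have [i e] := hg _ (schwartz_weighted s sg); split=> //.
  by rewrite -e Ls//; exact: inv_fourier_schwartz.
move=> v; have [Bv|/L0//] := pselect (B v).
have wv := weighted_spectrum Bv.
rewrite -(inv_fourier_spectrum s0 Bv); have [i ->] := hg _ wv.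
transitivity (cint mu (fun=> 0 : cplx R)); last first.
  by apply: complex_eq => /=; rewrite Rintegral_cst// mul0r.
apply: ae_eq_cint; [exact: cintg_cmeas i|exact: cmeas_cst|].
by move: g0; apply: filterS => x ->; rewrite mul0r.
Qed.

Lemma dual_norm_le L (K : R) : 0 <= K -> (forall v, B v -> normc (L v) <= K * wnorm s (spectrum v)) ->
  (dual_norm B (barron_norm s) L <= K%:E)%E.
Proof.
move=> K0 hK; apply: ge_ereal_sup => _ [v [Bv Nv] <-].
rewrite lee_fin (le_trans (hK v Bv))// -[leRHS]mulr1 ler_wpM2l//.
by rewrite -lee_fin -(barron_norm_spectrum Bv).
Qed.

Lemma dual_norm_ge L (K : R) : B' L -> 0 <= K -> (dual_norm B (barron_norm s) L <= K%:E)%E ->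
  forall v, B v -> normc (L v) <= K * wnorm s (spectrum v).
Proof.
move=> /dual_spaceP[Ll [M M0 hM] L0] K0 hK v Bv.
have Iv := spectrum_norm_ge0 v; set a := wnorm s (spectrum v) in Iv *.
(* A vector of norm 0 cannot be normalised; there the bound by M already forces L v = 0. *)
have [a0|a_neq0] := eqVneq a 0.
  by have := hM v Bv; rewrite -/a a0 !mulr0.
have ap : 0 < a by rewrite lt0r a_neq0.
(* The normalised vector v / a is written as (k - 1) v + v to fit the form k u + v in which
   linearity is stated. *)
pose k : cplx R := (a^-1)%:C; pose v' : cfun R n := fun x => (k - 1) * v x + v x.
have wv := weighted_spectrum Bv.
pose h x := (k - 1) * spectrum v x + spectrum v x.
have wh : weighted s h by exact: weighted_lin.
have v'E : v' = inv_fourier h by exact: (barron_linE s0 (k - 1) Bv Bv).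
have Bv' : B v' by rewrite v'E; exact: inv_fourier_barron.
have I1 : wnorm s (spectrum v') = 1.
  rewrite v'E inv_fourier_norm// /wnorm; rewrite -[RHS](mulVf a_neq0) -RintegralZl//; last exact: wv.2.
  apply: eq_Rintegral => x _; rewrite /h mulrBl mul1r subrK.
  by rewrite ComplexField.Normc.normcM normcR ger0_norm ?invr_ge0// mulrCA.
have : ((normc (L v'))%:E <= K%:E)%E.
  apply: le_trans hK; apply: ereal_sup_ubound; exists v' => //; split=> //.
  by rewrite (barron_norm_spectrum Bv') I1.
rewrite Ll// mulrBl mul1r subrK ComplexField.Normc.normcM normcR ger0_norm ?invr_ge0// lee_fin.
by rewrite mulrC ler_pdivrMr.
Qed.

End barron_dual.

(** * The extension map and restriction to Schwartz functions *)

Section tbarron_dual.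
Context (R : realType) (n : nat) (s : R) (s0 : 0 <= s).
Local Notation mu := (@lebesgue_rV R n).
Local Notation w x := (japanese x `^ s).
Local Notation Re := (@complex.Re R).
Local Notation Im := (@complex.Im R).
Local Notation B := (@barron R n s).
Local Notation B' := (dual_space (@barron R n s) (@barron_norm R n s)).
Local Notation tB := (@tbarron R n s).
Implicit Types (phi psi g h v : cfun R n) (L f : cfun R n -> cplx R).

(** A representative of the inverse transform of f that satisfies the bound at every point, so that
    products with elements of the weighted space are dominated pointwise. *)
Definition bounded_density (K : R) g f := represents g (dist_inv_fourier f) /\
  forall x : 'rV[R]_n, normc (g x) <= K * w x.

Lemma tbarron_norm_leP f (K : R) : 0 <= K ->
  (tbarron_norm s f <= K%:E)%E <->
  {ae mu, forall x : 'rV[R]_n, normc (density (dist_inv_fourier f) x) <= K * w x}.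
Proof.
move=> K0.
have E (x : 'rV[R]_n) : (`|(japanese x `^ (- s) * normc (density (dist_inv_fourier f) x))%R%:E|
    <= K%:E)%E = (normc (density (dist_inv_fourier f) x) <= K * w x).
  rewrite abse_EFin lee_fin ger0_norm ?mulr_ge0 ?powR_ge0 ?normc_ge0// powRN.
  by rewrite mulrC ler_pdivrMr ?japanese_powR_gt0.
(* By convention the norm is 0 if the whole space has measure 0; in that case every property holds
   almost everywhere. *)
rewrite /tbarron_norm unlock; case: ifPn => [_|mu0].
  split=> [/ess_supP|h]; [|apply/ess_supP]; [|move: h]; apply: filterS => x /=;
    by rewrite -E.
rewrite lee_fin K0; split=> // _; exists setT; split=> //.
by apply/eqP; rewrite eq_le measure_ge0 andbT leNgt.
Qed.

Lemma bounded_density_tbarron_norm (K : R) g f : 0 <= K -> bounded_density K g f ->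
  (tbarron_norm s f <= K%:E)%E.
Proof.
move=> K0 [rg gK]; apply/tbarron_norm_leP => //.
have rd := represents_density (ex_intro _ g rg).
by have := represents_ae rd rg (fun _ _ => erefl); apply: filterS => x ->.
Qed.

Lemma tbarron_norm_ge0 f : (0 <= tbarron_norm s f)%E.
Proof. exact: Lnorm_ge0. Qed.

(* Redefining the density as 0 where the almost sure bound fails makes the bound hold
   everywhere. *)
Lemma bounded_density_exists (K : R) f : 0 <= K ->
  (exists g, represents g (dist_inv_fourier f)) -> (tbarron_norm s f <= K%:E)%E ->
  exists g, bounded_density K g f.
Proof.
move=> K0 eg /(tbarron_norm_leP _ K0) dK.
have /representsP[md hd] := represents_density eg.
set d := density _ in dK md hd.
pose A := [set x : 'rV[R]_n | normc (d x) <= K * w x].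
have mA : measurable A.
  have mAe : measurable_fun setT (fun x : 'rV[R]_n => normc (d x) - K * w x).
    apply: measurable_funB; first exact: cmeas_normc.
    by apply: measurable_funM => //; exact: measurable_japanese_powR.
  rewrite -[A]setTI (_ : A = (fun x => normc (d x) - K * w x) @^-1` `]-oo, 0]); last first.
    by apply/seteqP; split=> x /=; rewrite /A/= in_itv/= subr_le0.
  exact: mAe.
pose g x : cplx R := d x * (\1_A x : R)%:C.
have mg : cmeas g by apply: cmeasM => //; apply: cmeas_real; exact: measurable_indic.
have dg : {ae mu, forall x, d x = g x}.
  by move: dK; apply: filterS => x dx; rewrite /g indicE mem_set// mulr1.
exists g; split.
  apply/representsP; split=> // phi sp; have [i e] := hd _ sp.
  have mphi := cintg_cmeas (schwartz_cintg sp).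
  have dg' : {ae mu, forall x, d x * phi x = g x * phi x}.
    by move: dg; apply: filterS => x ->.
  split; first by apply: ae_eq_cintg dg' i; exact: cmeasM.
  by rewrite e; apply: ae_eq_cint dg'; exact: cmeasM.
move=> x; rewrite /g ComplexField.Normc.normcM normcR indicE.
have [xA|xA] := boolP (x \in A).
  by rewrite normr1 mulr1; rewrite inE in xA.
by rewrite normr0 mulr0 mulr_ge0 ?powR_ge0.
Qed.

Lemma bounded_density_lin (k : cplx R) (K K' : R) g g' f f' :
  bounded_density K g f -> bounded_density K' g' f' ->
  bounded_density (normc k * K + K') (fun x => k * g x + g' x)
    (fun phi => k * f phi + f' phi).
Proof.
move=> [rg gK] [rg' gK']; split; last first.
  move=> x; rewrite (le_trans (normcD _ _))// ComplexField.Normc.normcM mulrDl -mulrA lerD//.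
  by rewrite ler_wpM2l ?normc_ge0.
have /representsP[m hm] := represents_lin k rg rg'.
apply/representsP; split=> // phi sp; have [i e] := hm _ sp; split=> //.
by rewrite -e !dist_inv_fourierE.
Qed.

Lemma bounded_density_cintg (K : R) g f h : bounded_density K g f -> weighted s h ->
  cintg mu (fun x => g x * h x) /\
  normc (cint mu (fun x => g x * h x)) <= K * wnorm s h.
Proof.
move=> [/representsP[mg _] gK] [mh hi].
have bound x : normc (g x * h x) <= K * (w x * normc (h x)).
  by rewrite ComplexField.Normc.normcM mulrA ler_wpM2r ?normc_ge0.
have i : cintg mu (fun x => g x * h x).
  by apply: (cintg_le _ bound); [exact: cmeasM|exact: intgZ].
split=> //; rewrite (le_trans (normc_cint i))// -RintegralZl//.
by apply: le_Rintegral => //; [exact: intg_normc|exact: intgZ].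
Qed.

Definition extension f : cfun R n -> cplx R := patch (fun=> 0) B
  (fun v => cint mu (fun x => density (dist_inv_fourier f) x * spectrum v x)).

(** Any bounded representative can replace the chosen density, as the two agree almost
    everywhere. *)
Lemma extensionE (K : R) g f v : bounded_density K g f -> B v ->
  extension f v = cint mu (fun x => g x * spectrum v x).
Proof.
move=> [rg gK] Bv; rewrite /extension patchE mem_set//.
have rd := represents_density (ex_intro _ g rg).
have [msp _] := weighted_spectrum Bv.
apply: ae_eq_cint; [apply: cmeasM => //; exact: rd.1|apply: cmeasM => //; exact: rg.1|].
by have := represents_ae rd rg (fun _ _ => erefl); apply: filterS => x ->.
Qed.

Lemma extension_out f v : ~ B v -> extension f v = 0.
Proof. by move=> nBv; rewrite /extension patchE memNset. Qed.

Lemma extension_lin (k : cplx R) (K K' : R) g g' f f' :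
  bounded_density K g f -> bounded_density K' g' f' ->
  extension (fun phi => k * f phi + f' phi) = fun v => k * extension f v + extension f' v.
Proof.
move=> bg bg'; apply/funext => v; have [Bv|nBv] := pselect (B v); last first.
  by rewrite !extension_out// mulr0 addr0.
have wv := weighted_spectrum Bv.
rewrite (extensionE (bounded_density_lin k bg bg') Bv) (extensionE bg Bv) (extensionE bg' Bv).
have [i _] := bounded_density_cintg bg wv; have [i' _] := bounded_density_cintg bg' wv.
rewrite -cintZ// -cintD//; last exact: cintgZ.
by congr (cint mu _); apply/funext => x; rewrite mulrDl mulrA.
Qed.

Lemma extension_bound (K : R) g f v : bounded_density K g f -> B v ->
  normc (extension f v) <= K * wnorm s (spectrum v).
Proof.
move=> bg Bv; rewrite (extensionE bg Bv).
by have [] := bounded_density_cintg bg (weighted_spectrum Bv).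
Qed.

Lemma extension_dual (K : R) g f : 0 <= K -> bounded_density K g f -> B' (extension f).
Proof.
move=> K0 bg; apply/dual_spaceP; split; last by move=> v; exact: extension_out.
- move=> k u v Bu Bv; have Bk := barron_lin s0 k Bu Bv.
  rewrite (extensionE bg Bk) (extensionE bg Bu) (extensionE bg Bv).
  have [iu _] := bounded_density_cintg bg (weighted_spectrum Bu).
  have [iv _] := bounded_density_cintg bg (weighted_spectrum Bv).
  have [ik _] := bounded_density_cintg bg (weighted_spectrum Bk).
  rewrite -cintZ// -cintD//; last exact: cintgZ.
  apply: ae_eq_cint; first exact: cintg_cmeas ik.
    exact: cintg_cmeas (cintgD (cintgZ k iu) iv).
  have := spectrum_lin s0 k Bu Bv; apply: filterS => x ->; ring.
- by exists K => // v Bv; exact: extension_bound bg Bv.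
Qed.

(** Since phi is the inverse transform of [fourier phi], the value f phi is the inverse transform of
    f evaluated at [fourier phi], that is, the integral of g against it. *)
Lemma extension_schwartz (K : R) g f phi : bounded_density K g f -> schwartz phi ->
  extension f phi = f phi.
Proof.
move=> bg sp; have [rg gK] := bg; have Bp := schwartz_barron s0 sp.
have sf := fourier_schwartz sp.
rewrite (extensionE bg Bp) -{2}(inv_fourierK sp) -dist_inv_fourierE//.
have /representsP[mg /(_ _ sf)[i ->]] := rg.
apply: ae_eq_cint; [|exact: cintg_cmeas i|].
  by apply: cmeasM => //; have [] := weighted_spectrum Bp.
by have := spectrum_schwartz s0 sp; apply: filterS => x ->.
Qed.

Lemma tbarron_bounded_density f : tB f ->
  exists K g, [/\ 0 <= K, tbarron_norm s f = K%:E & bounded_density K g f].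
Proof.
move=> [_ eg lt]; have ge := tbarron_norm_ge0 f.
have fK : tbarron_norm s f = (fine (tbarron_norm s f))%:E by rewrite fineK// ge0_fin_numE.
have K0 : 0 <= fine (tbarron_norm s f) by exact: fine_ge0.
have [g bg] := bounded_density_exists K0 eg (eq_ind_r (fun z => z <= _)%E (lexx _) fK).
by exists (fine (tbarron_norm s f)), g.
Qed.

(** The inclusion of the Schwartz space into B^s is continuous at 0, with a bound linear in the size
    of the seminorms. *)
Lemma barron_norm_small : exists (N : nat) (C : R), 0 <= C /\
  forall (d : R) phi, schwartz phi -> schwartz_small N d phi ->
  wnorm s (spectrum phi) <= C * d.
Proof.
have [k hk] := @japanese_powR_le_weight R n s.
have [N [C hC]] := @trig_small R n k.
(* There are four integrals: the cosine and sine transforms of the real and imaginary parts of phi.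
   The maximum makes the constant nonnegative. *)
exists N, (4 * Num.max C 0); split; first by rewrite mulr_ge0// le_max lexx orbT.
move=> d phi sp small.
have ip := schwartz_cintg sp; have /schwartzP[sr si] := sp.
have d0 : 0 <= d.
  have /ltW := small [::] [::] isT isT 0; apply: le_trans.
  by rewrite mulr_ge0// normc_ge0.
have [cr' ss'] : \int[mu]_xi (rV_weight xi ^+ k * `|trig_transform cos (fun x => Re (phi x)) xi|) <= C * d /\
    \int[mu]_xi (rV_weight xi ^+ k * `|trig_transform sin (fun x => Re (phi x)) xi|) <= C * d.
  apply: hC => // a b sa sb x; apply: le_trans (ltW (small a b sa sb x)).
  by rewrite ler_wpM2l//; exact: (normRe_le (cpartial b phi x)).
have [ci' si'] : \int[mu]_xi (rV_weight xi ^+ k * `|trig_transform cos (fun x => Im (phi x)) xi|) <= C * d /\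
    \int[mu]_xi (rV_weight xi ^+ k * `|trig_transform sin (fun x => Im (phi x)) xi|) <= C * d.
  apply: hC => // a b sa sb x; apply: le_trans (ltW (small a b sa sb x)).
  by rewrite ler_wpM2l//; exact: (normIm_le (cpartial b phi x)).
have [tcr tsr] := rschwartz_trig sr; have [tci tsi] := rschwartz_trig si.
have W0 (x : 'rV[R]_n) : 0 <= rV_weight x ^+ k by rewrite exprn_ge0// ltW// rV_weight_gt0.
have iW (f : 'rV[R]_n -> R) : rschwartz f -> intg mu (fun x => rV_weight x ^+ k * `|f x|).
  move=> sf; have := intg_norm (intg_rschwartz_weight k sf).
  by under [X in _ (_ \o X)]eq_fun do rewrite normrM (ger0_norm (W0 _)).
have wf := schwartz_weighted s (fourier_schwartz sp).
have -> : wnorm s (spectrum phi) = wnorm s (fourier phi).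
  by have := inv_fourier_norm s0 wf; rewrite inv_fourierK.
pose F x := rV_weight x ^+ k * `|trig_transform cos (fun x => Re (phi x)) x| +
  rV_weight x ^+ k * `|trig_transform sin (fun x => Re (phi x)) x| +
  (rV_weight x ^+ k * `|trig_transform cos (fun x => Im (phi x)) x| +
  rV_weight x ^+ k * `|trig_transform sin (fun x => Im (phi x)) x|).
have i1 := iW _ tcr; have i2 := iW _ tsr; have i3 := iW _ tci; have i4 := iW _ tsi.
apply: (@le_trans _ _ (\int[mu]_x F x)).
  apply: le_Rintegral => //; [exact: wf.2|by apply: intgD; apply: intgD|].
  move=> x _; rewrite (le_trans (ler_wpM2r (normc_ge0 _) (hk x)))//.
  rewrite /F -!mulrDr ler_wpM2l// (le_trans (normc_le _))// fourierE.
  have [-> ->] := oscillatory_ReIm (@sqrN1 R) x ip.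
  rewrite opprK mul1r mulN1r (le_trans (lerD (ler_normD _ _) (ler_normB _ _)))//.
  have arr (a b c e : R) : a + b + (c + e) <= a + e + (c + b).
    by rewrite addrACA [b + e]addrC addrACA.
  exact: arr.
rewrite /F !RintegralD//; try exact: intgD.
have Cd : C * d <= Num.max C 0 * d by rewrite ler_wpM2r// le_max lexx.
rewrite (le_trans (lerD (lerD cr' ss') (lerD ci' si')))//.
have -> : 4 * Num.max C 0 * d = Num.max C 0 * d + Num.max C 0 * d +
  (Num.max C 0 * d + Num.max C 0 * d) by ring.
by rewrite !lerD.
Qed.

Lemma dual_restriction_tempered L : B' L -> tempered (patch (fun=> 0) schwartz L).
Proof.
move=> /dual_spaceP[Ll [M M0 hM] _].
have PE phi : schwartz phi -> patch (fun=> 0) schwartz L phi = L phi.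
  by move=> sp; rewrite patchE mem_set.
split.
- move=> k u v su sv; have sku : schwartz (k *: u) by exact: schwartzZ.
  rewrite !PE//; last exact: schwartzD.
  by apply: Ll; exact: schwartz_barron.
- move=> phi sp e e0; have [N [C [C0 hC]]] := barron_norm_small.
  (* The summand 1 keeps the denominator positive and makes M C d < e strict. *)
  pose d := e / (M * C + 1).
  have MC1 : 0 < M * C + 1 by rewrite ltr_wpDl// mulr_ge0.
  have d0 : 0 < d by rewrite divr_gt0.
  exists N, d; split=> // psi spsi small.
  rewrite !PE//; have sB := schwartzB spsi sp.
  have -> : L psi - L phi = L (psi - phi).
    have -> : psi - phi = fun x => -1 * phi x + psi x.
      by apply/funext => x; rewrite mulN1r addrC.
    by rewrite Ll ?mulN1r 1?addrC//; exact: schwartz_barron.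
  rewrite (le_lt_trans (hM _ (schwartz_barron s0 sB)))//.
  rewrite (le_lt_trans (ler_wpM2l M0 (hC _ _ sB small)))//.
  rewrite mulrA /d mulrCA gtr_pMr// ltr_pdivrMr// mul1r ltrDl//.
- by move=> phi nsp; rewrite patchE memNset.
Qed.

Lemma dual_restriction_density L (M : R) : B' L -> 0 <= M ->
  (forall v, B v -> normc (L v) <= M * wnorm s (spectrum v)) ->
  exists g, bounded_density (2 * M) g (patch (fun=> 0) schwartz L).
Proof.
move=> BL M0 hM; have [g [mg gM hg]] := dual_representation s0 BL M0 hM.
exists g; split=> //; apply/representsP; split=> // phi sp.
have [i e] := hg _ (schwartz_weighted s sp); split=> //.
by rewrite dist_inv_fourierE// patchE mem_set//; exact: inv_fourier_schwartz.
Qed.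

Lemma dual_eq L L' : B' L -> B' L' -> (forall phi, schwartz phi -> L phi = L' phi) -> L = L'.
Proof.
move=> BL BL' LL'; apply/funext => v; apply/eqP; rewrite -subr_eq0; apply/eqP.
apply: (dual_schwartz_eq0 s0 (dual_sub BL BL')) => phi sp.
have -> : (L - L') phi = L phi - L' phi by [].
by apply/eqP; rewrite subr_eq0 LL'.
Qed.

End tbarron_dual.

(** The isomorphism is [extension s]. It does not increase norms, and its inverse, restriction to
    the Schwartz space, at most doubles them. *)
Theorem proposition2p2 (R : realType) (n : nat) (s : R) (s_ge0 : 0 <= s) :
  let B := @barron R n s in
  let B' := dual_space B (barron_norm s) in
  let tB := @tbarron R n s in
  [/\ (forall f, tB f -> forall phi, schwartz phi ->
        f phi = cintegral (fun xi =>
          ((japanese xi `^ (- s))%:C * density (dist_inv_fourier f) xi) *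
          ((japanese xi `^ s)%:C * fourier phi xi))),
      (forall f, tB f ->
        exists! L, B' L /\ forall phi, schwartz phi -> L phi = f phi) &
      exists T : (cfun R n -> cplx R) -> (cfun R n -> cplx R),
        [/\ (forall f, tB f -> B' (T f) /\
              forall phi, schwartz phi -> T f phi = f phi),
            linear_on tB T,
            set_bij tB B' T,
            normwise_continuous tB (tbarron_norm s) (dual_norm B (barron_norm s)) T
          & normwise_continuous B' (dual_norm B (barron_norm s)) (tbarron_norm s)
              ('pinv_(fun=> 0) tB T)]].
Proof.
move=> B B' tB.
have ext f : tB f -> B' (extension s f) /\ forall phi, schwartz phi -> extension s f phi = f phi.
  move=> /tbarron_bounded_density[K [g [K0 _ bg]]]; split.
    exact: (extension_dual s_ge0 K0 bg).
  by move=> phi; exact: (extension_schwartz s_ge0 bg).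
have extB (k : cplx R) f f' : tB f -> tB f' ->
    extension s (k *: f + f') = k *: extension s f + extension s f'.
  move=> /tbarron_bounded_density[K [g [_ _ bg]]] /tbarron_bounded_density[K' [g' [_ _ bg']]].
  exact: (extension_lin k bg bg').
(* Differences are put in the form k f' + f, the one covered by the linearity of the extension and
   of bounded densities. *)
have subE f f' : f - f' = -1 *: f' + f :> (cfun R n -> cplx R).
  by rewrite scaleN1r addrC.
have bij : set_bij tB B' (extension s).
  split.
  - by move=> f /ext[].
  - move=> f f'; rewrite !inE => tf tf' ff'; apply/funext => phi.
    have [sp|nsp] := pselect (schwartz phi).
      by rewrite -(ext _ tf).2// -(ext _ tf').2// ff'.
    by have [[_ _ vf] _ _] := tf; have [[_ _ vf'] _ _] := tf'; rewrite vf// vf'.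
  (* The preimage of L is its restriction to the Schwartz space, set to 0 elsewhere. Its extension
     agrees with L on Schwartz functions, hence on all of B^s. *)
  - move=> L BL; have /dual_spaceP[_ [M M0 hM] _] := BL.
    have [g bg] := dual_restriction_density s_ge0 BL M0 hM.
    have M20 : 0 <= 2 * M by rewrite mulr_ge0.
    pose f := patch (fun=> 0) schwartz L : cfun R n -> cplx R.
    have tf : tB f.
      split; first exact: (dual_restriction_tempered s_ge0 BL).
        by exists g; exact: bg.1.
      exact: le_lt_trans (bounded_density_tbarron_norm M20 bg) (ltry _).
    exists f => //; have [Bf fE] := ext _ tf; apply: (dual_eq s_ge0 Bf BL) => phi sp.
    by rewrite fE// /f patchE mem_set.
split.
(* The weights <xi>^-s and <xi>^s cancel pointwise, and inversion turns f phi into the inverse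
   transform of f tested on [fourier phi]. *)
- move=> f tf phi sp; have [K [g [K0 _ bg]]] := tbarron_bounded_density tf.
  have rd := represents_density (ex_intro _ g bg.1).
  have /representsP[_ /(_ _ (fourier_schwartz sp))[_]] := rd.
  rewrite dist_inv_fourierE ?inv_fourierK//; last exact: fourier_schwartz.
  move=> ->; congr cintegral; apply/funext => x.
  rewrite mulrACA -rmorphM powRN mulVf ?mul1r//.
  by rewrite gt_eqF// japanese_powR_gt0.
- move=> f tf; exists (extension s f); split; first exact: ext.
  move=> L [BL Lf]; have [Bf fE] := ext _ tf.
  by apply: (dual_eq s_ge0 Bf BL) => phi sp; rewrite fE// Lf.
exists (extension s); split=> //.
(* The radius e itself works: the difference has a representative bounded by exactly its norm times
   <xi>^s, which bounds the extension by the same number. *)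
- move=> f tf e e0; exists e => // f' tf'.
  have [K [g [K0 _ bg]]] := tbarron_bounded_density tf.
  have [K' [g' [K0' _ bg']]] := tbarron_bounded_density tf'.
  rewrite !subE -extB//.
  have bd := bounded_density_lin (-1) bg bg'.
  have T0 := tbarron_norm_ge0 s (-1 *: f + f').
  move=> lt; have fin : tbarron_norm s (-1 *: f + f') \is a fin_num.
    by rewrite ge0_fin_numE// (lt_trans lt)// ltry.
  have [g1 bg1] : exists g1, bounded_density s (fine (tbarron_norm s (-1 *: f + f'))) g1 (-1 *: f + f').
    apply: bounded_density_exists; [exact: fine_ge0|eexists; exact: bd.1|by rewrite fineK].
  apply: le_lt_trans lt; rewrite -[leRHS]fineK//.
  apply: dual_norm_le => //; first exact: fine_ge0.
  by move=> v; exact: extension_bound bg1.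
(* The half compensates the factor 2 lost in representing real and imaginary parts separately. *)
- move=> L BL e e0; exists (e / 2) => [|L' BL']; first by rewrite divr_gt0.
  set U := 'pinv_ _ _ _ => lt.
  have UP L1 : B' L1 -> tB (U L1) /\ extension s (U L1) = L1.
    move=> BL1; have [_ _ sur] := bij; split.
      by apply: (surjpinv_image_sub sur); exists L1.
    by have /(_ L1) := surjpK (fun=> 0) sur; rewrite inE; exact.
  have [tU TU] := UP _ BL; have [tU' TU'] := UP _ BL'.
  pose D := L' - L; have BD : B' D := dual_sub BL' BL.
  (* The dual norm is an extended real: the smallness assumption excludes +oo, and the maximum with
     0 provides a nonnegative real bound. *)
  have [K [K0 DK Ke]] : exists K : R, [/\ 0 <= K, (dual_norm B (barron_norm s) D <= K%:E)%E & 2 * K < e].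
    move: lt; rewrite -/D; case: (dual_norm _ _ _) => [r| |]//.
      rewrite lte_fin => re; exists (Num.max 0 r); rewrite le_max lexx lee_fin le_max lexx orbT.
      by split=> //; case: (leP 0 r) => _; lra.
    by exists 0; rewrite mulr0 leNye.
  have [g bg] := dual_restriction_density s_ge0 BD K0 (dual_norm_ge s_ge0 BD K0 DK).
  (* The inverse images are determined on Schwartz functions by L and L' and vanish elsewhere, so
     their difference is the restriction of D. *)
  have -> : U L' - U L = patch (fun=> 0) schwartz D.
    apply/funext => phi; rewrite patchE; have -> : (U L' - U L) phi = U L' phi - U L phi by [].
    have [sp|nsp] := pselect (schwartz phi).
      by rewrite mem_set// -(ext _ tU).2// -(ext _ tU').2// TU TU'.
    rewrite memNset//.
    by have [[_ _ vU] _ _] := tU; have [[_ _ vU'] _ _] := tU'; rewrite vU// vU'// subrr.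
  apply: le_lt_trans (bounded_density_tbarron_norm _ bg) _; first by rewrite mulr_ge0.
  by rewrite lte_fin.
Qed.
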